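(* For every $w\in S_{\mathbb Z}$ and every partition $\lambda$, $$\sum_{\alpha\in\operatorname{Orb}(\lambda)}\overleftarrow{\kappa^w_\alpha}=[e_\lambda]F_w,\qquad \sum_{\alpha\in\operatorname{Orb}(\lambda)}\overleftarrow{\kappa^{\widehat w}_{\widehat\alpha}}=[h_\lambda]F_w,$$ where $[e_\lambda]F_w$ and $[h_\lambda]F_w$ are the coefficients of $e_\lambda$ and $h_\lambda$ in the expansions of the Stanley symmetric function $F_w$ in the elementary and complete homogeneous bases of $\Lambda$, respectively.
   Context: Ring. $\Lambda^-=\Lambda(\ldots,x_{-1},x_0)$ is the ring of symmetric functions over $\mathbb Q$ in the variables $x_i$, $i\le 0$, and $\mathcal R=\Lambda^-\otimes_{\mathbb Q}\mathbb Q[x_i\mid i\in\mathbb Z]$, identified via multiplication with a ring of bounded-degree formal power series in the variables $x_i$, $i\in\mathbb Z$. $\Lambda$ is the ring of symmetric functions over $\mathbb Q$ in $x_1,x_2,\ldots$. Back stable SEMs. $\mathcal C$ is the set of finitely supported tuples $\alpha=(\alpha_i)_{i\in\mathbb Z}$ of nonnegative integers. For $\alpha\in\mathcal C$, $\overleftarrow{\mathbf e}_\alpha=\prod_{i\in\mathbb Z}\mathbf e_{\alpha_i}(\ldots,x_{i-1},x_i)\in\mathcal R$, where $\mathbf e_d(\ldots,x_{k-1},x_k)$ is the elementary symmetric function in the variables $x_i$, $i\le k$. These form a $\mathbb Q$-basis of $\mathcal R$. For a partition $\lambda$, $\operatorname{Orb}(\lambda)$ is the set of $\alpha\in\mathcal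 C$ whose nonzero entries, sorted in weakly decreasing order, form $\lambda$. Permutations. $S_{\mathbb Z}$ is the group of permutations of $\mathbb Z$ moving only finitely many integers; $S_\infty\subset S_{\mathbb Z}$ is the subgroup of those fixing every $i\le 0$; $s_i=(i,i+1)$; $\ell$ is Coxeter length. The shift $\gamma$ acts by $\gamma(w)(i)=w(i-1)+1$ and $\gamma(x_i)=x_{i+1}$; for $w\in S_\infty$, $1^m\times w=\gamma^m(w)$. Dynkin reversal: $\widehat w(i)=1-w(1-i)$ for $w\in S_{\mathbb Z}$, and $\widehat\alpha_i=\alpha_{-i}$ for $\alpha\in\mathcal C$. Schubert polynomials. For $w\in S_\infty$, $\mathfrak S_w$ is the usual Schubert polynomial: $\mathfrak S_{w_0}=x_1^{n-1}x_2^{n-2}\cdots x_{n-1}$ for the longest $w_0\in S_n$, and $\partial_i\mathfrak S_w=\mathfrak S_{ws_i}$ whenever $\ell(ws_i)<\ell(w)$, where $\partial_i f=(f-s_if)/(x_i-x_{i+1})$. For $w\in S_{\mathbb Z}$, $\overleftarrow{\mathfrak S}_w=\lim_{m\to\infty}\gamma^{-m}\big(\mathfrak S_{\gamma^m(w)}\big)\in\mathcal R$ (coefficientwise limit, over $m$ with $\gamma^m(w)\in S_\infty$). The coefficients $\overleftarrow{\kappa^w_\alpha}$ are defined by $\overleftarrow{\mathfrak S}_w=\sum_{\alpha\in\mathcal C}\overleftarrow{\kappa^w_\alpha}\,\overleftarrow{\mathbf e}_\alpha$. Stanley symmetric functions. For $w\in S_\infty$, $F_w=\lim_{m\to\infty}\mathfrak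 S_{1^m\times w}\in\Lambda$ (coefficientwise limit); this is extended to $w\in S_{\mathbb Z}$ by requiring $F_{\gamma(w)}=F_w$. *)

(* Defs.v *)
From mathcomp Require Import all_boot all_order all_algebra finmap.
From mathcomp Require Import boolp classical_sets functions cardinality fsbigop.
From mathcomp.multinomials Require Import monalg.

Set Implicit Arguments.
Unset Strict Implicit.
Unset Printing Implicit Defensive.

Import Order.TTheory GRing.Theory Num.Theory.

Local Open Scope classical_set_scope.
Local Open Scope ring_scope.

(* {cmonom int} is the type of finitely supported functions int -> nat, with
   pointwise addition as its monoid law.  It serves both as the set C of tuples
   alpha and as the set of monomials in the variables x_i, i in Z. *)
Definition tuples := {cmonom int}.

Definition poly_ring := {malg rat[{cmonom int}]}.

Definition var (i : int) : poly_ring := << ucm i >>.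

(* The monomial \prod_i x_(g i) ^ (b i), for b = \prod_i x_i ^ (b i). *)
Definition rename (g : int -> int) (b : {cmonom int}) : {cmonom int} :=
  \big[mmul/mone]_(i <- finsupp (cmonom_val b)) expcmn (ucm (g i)) (b i).

Lemma expcmnE (b : {cmonom int}) n j : expcmn b n j = (n * b j)%N.
Proof.
elim: n => [|[|n] IH]; first exact: onecmE; first by rewrite mul1n.
by rewrite mulSn -IH; exact: mulcmE.
Qed.

Lemma renameE (g : int -> int) (b : {cmonom int}) (i : int) :
  injective g -> rename g b (g i) = b i.
Proof.
move=> g_inj; have -> : rename g b (g i)
    = (\sum_(k <- finsupp (cmonom_val b)) (k == i) * b k)%N.
  rewrite /rename; elim: (enum_fset _) => [|k r IH]; first by rewrite !big_nil cm1.
  by rewrite !big_cons cmM IH expcmnE cmU (inj_eq g_inj) mulnC.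
have [ib|ib] := boolP (i \in finsupp (cmonom_val b)).
  rewrite (big_fsetD1 i) //= eqxx mul1n big1_seq ?addn0 // => k.
  by rewrite in_fsetD1 => /and3P[_ /negPf->].
rewrite big1_seq => [|k /andP[_ kb]].
  by apply/esym/eqP; rewrite cmE_eq0.
by case: eqVneq kb ib => // -> ->.
Qed.

(* Formal power series, as coefficient functions. *)
Definition series := {cmonom int} -> rat.

Definition sone : series := fun b => (b == mone)%:R.

Definition smul (f g : series) : series := fun b =>
  \sum_(p \in [set p : {cmonom int} * {cmonom int} | mmul p.1 p.2 = b])
     f p.1 * g p.2.

(* The elementary and complete homogeneous symmetric functions of degree d in
   the variables x_i, i in V. *)
Definition esym (V : pred int) (d : nat) : series := fun b =>
  ((mdeg b == d) &&
   all (fun i => V i && (b i == 1%N)) (finsupp (cmonom_val b)))%:R.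

Definition hsym (V : pred int) (d : nat) : series := fun b =>
  ((mdeg b == d) && all V (finsupp (cmonom_val b)))%:R.

(* Factors with alpha_i = 0 are e_0 = 1 and are left out. *)
Definition sem (alpha : tuples) : series :=
  \big[smul/sone]_(i <- finsupp (cmonom_val alpha))
    esym (fun j => j <= i) (alpha i).

Definition is_part (l : seq nat) : bool := sorted geq l && (0%N \notin l).

Definition intpart := {l : seq nat | is_part l}.

Definition e_ (l : intpart) : series :=
  \big[smul/sone]_(d <- val l) esym (fun i => 1 <= i) d.

Definition h_ (l : intpart) : series :=
  \big[smul/sone]_(d <- val l) hsym (fun i => 1 <= i) d.

Definition Orb (l : intpart) : set tuples :=
  [set alpha : tuples | sort geq [seq alpha i | i <- finsupp (cmonom_val alpha)]
                         = val l].

Definition hat_tuple (alpha : tuples) : tuples := rename -%R alpha.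

(* [coef B f i] is the coefficient of B i in the (finite) expansion of f in the
   family B, which is unique when B is linearly independent; it is 0 when f is
   not in the span of B. *)
Definition expansion (I : choiceType) (B : I -> series) (f : series) :
    set (I -> rat) :=
  [set c | finite_set [set i | c i != 0] /\
           forall b, f b = \sum_(i \in [set: I]) c i * B i b].

Definition coef (I : choiceType) (B : I -> series) (f : series) : I -> rat :=
  xget (fun=> 0) (expansion B f).

Definition S_Z : set (int -> int) :=
  [set w | bijective w /\ finite_set [set i | w i != i]].

Definition S_infty : set (int -> int) :=
  [set w | S_Z w /\ forall i, i <= 0 -> w i = i].

Definition simple_tr (i : int) : int -> int :=
  fun j => if j == i then i + 1 else if j == i + 1 then i else j.

Definition word_prod (a : seq int) : int -> int :=
  foldr (fun i w => simple_tr i \o w) id a.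

Definition has_word (w : int -> int) (n : nat) : Prop :=
  exists2 a : seq int, size a = n & word_prod a = w.

(* Coxeter length: the least length of a word in the simple transpositions. *)
Definition cox_length (w : int -> int) : nat :=
  xget 0%N [set n | has_word w n /\ forall k, has_word w k -> (n <= k)%N].

(* gamma ^ m *)
Definition shift (m : nat) (w : int -> int) : int -> int :=
  fun i => w (i - m%:Z) + m%:Z.

Definition shift_monom (m : nat) : {cmonom int} -> {cmonom int} :=
  rename (fun i => i + m%:Z).

Definition hat (w : int -> int) : int -> int := fun i => 1 - w (1 - i).

(* The longest element of S_n. *)
Definition w0 (n : nat) : int -> int :=
  fun i => if (1 <= i <= n%:Z) then n%:Z + 1 - i else i.

Definition simple_act (i : int) (f : poly_ring) : poly_ring :=
  \sum_(b <- msupp f) << f@_b *g rename (simple_tr i) b >>.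

Definition is_divided_difference (i : int) (f g : poly_ring) : Prop :=
  (var i - var (i + 1)) * g = f - simple_act i f.

Definition schubert_family : set ((int -> int) -> poly_ring) :=
  [set S | (forall n : nat,
              S (w0 n) = \prod_(1 <= i < n) var i%:Z ^+ (n - i)) /\
           (forall w i, S_infty w -> 1 <= i ->
              (cox_length (w \o simple_tr i) < cox_length w)%N ->
              is_divided_difference i (S w) (S (w \o simple_tr i)))].

(* Only the values on S_infty, where the family is unique, are meaningful. *)
Definition schubert : (int -> int) -> poly_ring := xget (fun=> 0) schubert_family.

(* The limit of an eventually constant sequence. *)
Definition stable_lim (u : nat -> rat) : rat :=
  xget 0 [set c | exists N, forall m, (N <= m)%N -> u m = c].

(* For w in S_Z, shift m w is in S_infty for all large m.  The coefficient of b
   in gamma ^ (-m) f is that of gamma ^ m b in f. *)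
Definition back_stable_schubert (w : int -> int) : series :=
  fun b => stable_lim (fun m => (schubert (shift m w))@_(shift_monom m b)).

Definition kappa (w : int -> int) : tuples -> rat :=
  coef sem (back_stable_schubert w).

(* On S_infty this is the limit of the Schubert polynomials of 1^m x w.  The
   same formula gives the shift-invariant extension to S_Z: the sequence for
   gamma w is that for w without its first term. *)
Definition stanley (w : int -> int) : series :=
  fun b => stable_lim (fun m => (schubert (shift m w))@_b).

(* Main.v *)
From HB Require Import structures.
Require Import Defs.
From mathcomp Require Import all_boot all_order all_algebra finmap perm.
From mathcomp Require Import boolp classical_sets functions cardinality fsbigop.
From mathcomp.multinomials Require Import monalg.
From mathcomp Require Import zify.
From Stdlib Require Import Ring.

(* Idea.  Fomin and Stanley: with A_i(x) = ... (1 + x u_(i+1)) (1 + x u_i) in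
   the nilCoxeter algebra, the coefficient of w in A_1(x_1) A_2(x_2) ... is the
   Schubert polynomial of w.  Hence the back stable Schubert function of w is
   the coefficient of w in ... A_(-1)(x_(-1)) A_0(x_0) A_1(x_1) ..., where all
   factors to the left of the support of w involve the same u's; reading off a
   monomial in variables far to the left gives the Stanley function, and an
   SEM looks there like the product of the e_(alpha_i) in all variables.  This
   yields the first identity, provided that the back stable function is a
   finite combination of SEMs: the span of the SEMs is stable under
   multiplication by all the e_d(..., x_k), hence by the x_k.

   For the second identity write the coefficients of F_w as [w] a_s, where
   a_s is a product of the commuting coefficients a_k of A(x).  Dynkin reversal
   turns A(x) into B(x) = A(-x)^(-1), so the b_k are obtained from the a_k as
   the h_k are from the e_k.  Since the coefficient of x^s in e_t (or h_t) is a
   symmetric function of s and t, the e-coefficients of F_w are the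
   h-coefficients of the Stanley function of the reversal of w. *)

Set Implicit Arguments.
Unset Strict Implicit.
Unset Printing Implicit Defensive.

Import Order.TTheory GRing.Theory Num.Theory.

Local Open Scope classical_set_scope.
Local Open Scope ring_scope.

(** * Power series as a ring *)

(** [kappa] and [coef] pick an expansion by choice and default to 0, so existence must come before
    any comparison. For [kappa] it is obtained by cutting the back stable function at the lower end
    of the support of w: the part below is a symmetric function of the variables there, hence a
    combination of products of e's, and only finitely many factors, polynomial in the x_k, remain.
    The comparison then works for whichever expansion was chosen: grouped by orbits it becomes an
    expansion of F_w in the e_lambda, and that one is unique. The nilCoxeter algebra appears only
    through its right action on functions of permutations; infinite products are replaced by finite
    ones agreeing on all permutations of a bounded window. Symmetric functions are handled through
    their coefficients, which count matrices with bounded entries and given row and column sums;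
    transposing matrices is the symmetry behind the second identity. The commutation A(x) A(y) =
    A(y) A(x) serves twice: it makes the stable coefficients symmetric, and it yields the divided
    differences that identify the products with Schubert polynomials. *)

Notation monom := {cmonom int}.

Lemma cmonom_ext (b c : monom) : (forall i, b i = c i) -> b = c.
Proof. by move=> bc; apply/eqP/cmP. Qed.

Definition agrees (D : set monom) (f : series) (P : poly_ring) :=
  forall b, D b -> f b = P@_b.

Definition divisor_closed (D : set monom) :=
  forall b c : monom, D (mmul b c) -> D b.

(** The coefficient of a product at b involves only coefficients at divisors of b, so on a
    divisor-closed set series multiply like polynomials. The ring laws of [smul] are transported
    from [poly_ring] in this way. *)
Lemma agrees_mul D f g P Q : divisor_closed D ->
  agrees D f P -> agrees D g Q -> agrees D (smul f g) (P * Q).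
Proof.
move=> Dd fP gQ b Db; rewrite /smul.
pose X := [set p : monom * monom | mmul p.1 p.2 = b].
have -> : \sum_(p \in X) f p.1 * g p.2 = \sum_(p \in X) P@_p.1 * Q@_p.2.
  apply: eq_fsbigr => -[p q]; rewrite inE /X /= => pq.
  by rewrite fP 1?gQ //; [move: Db; rewrite -pq mulmC | move: Db; rewrite -pq] => /Dd.
rewrite mcoeffMl.
pose S : seq (monom * monom) := [seq (p, q) | p <- msupp P, q <- msupp Q].
have uS : uniq S by rewrite allpairs_uniq // => -[a1 a2] [b1 b2].
transitivity (\sum_(p <- S | mmul p.1 p.2 == b) P@_p.1 * Q@_p.2).
  rewrite [RHS]bigfs //; first by apply: eq_fsbigl; apply/seteqP; split => p /= /eqP.
  move=> [p q] _; apply: contraNeq; rewrite mulf_eq0 negb_or => /andP[Pp Qq].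
  by apply/allpairsP; exists (p, q); rewrite -!mcoeff_neq0.
by rewrite big_mkcond big_allpairs; apply: eq_bigr => p _; apply: eq_bigr => q _; rewrite mulrb.
Qed.

Definition divides (c b : monom) := forall i, (c i <= b i)%N.

Lemma divides_mulr c d b : mmul c d = b -> divides c b.
Proof. by move=> <- i; rewrite cmM leq_addr. Qed.

Lemma dividesP c b : divides c b -> exists d, b = mmul c d.
Proof.
move=> cb; exists (divcm b c); apply: cmonom_ext => i.
by rewrite cmM divcmE subnKC.
Qed.

(** A divisor of b is determined by its exponents on the support of b, each at most [mdeg b]. *)
Lemma finite_divisors b : finite_set [set c | divides c b].
Proof.
pose g (c : monom) : {ffun finsupp (cmonom_val b) -> 'I_(mdeg b).+1} :=
  [ffun i => inord (c (val i))].
have g_inj : {in [set c | divides c b] &, injective g}.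
  move=> c d; rewrite !inE /= => cb db gcd; apply: cmonom_ext => i.
  have [ib|] := boolP (i \in finsupp (cmonom_val b)).
    have le_mdeg e : divides e b -> (e i < (mdeg b).+1)%N.
      move=> eb; rewrite ltnS (leq_trans (eb i)) // mdegE (big_fsetD1 i) //=.
      exact: leq_addr.
    have := congr1 (fun h : {ffun finsupp (cmonom_val b) -> 'I_(mdeg b).+1} => val (h (FSetSub ib))) gcd.
    by rewrite /g !ffunE /= !inordK ?le_mdeg.
  by rewrite -cmE_eq0 => /eqP bi0; have := cb i; have := db i; rewrite bi0 !leqn0 => /eqP-> /eqP->.
apply: card_le_finite (@finite_finset _ (g @` [set c | divides c b])).
by have := inj_card_eq g_inj; rewrite card_eq_le => /andP[].
Qed.

Lemma agrees_ex (f : series) (b : monom) :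
  exists P, agrees [set c | divides c b] f P.
Proof.
pose X := fset_set [set c | divides c b].
exists (\sum_(c <- X) << f c *g c >>) => c cb.
rewrite raddf_sum /= (eq_bigr (fun d => f d *+ (d == c))); last by move=> d _; exact: mcoeffU.
rewrite (big_fsetD1 c) /=; last by rewrite in_fset_set ?inE //; exact: finite_divisors.
rewrite eqxx big1_seq /=; first by rewrite addr0.
by move=> d; rewrite in_fsetD1 => /andP[/negPf-> _].
Qed.

Lemma divisor_closed_divides b : divisor_closed [set c | divides c b].
Proof. by move=> c d /= cdb i; apply: leq_trans (cdb i); rewrite cmM leq_addr. Qed.

Lemma agrees_one D : agrees D sone 1.
Proof. by move=> b _; rewrite mcoeff1. Qed.

Lemma smulC f g : smul f g = smul g f.
Proof.
apply/funext => b; have [P fP] := agrees_ex f b; have [Q gQ] := agrees_ex g b.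
have D := @divisor_closed_divides b.
have bb : divides b b by move=> i.
have := agrees_mul D fP gQ bb; rewrite mulrC => ->.
by rewrite (agrees_mul D gQ fP bb).
Qed.

Lemma smulA f g h : smul f (smul g h) = smul (smul f g) h.
Proof.
apply/funext => b; have [P fP] := agrees_ex f b; have [Q gQ] := agrees_ex g b.
have [R hR] := agrees_ex h b.
have D := @divisor_closed_divides b.
have bb : divides b b by move=> i.
have := agrees_mul D fP (agrees_mul D gQ hR) bb.
by have := agrees_mul D (agrees_mul D fP gQ) hR bb; rewrite mulrA => -> ->.
Qed.

Lemma smul1f f : smul sone f = f.
Proof.
apply/funext => b; have [P fP] := agrees_ex f b.
have D := @divisor_closed_divides b.
have bb : divides b b by move=> i.
by rewrite (agrees_mul D (@agrees_one _) fP bb) mul1r fP.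
Qed.

Definition fps : Type := series.

HB.instance Definition _ := gen_eqMixin fps.
HB.instance Definition _ := gen_choiceMixin fps.

(* Locked, since conversion would otherwise unfold sums over all divisors. *)
Definition fps_zero : fps := locked (fun=> 0).
Definition fps_one : fps := locked sone.
Definition fps_opp : fps -> fps := locked (fun f b => - f b).
Definition fps_add : fps -> fps -> fps := locked (fun f g b => f b + g b).
Definition fps_mul : fps -> fps -> fps := locked smul.

Fact fps_zeroE b : fps_zero b = 0. Proof. by rewrite /fps_zero -lock. Qed.
Fact fps_oneE : fps_one = sone. Proof. by rewrite /fps_one -lock. Qed.
Fact fps_oppE f b : fps_opp f b = - f b. Proof. by rewrite /fps_opp -lock. Qed.
Fact fps_addE f g b : fps_add f g b = f b + g b. Proof. by rewrite /fps_add -lock. Qed.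
Fact fps_mulE : fps_mul = smul. Proof. by rewrite /fps_mul -lock. Qed.

Fact fps_addA : associative fps_add.
Proof. by move=> f g h; apply/funext => b; rewrite !fps_addE addrA. Qed.
Fact fps_addC : commutative fps_add.
Proof. by move=> f g; apply/funext => b; rewrite !fps_addE addrC. Qed.
Fact fps_add0 : left_id fps_zero fps_add.
Proof. by move=> f; apply/funext => b; rewrite fps_addE fps_zeroE add0r. Qed.
Fact fps_addN : left_inverse fps_zero fps_opp fps_add.
Proof. by move=> f; apply/funext => b; rewrite fps_addE fps_oppE fps_zeroE addNr. Qed.

HB.instance Definition _ :=
  GRing.isZmodule.Build fps fps_addA fps_addC fps_add0 fps_addN.

Lemma fpsD (f g : fps) b : (f + g) b = f b + g b. Proof. exact: fps_addE. Qed.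
Lemma fpsN (f : fps) b : (- f) b = - f b. Proof. exact: fps_oppE. Qed.
Lemma fpsB (f g : fps) b : (f - g) b = f b - g b.
Proof. by rewrite -fpsN -fpsD. Qed.
Lemma fps0 b : (0 : fps) b = 0. Proof. exact: fps_zeroE. Qed.

Fact fps_mulA : associative fps_mul.
Proof. by rewrite fps_mulE; exact: smulA. Qed.
Fact fps_mulC : commutative fps_mul.
Proof. by rewrite fps_mulE; exact: smulC. Qed.
Fact fps_mul1 : left_id fps_one fps_mul.
Proof. by rewrite fps_mulE fps_oneE; exact: smul1f. Qed.
Fact fps_mulDl : left_distributive fps_mul +%R.
Proof.
rewrite fps_mulE.
move=> f g h; apply/funext => b; have [P fP] := agrees_ex f b.
have [Q gQ] := agrees_ex g b; have [R hR] := agrees_ex h b.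
have D := @divisor_closed_divides b.
have fgPQ : agrees [set c | divides c b] (f + g) (P + Q).
  by move=> c cb; rewrite mcoeffD fpsD -fP // -gQ.
have bb : divides b b by move=> i.
rewrite fpsD (agrees_mul D fgPQ hR bb) (agrees_mul D fP hR bb) (agrees_mul D gQ hR bb).
by rewrite mulrDl mcoeffD.
Qed.

Fact fps_one_neq0 : fps_one != 0.
Proof.
apply/eqP => /(congr1 (fun f : fps => f mone)).
by rewrite fps_oneE /sone eqxx fps0 => /eqP; rewrite oner_eq0.
Qed.

HB.instance Definition _ := GRing.Zmodule_isComNzRing.Build fps
  fps_mulA fps_mulC fps_mul1 fps_mulDl fps_one_neq0.

Lemma fpsME (f g : fps) : f * g = smul f g.
Proof. by rewrite -fps_mulE. Qed.
Lemma fps1E : (1 : fps) = sone. Proof. exact: fps_oneE. Qed.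

Lemma fps_sumE (I : Type) (r : seq I) (F : I -> fps) b :
  (\sum_(i <- r) F i) b = \sum_(i <- r) F i b.
Proof. by elim: r => [|i r IH]; rewrite ?big_nil ?fps0 // !big_cons fpsD IH. Qed.

Definition fps_of (P : poly_ring) : fps := fun b => P@_b.

Lemma fps_of_inj : injective fps_of.
Proof. by move=> P Q PQ; apply/malgP => b; exact: (congr1 (fun f : fps => f b) PQ). Qed.

Fact fps_of_zmod : zmod_morphism fps_of.
Proof. by move=> P Q; apply/funext => b; rewrite fpsB /fps_of mcoeffB. Qed.
HB.instance Definition _ := GRing.isZmodMorphism.Build _ _ fps_of fps_of_zmod.

Fact fps_of_monoid : monoid_morphism fps_of.
Proof.
split=> [|P Q]; first by apply/funext => b; rewrite fps1E /fps_of mcoeff1.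
by apply/esym/funext => b; rewrite fpsME; apply: (@agrees_mul setT).
Qed.
HB.instance Definition _ := GRing.isMonoidMorphism.Build _ _ fps_of fps_of_monoid.

Definition mono : monom -> fps := locked (fun c b => (b == c)%:R).

Lemma monoE c b : mono c b = (b == c)%:R.
Proof. by rewrite /mono -lock. Qed.

Definition X (k : int) : fps := mono (ucm k).

Lemma fps_of_var k : fps_of (var k) = X k.
Proof. by apply/funext => b; rewrite /fps_of mcoeffU1 eq_sym /X monoE. Qed.

(** Scalar multiplication on [fps] is multiplication by these constant series. *)
Definition constf (r : rat) : fps := fun b => if b == mone then r else 0.

Lemma mmulI (c : monom) : injective (mmul c).
Proof.
move=> d e /(congr1 (fun b : monom => b : int -> nat)) cde; apply: cmonom_ext => i.
by have := congr1 (@^~ i) cde; rewrite /= !cmM => /addnI.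
Qed.

Lemma monoM_coef (c d : monom) (f : fps) : (mono c * f) (mmul c d) = f d.
Proof.
rewrite fpsME /smul -(@fsbig_widen _ _ _ _ [set (c, d)]).
- by rewrite fsbig_set1 monoE eqxx mul1r.
- by move=> _ ->.
- move=> [p q] /= [pq npq]; rewrite monoE; case: eqP => [pc|]; last by rewrite mul0r.
  by case: npq; rewrite -pc in pq *; rewrite (mmulI pq).
Qed.

Lemma monoM_coef0 (c b : monom) (f : fps) : ~ divides c b -> (mono c * f) b = 0.
Proof.
move=> ncb; rewrite fpsME /smul fsbig1 // => -[p q] /= pq.
rewrite monoE; case: eqP => [pc|]; last by rewrite mul0r.
by case: ncb; rewrite -pc; apply: divides_mulr pq.
Qed.

Lemma constfM_coef r (f : fps) b : ((constf r : fps) * f) b = r * f b.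
Proof.
rewrite fpsME /smul -(@fsbig_widen _ _ _ _ [set (mone, b)]).
- by rewrite fsbig_set1 /constf eqxx.
- by move=> _ -> /=; rewrite mul1m.
- move=> [p q] /= [pq npq]; rewrite /constf; case: eqP => [p1|]; last by rewrite mul0r.
  by case: npq; rewrite -pq p1 mul1m.
Qed.

Lemma varM_coef k (b : monom) (f : fps) : (X k * f) (mmul (ucm k) b) = f b.
Proof. exact: monoM_coef. Qed.

Lemma varM_coef0 k (b : monom) (f : fps) : b k = 0%N -> (X k * f) b = 0.
Proof. by move=> bk; apply: monoM_coef0 => /(_ k); rewrite cmUU bk. Qed.

Lemma monom_split k (b : monom) : (0 < b k)%N -> exists c, b = mmul (ucm k) c.
Proof.
by move=> bk; apply: dividesP => i; rewrite cmU; case: eqP => // <-.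
Qed.

(** An automorphism of the monoid of monomials permutes the factorizations of b; this makes
    exchanging two variables multiplicative. *)
Lemma smul_comp (r r' : monom -> monom) (f g : fps) : cancel r r' -> cancel r' r ->
    {morph r : b c / mmul b c >-> mmul b c} ->
  forall b, (f * g) (r b) = (((fun c => f (r c)) : fps) * ((fun c => g (r c)) : fps)) b.
Proof.
move=> rK r'K rM b; rewrite !fpsME /smul.
rewrite (@reindex_fsbig _ _ _ _ _ (fun p => (r p.1, r p.2)) [set p | mmul p.1 p.2 = b]) /=.
  by rewrite /smul.
split.
- by move=> [p q] /= <-; rewrite rM.
- by move=> [p q] [p' q'] _ _ /= [] /(can_inj rK) -> /(can_inj rK) ->.
- move=> [p q] /= pq; exists (r' p, r' q) => /=; last by rewrite !r'K.
  by apply: (can_inj rK); rewrite rM !r'K.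
Qed.

(** At the monomial x_i c the equation says that g(c) is the coefficient of g at x_i c / x_j, or 0
    when x_j does not divide c; the exponent of x_j drops until it reaches 0. This makes divided
    differences unique. *)
Lemma cancel_var_sub (i j : int) (g : fps) : i != j -> (X i - X j) * g = 0 -> g = 0.
Proof.
move=> ij g0; apply/funext => c; have [n] := ubnP (c j).
elim: n c => // n IH c cn.
have gE : (X i * g) (mmul (ucm i) c) = (X j * g) (mmul (ucm i) c).
  apply/eqP; rewrite -subr_eq0 -fpsB -mulrBl g0 fps0.
  exact: eqxx.
transitivity ((X j * g) (mmul (ucm i) c)); first exact: etrans (esym (varM_coef i c g)) gE.
rewrite fps0.
have [cj|cj] := posnP (c j).
  by apply: varM_coef0; rewrite cmM cmU (negPf ij).
have [d dE] := monom_split cj; rewrite dE mulmA (mulmC (ucm i)) -mulmA.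
apply: etrans (varM_coef j _ g) _; rewrite IH ?fps0 //; rewrite cmM cmU (negPf ij) add0n.
by move: cn; rewrite dE cmM cmUU.
Qed.

Lemma cancel_varp_sub (i j : int) (P Q : poly_ring) : i != j ->
  (var i - var j) * P = (var i - var j) * Q -> P = Q.
Proof.
move=> ij PQ; apply: fps_of_inj; apply: subr0_eq.
apply: (cancel_var_sub ij); rewrite -!fps_of_var -!rmorphB -rmorphM mulrBr PQ.
by rewrite subrr rmorph0.
Qed.

(** * Coefficients of products of symmetric functions *)

Definition msup (b : monom) : {fset int} := finsupp (cmonom_val b).

(** A common form of e_d (bound D = 1) and h_d (any bound D at least d), so that both are treated at
    once. *)
Definition gsym (D : nat) (V : pred int) (d : nat) : fps := fun b =>
  ((mdeg b == d) && all (fun i => V i && (b i <= D)%N) (msup b))%:R.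

Lemma esymE V d : Defs.esym V d = gsym 1 V d.
Proof.
apply/funext => b; rewrite /Defs.esym /gsym; congr ((_ && _)%:R).
apply: eq_in_all => i ib; congr (_ && _).
by move: ib; rewrite -[i \in _]cmE_neq0; case: (b i) => [|[]].
Qed.

Lemma hsymE D V d : (d <= D)%N -> hsym V d = gsym D V d.
Proof.
move=> dD; apply/funext => b; rewrite /hsym /gsym; case: eqP => //= bd.
congr (_%:R); congr nat_of_bool; apply: eq_in_all => i ib.
suff -> : (b i <= D)%N by rewrite andbT.
by apply: leq_trans dD; rewrite -bd mdegE (big_fsetD1 i) //= leq_addr.
Qed.

Definition gprod D V (l : seq nat) : fps := \prod_(d <- l) gsym D V d.

Lemma big_smul (I : Type) (r : seq I) (F : I -> series) :
  \big[smul/sone]_(i <- r) F i = \prod_(i <- r) (F i : fps).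
Proof.
elim: r => [|i r IH]; first by rewrite !big_nil fps1E.
rewrite [LHS]big_cons IH [RHS]big_cons fpsME. by [].
Qed.

Lemma not_all_msup_mul V b c d : ~~ all V (msup b) -> mmul c d = b ->
  ~~ all V (msup c) || ~~ all V (msup d).
Proof.
move=> bV cd; rewrite -negb_and; apply: contraNN bV => /andP[cV dV].
apply/allP => i; rewrite /msup -cd mdomD in_fsetU => /orP[ic|id]; [exact: (allP cV)|exact: (allP dV)].
Qed.

Lemma gprod0 D V l b : ~~ all V (msup b) -> gprod D V l b = 0.
Proof.
rewrite /gprod; elim: l b => [|d l IH] b bV.
  rewrite big_nil fps1E /sone; case: eqP => // b1; move: bV.
  by rewrite b1 /msup mdom1.
rewrite big_cons fpsME /smul fsbig1 // => -[p q] /= pq.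
have /orP[pV|qV] := not_all_msup_mul bV pq; last by rewrite IH ?mulr0.
rewrite /gsym (_ : all _ _ = false) ?andbF ?mul0r //.
by apply: contraNF pV; apply: sub_all => i /andP[].
Qed.

(** The number of k by q matrices with entries in 0..D, row sums l and column sums s. It turns out
    to be the coefficient of x^s in a product of [gsym D], and its symmetry in l and s is
    transposition. *)
Definition cntf (D k q : nat) (l s : nat -> nat) : rat :=
  \sum_(A : {ffun 'I_k -> {ffun 'I_q -> 'I_D.+1}})
    ([forall i : 'I_k, \sum_j A i j == l i]%N && [forall j : 'I_q, \sum_i A i j == s j]%N)%:R.

Definition cnt (D : nat) (l s : seq nat) : rat :=
  cntf D (size l) (size s) (nth 0 l)%N (nth 0 s)%N.

Lemma eq_cntf D k q l s s' : (forall j, (j < q)%N -> s j = s' j) ->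
  cntf D k q l s = cntf D k q l s'.
Proof.
move=> ss'; apply: eq_bigr => A _; congr ((_ && _)%:R).
by apply: eq_forallb => j; rewrite ss'.
Qed.

Lemma cnt_sym D l s : cnt D l s = cnt D s l.
Proof.
rewrite /cnt /cntf.
pose tr (r q : nat) (A : {ffun 'I_r -> {ffun 'I_q -> 'I_D.+1}}) : {ffun 'I_q -> {ffun 'I_r -> 'I_D.+1}} :=
  [ffun j => [ffun i => A i j]].
have trK r q : cancel (@tr r q) (@tr q r).
  by move=> A; apply/ffunP => i; apply/ffunP => j; rewrite !ffunE.
rewrite (reindex (@tr _ _)) /=; last by apply: onW_bij; exists (@tr _ _).
apply: eq_bigr => A _; congr (_%:R); rewrite andbC.
by congr (nat_of_bool (_ && _)); apply: eq_forallb => i; congr (_ == _);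
  apply: eq_bigr => j _; rewrite !ffunE.
Qed.

Section Coefficients.
Variables (D : nat) (V : pred int) (vs : seq int).
Hypotheses (uvs : uniq vs) (Vvs : all V vs).
Let r := size vs.

Definition ffmon (g : {ffun 'I_r -> 'I_D.+1}) : monom :=
  \big[mmul/mone]_(j < r) expcmn (ucm (nth (0:int) vs j)) (g j).

Lemma cm_big (I : Type) (t : seq I) (F : I -> monom) i :
  (\big[mmul/mone]_(k <- t) F k) i = (\sum_(k <- t) F k i)%N.
Proof.
by elim: t => [|k t IH]; rewrite ?big_nil ?cm1 // !big_cons cmM IH.
Qed.

Lemma ffmon_nth g (k : 'I_r) : ffmon g (nth (0:int) vs k) = g k.
Proof.
rewrite /ffmon cm_big (bigD1 k) //= big1 => [|j jk].
  by rewrite expcmnE cmUU muln1 addn0.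
by rewrite expcmnE cmU nth_uniq // (negPf (_ : _ != _)) ?muln0.
Qed.

Lemma ffmon_out g i : i \notin vs -> ffmon g i = 0%N.
Proof.
move=> ivs; rewrite /ffmon cm_big big1 // => j _; rewrite expcmnE cmU.
by case: eqP => [E|]; [case/negP: ivs; rewrite -E mem_nth | rewrite muln0].
Qed.

Let Dvs : set monom := [set b | {subset msup b <= vs}].

Let Dvs_closed : divisor_closed Dvs.
Proof. by move=> b c /= bc i ib; apply: bc; rewrite /msup mdomD in_fsetU [i \in _]ib. Qed.

Lemma mdeg_vs b : Dvs b -> mdeg b = (\sum_(j < r) b (nth (0:int) vs j))%N.
Proof.
move=> bvs; rewrite (@mdegEw _ _ [fset i in vs]%fset).
  rewrite -(big_mkord xpredT (fun j => b (nth (0:int) vs j))) -(big_nth (0:int) xpredT b) /=.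
  by apply/perm_big/uniq_perm => [|//|i]; [exact: fset_uniq | rewrite in_fset].
by apply/fsubsetP => i ib; rewrite in_fset; exact: bvs.
Qed.

Lemma ffmon_eqP (g : {ffun 'I_r -> 'I_D.+1}) b : Dvs b -> reflect (forall j : 'I_r, g j = b (nth (0:int) vs j) :> nat) (ffmon g == b).
Proof.
move=> bvs; apply: (iffP eqP) => [<- j|gb]; first by rewrite ffmon_nth.
apply: cmonom_ext => i; have [ivs|ivs] := boolP (i \in vs).
  have ir : (index i vs < r)%N by rewrite index_mem.
  by rewrite -(nth_index (0:int) ivs) (ffmon_nth g (Ordinal ir)) gb.
rewrite ffmon_out //; apply/esym/eqP; rewrite cmE_eq0.
by apply: contraNN ivs => /bvs.
Qed.

Definition gsym_poly d : poly_ring :=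
  \sum_(g : {ffun 'I_r -> 'I_D.+1} | (\sum_j g j == d)%N) << ffmon g >>.

Lemma gsym_agrees d : agrees Dvs (gsym D V d) (gsym_poly d).
Proof.
move=> b bvs; rewrite raddf_sum /=; under eq_bigr do rewrite mcoeffU1.
rewrite /gsym; have [bD|bD] := boolP (all (fun i => (b i <= D)%N) (msup b)); last first.
  rewrite (_ : all _ _ = false) ?andbF; last first.
    by apply: contraNF bD; apply: sub_all => i /andP[].
  rewrite big1 // => g _; case: eqP => // gb; case/negP: bD; apply/allP => i ib.
  have ivs := bvs _ ib; rewrite -gb -(nth_index (0:int) ivs).
  have ir : (index i vs < r)%N by rewrite index_mem.
  by rewrite (ffmon_nth g (Ordinal ir)) -ltnS.
have bD' i : (b i <= D)%N.
  by have [/(allP bD)//|] := boolP (i \in msup b); rewrite -cmE_eq0 => /eqP->.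
have -> : all (fun i => V i && (b i <= D)%N) (msup b).
  by apply/allP => i /bvs /(allP Vvs) ->; rewrite bD'.
pose g0 : {ffun 'I_r -> 'I_D.+1} := [ffun j : 'I_r => inord (b (nth (0:int) vs j))].
have g0E (j : 'I_r) : g0 j = b (nth (0:int) vs j) :> nat by rewrite ffunE inordK // ltnS.
have sE : (\sum_j g0 j = \sum_(j < r) b (nth (0:int) vs j))%N by apply: eq_bigr => j _; exact: g0E.
have b0 : ffmon g0 == b by apply/ffmon_eqP.
rewrite andbT mdeg_vs // [RHS]big_mkcond [RHS](bigD1 g0) //= [X in _ + X]big1 ?addr0.
  by rewrite sE b0; case: eqP.
move=> g gg0; case: ifP => // _; case: ffmon_eqP => // gb.
by case/eqP: gg0; apply/ffunP => j; apply/val_inj; rewrite /= gb g0E.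
Qed.

(** Expanding the product chooses from each factor an exponent vector; these are the rows of a
    matrix, and the resulting monomial has its column sums as exponents. *)
Lemma gprod_coef l b : {subset msup b <= vs} -> gprod D V l b = cnt D l (map b vs).
Proof.
move=> bvs; have agr : agrees Dvs (gprod D V l) (\prod_(d <- l) gsym_poly d).
  rewrite /gprod; elim: {b bvs}l => [|d l IH]; first by rewrite !big_nil fps1E; exact: agrees_one.
  by rewrite !big_cons fpsME; apply: agrees_mul => //; exact: gsym_agrees.
rewrite agr // (big_nth 0%N) big_mkord bigA_distr_big_dep raddf_sum /=.
have mulU (c d : monom) : << c >> * << d >> = << mmul c d >> :> poly_ring.
  by rewrite malgM_def fgmulUU mulr1.
have prodU (I : Type) (t : seq I) (F : I -> monom) :
    \prod_(i <- t) << F i >> = << \big[mmul/mone]_(i <- t) F i >> :> poly_ring.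
  elim: t => [|i t IH]; first by rewrite [LHS]big_nil [X in << X >>]big_nil.
  by rewrite [LHS]big_cons IH mulU; congr << _ >>; rewrite [RHS]big_cons.
rewrite /cnt size_map (@eq_cntf _ _ _ _ _ (fun j => b (nth (0:int) vs j))); last first.
  by move=> j jr; rewrite (nth_map 0).
rewrite /cntf big_mkcond; apply: eq_bigr => A _; rewrite /= prodU mcoeffU1.
rewrite (_ : (A \in family _) = [forall i : 'I_(size l), (\sum_j A i j == nth 0 l i)%N]); last first.
  by apply: eq_forallb => i.
case: ifP => //= _; congr (_%:R); congr nat_of_bool.
apply/eqP/forallP => [<- j|Ab].
  by rewrite cm_big; apply/eqP; apply: eq_bigr => i _; rewrite ffmon_nth.
apply: cmonom_ext => i; rewrite cm_big.
have [ivs|ivs] := boolP (i \in vs).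
  have ir : (index i vs < r)%N by rewrite index_mem.
  rewrite -(nth_index (0:int) ivs) -(eqP (Ab (Ordinal ir))) /=; apply: eq_bigr => k _.
  by rewrite (ffmon_nth (A k) (Ordinal ir)).
rewrite big1 => [|k _]; last by rewrite ffmon_out.
by apply/esym/eqP; rewrite cmE_eq0; apply: contraNN ivs => /bvs.
Qed.
End Coefficients.

Lemma gprodE D V l b : gprod D V l b =
  if all V (msup b) then cnt D l [seq b i | i <- msup b] else 0.
Proof.
case: ifPn => bV; last exact: gprod0.
by rewrite (@gprod_coef D V (msup b)) ?fset_uniq.
Qed.

Lemma gprod_perm D V l l' : perm_eq l l' -> gprod D V l = gprod D V l'.
Proof. exact: perm_big. Qed.

Fixpoint mon (i : int) (s : seq nat) : monom :=
  if s is k :: s' then mmul (expcmn (ucm i) k) (mon (i + 1) s') else mone.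

Definition vars (i : int) (n : nat) : seq int := [seq i + k%:Z | k <- iota 0 n].

Lemma mem_vars i n j : (j \in vars i n) = (i <= j < i + n%:Z).
Proof.
apply/mapP/idP => [[k]|/andP[ij jn]]; first by rewrite mem_iota; lia.
by exists (absz (j - i)%R); rewrite ?mem_iota; lia.
Qed.

Lemma vars_uniq i n : uniq (vars i n).
Proof. by rewrite map_inj_uniq ?iota_uniq // => k l; lia. Qed.

Lemma size_vars i n : size (vars i n) = n.
Proof. by rewrite size_map size_iota. Qed.

Lemma monE i s j : mon i s j = if i <= j then nth 0%N s (absz (j - i)%R) else 0%N.
Proof.
elim: s i => [|k s IH] i /=; first by rewrite cm1 nth_nil; case: ifP.
rewrite cmM expcmnE cmU IH; case: (ltgtP i j) => [ij|ji|<-].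
- have -> : i + 1 <= j by lia.
  by rewrite muln0 (_ : absz (j - i)%R = (absz (j - (i + 1))%R).+1) //; lia.
- by rewrite muln0 (_ : (i + 1 <= j) = false) //; lia.
- by rewrite subrr muln1 (_ : (i + 1 <= i) = false) ?addn0 //; lia.
Qed.

Lemma msupE (b : monom) i : (i \in msup b) = (b i != 0%N).
Proof. by rewrite cmE_neq0. Qed.

Lemma msup_mon i s j : j \in msup (mon i s) -> i <= j < i + (size s)%:Z.
Proof.
rewrite msupE monE; case: ifP => //= ij; case: (ltnP (absz (j - i)%R) (size s)); first by lia.
by move=> ?; rewrite nth_default.
Qed.

Lemma map_mon i s : [seq mon i s j | j <- vars i (size s)] = s.
Proof.
apply: (@eq_from_nth _ 0%N); rewrite !size_map ?size_iota // => k ks.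
rewrite (nth_map 0) ?size_map ?size_iota // monE (nth_map 0%N) ?size_iota //.
rewrite nth_iota // add0n (_ : i <= i + k%:Z); last by lia.
by congr (nth _ _ _); lia.
Qed.

Lemma mon_map i n (b : monom) : (forall j, j \in msup b -> i <= j < i + n%:Z) ->
  mon i [seq b j | j <- vars i n] = b.
Proof.
move=> bn; apply: cmonom_ext => j; rewrite monE.
have [bj|bj] := eqVneq (b j) 0%N.
  case: ifP => // ij; have [jn|jn] := ltnP (absz (j - i)%R) n; last first.
    by rewrite nth_default ?bj // size_map size_vars.
  rewrite (nth_map 0) ?size_vars // (nth_map 0%N) ?size_iota // nth_iota //.
  by rewrite bj -[RHS]bj; congr (b _); lia.
have /bn/andP[ij jn] : j \in msup b by rewrite msupE.
rewrite ij (nth_map 0) ?size_vars ?(nth_map 0%N) ?size_iota ?nth_iota; try lia.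
by congr (b _); lia.
Qed.

Lemma mon_cat i s t : mon i (s ++ t) = mmul (mon i s) (mon (i + (size s)%:Z) t).
Proof.
elim: s i => [|k s IH] i /=; first by rewrite mul1m addr0.
by rewrite IH mulmA; congr (mmul _ (mon _ _)); lia.
Qed.

Lemma mon_nseq0 i n : mon i (nseq n 0%N) = mone.
Proof. by elim: n i => //= n IH i; rewrite IH mulm1. Qed.

Lemma cnt_gprod D l s i : cnt D l s = gprod D xpredT l (mon i s).
Proof.
rewrite (@gprod_coef _ _ (vars i (size s))) ?vars_uniq ?map_mon ?all_predT //.
by move=> j /msup_mon; rewrite mem_vars.
Qed.

Lemma cnt_perml D l l' s : perm_eq l l' -> cnt D l s = cnt D l' s.
Proof. by move=> ll'; rewrite !(cnt_gprod _ _ _ 0) (gprod_perm _ _ ll'). Qed.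

Lemma cnt_permr D l s s' : perm_eq s s' -> cnt D l s = cnt D l s'.
Proof. by move=> ss'; rewrite !(cnt_sym D l) (cnt_perml _ _ ss'). Qed.

Lemma cnt_filter D l s : cnt D l [seq k <- s | k != 0%N] = cnt D l s.
Proof.
rewrite -[RHS](@cnt_permr D l ([seq k <- s | k != 0%N] ++ [seq k <- s | k == 0%N])); last first.
  by rewrite perm_sym -(perm_filterC (fun k => k != 0%N)) perm_cat2l; under eq_filter do rewrite /= negbK.
have -> : [seq k <- s | k == 0%N] = nseq (count (pred1 0%N) s) 0%N.
  by elim: s => //= k s ->; case: eqP => //= ->.
by rewrite !(cnt_gprod _ _ _ 0) mon_cat mon_nseq0 mulm1.
Qed.

Lemma cnt_sumn D l s : cnt D l s != 0 -> sumn l = sumn s.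
Proof.
apply: contra_neqP => ls; rewrite /cnt /cntf big1 // => A _.
case: andP => // -[/forallP Al /forallP As]; case: ls.
rewrite !sumnE [LHS](big_nth 0%N) [RHS](big_nth 0%N) !big_mkord.
rewrite -(eq_bigr _ (fun i _ => eqP (Al i))) -[RHS](eq_bigr _ (fun i _ => eqP (As i))).
exact: exchange_big.
Qed.

Lemma gsym_full i n :
  gsym 1 (fun j => j \in vars i n) n = mono (mon i (nseq n 1%N)).
Proof.
apply/funext => b; rewrite monoE; congr (_%:R); congr nat_of_bool.
apply/andP/eqP => [[/eqP bn /allP bV]|->]; last first.
  have sup j : j \in msup (mon i (nseq n 1%N)) -> j \in vars i n.
    by move/msup_mon; rewrite mem_vars size_nseq.
  rewrite (mdeg_vs (vars_uniq i n)) //; split.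
    rewrite (eq_bigr (fun=> 1%N)) ?sum1_card ?card_ord ?size_vars // => j _.
    rewrite monE; have jn := ltn_ord j.
    rewrite (nth_map 0%N) ?size_iota // nth_iota // add0n.
    by rewrite (_ : i <= i + j%:Z) ?nth_nseq; [case: ifP => //; lia|lia].
  apply/allP => j /sup ->; rewrite monE; case: ifP => //= _.
  by rewrite nth_nseq; case: ifP.
have bsup : {subset msup b <= vars i n} by move=> j /bV /andP[].
have b1 j : (b j <= 1)%N.
  by case: (boolP (j \in msup b)) => [/bV/andP[]//|]; rewrite msupE negbK => /eqP->.
rewrite (mdeg_vs (vars_uniq i n)) // in bn.
have allone (j : 'I_(size (vars i n))) : b (nth (0:int) (vars i n) j) = 1%N.
  have : (\sum_(j < size (vars i n)) (1 - b (nth (0:int) (vars i n) j)) = 0)%N.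
    by rewrite sumnB // sum1_card card_ord bn size_vars subnn.
  move/eqP; rewrite sum_nat_eq0 => /forallP /(_ j).
  rewrite implyTb subn_eq0 => b1'; apply/eqP; rewrite eqn_leq b1' andbT; exact: b1.
rewrite -[LHS](@mon_map i n); last by move=> j /bsup; rewrite mem_vars.
congr mon; apply: (@eq_from_nth _ 0%N); rewrite ?size_map ?size_iota ?size_nseq // => k kn.
rewrite nth_nseq kn (nth_map 0) ?size_vars //.
have kn' : (k < size (vars i n))%N by rewrite size_vars.
exact: (allone (Ordinal kn')).
Qed.

(** In n variables e_n is the product of all of them, so a factor e_n lowers each exponent by one
    and leaves nothing at monomials that miss a variable. *)
Lemma cnt_head n l s : size s = n ->
  cnt 1 (n :: l) s = if all (leq 1) s then cnt 1 l (map predn s) else 0.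
Proof.
move=> sn; pose V := [pred j : int | j \in vars 0 n].
have E l' s' : size s' = n -> cnt 1 l' s' = gprod 1 V l' (mon 0 s').
  move=> s'n; have Vall : all V (vars 0 n) by apply/allP.
  have sup : {subset msup (mon 0 s') <= vars 0 n} by move=> j /msup_mon; rewrite mem_vars s'n.
  by rewrite (@gprod_coef 1 V (vars 0 n) (vars_uniq 0 n) Vall _ _ sup) -s'n map_mon.
rewrite E // /gprod big_cons (gsym_full 0 n).
case: ifP => s0.
  rewrite -(_ : mmul (mon 0 (nseq n 1%N)) (mon 0 (map predn s)) = mon 0 s).
    by rewrite monoM_coef -/(gprod _ _ _) -E // size_map.
  apply: cmonom_ext => j; rewrite cmM !monE; case: ifP => // _.
  have [js|js] := ltnP (absz (j - 0)%R) n; last by rewrite !nth_default ?size_map ?size_nseq ?sn.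
  rewrite nth_nseq js (nth_map 0%N) ?sn // add1n prednK //.
  by apply: (allP s0); rewrite mem_nth ?sn.
apply: monoM_coef0 => dv; case/negP: s0; apply/(all_nthP 0%N) => k; rewrite sn => kn.
have := dv k%:Z; rewrite !monE (_ : 0 <= k%:Z) // subr0 /= nth_nseq kn.
exact.
Qed.

(** * Linear independence of the e_lambda *)

Lemma cnt_nil0 D n : cnt D [::] (nseq n 0%N) = 1.
Proof. by rewrite (cnt_gprod _ _ _ 0) mon_nseq0 /gprod big_nil fps1E /sone eqxx. Qed.

Lemma part_cons d l : is_part (d :: l) -> is_part l.
Proof.
rewrite /is_part /= in_cons negb_or => /andP[/path_sorted -> /andP[_ ->]].
by [].
Qed.

Lemma part_head_max d l : is_part (d :: l) -> all (fun k => (k <= d)%N) (d :: l).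
Proof.
case/andP => + _; rewrite /= leqnn /= => dl.
by move: dl; rewrite (path_sortedE (rev_trans leq_trans)) => /andP[].
Qed.

(* Setting the last of n variables to zero kills the products having a factor
   e_n and leaves the others independent by induction; a factor e_n = x_1..x_n
   can be cancelled. *)
Lemma cnt1_independent n k (c : seq nat -> rat) (L : seq (seq nat)) : uniq L ->
    (forall l, l \in L -> [&& is_part l, all (fun d => (d <= n)%N) l & (size l <= k)%N]) ->
    (forall s, size s = n -> \sum_(l <- L) c l * cnt 1 l s = 0) ->
  forall l, l \in L -> c l = 0.
Proof.
have base m c' L' : uniq L' -> {in L', forall l, l = [::]} ->
    \sum_(l <- L') c' l * cnt 1 l (nseq m 0%N) = 0 -> forall l, l \in L' -> c' l = 0.
  move=> uL nilE L0 l lL; have := L0; rewrite (bigD1_seq l) //= big1_seq ?addr0.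
    by rewrite (nilE _ lL) cnt_nil0 mulr1.
  by move=> l' /andP[l'l l'L]; case/eqP: l'l; rewrite (nilE _ lL) (nilE _ l'L).
elim: n k c L => [|n IHn] k c L.
  move=> uL Lp L0; apply: (base 0%N) => // [l'|]; last exact: L0.
  move=> /Lp /and3P[/andP[_]]; case: l' => // d l'; rewrite inE negb_or.
  by case/andP => d0 _ /andP[]; rewrite leqn0 eq_sym (negPf d0).
elim: k c L => [|k IHk] c L uL Lp L0.
  apply: (base n.+1) => // [l'|]; last by apply: L0; rewrite size_nseq.
  by move=> /Lp /and3P[_ _]; rewrite leqn0 size_eq0 => /eqP.
pose P := [pred l : seq nat | head 0%N l == n.+1].
have L1P l : l \in L -> ~~ P l -> all (fun d => (d <= n)%N) l.
  move=> /Lp; case: l => //= d l /and3P[dlp /andP[dn _] _] dn1.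
  have := part_head_max dlp; apply: sub_all => e /leq_trans; apply.
  by rewrite -ltnS ltn_neqAle dn1.
have c1 l : l \in L -> ~~ P l -> c l = 0.
  move=> lL lP; apply: (IHn k.+1 c [seq l <- L | ~~ P l]).
  - exact: filter_uniq.
  - move=> l'; rewrite mem_filter => /andP[l'P l'L].
    by have /and3P[-> _ ->] := Lp _ l'L; rewrite L1P.
  - move=> s sn; have S0 : \sum_(l' <- L | P l') c l' * cnt 1 l' (rcons s 0%N) = 0.
      rewrite big1 // => -[|d l'] /eqP //= ->.
      by rewrite cnt_head ?size_rcons ?sn // all_rcons /= mulr0.
    have := L0 (rcons s 0%N); rewrite size_rcons sn => /(_ erefl).
    rewrite (bigID P) /= S0 add0r => L0s; apply: etrans L0s; rewrite big_filter; apply: eq_bigr => l' _.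
    by rewrite -[in RHS]cnt_filter filter_rcons /= cnt_filter.
  - by rewrite mem_filter lP.
move=> l lL; have [lP|/c1->//] := boolP (P l).
have {}lE : l = n.+1 :: behead l by case: l lP {lL} => // d l /eqP /= ->.
rewrite lE; apply: (IHk (fun l => c (n.+1 :: l)) [seq behead l | l <- L & P l]).
- rewrite map_inj_in_uniq ?filter_uniq // => l1 l2.
  rewrite !mem_filter; case: l1 l2 => [|d1 l1] [|d2 l2] //=.
  by case/andP => /eqP-> _ /andP[/eqP-> _] ->.
- move=> _ /mapP[[|d l'] + ->]; rewrite mem_filter // => /andP[/eqP /= -> /Lp].
  by case/and3P => /part_cons lp /andP[_ ln] lk; apply/and3P; split.
- move=> s sn; have S0 : \sum_(l' <- L | ~~ P l') c l' * cnt 1 l' (map S s) = 0.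
    by rewrite big1_seq // => l' /andP[? ?]; rewrite c1 ?mul0r.
  have := L0 (map S s); rewrite size_map sn => /(_ erefl).
  rewrite (bigID P) /= S0 addr0 => L0s; apply: etrans L0s; rewrite big_map big_filter.
  apply: eq_bigr => -[|d l'] //= /eqP ->.
  rewrite cnt_head ?size_map ?sn //.
  have -> : all (leq 1) (map S s) by apply/allP => _ /mapP[m _ ->].
  by rewrite -map_comp (@map_id_in _ (predn \o S)).
- by apply/mapP; exists l => //; rewrite mem_filter lP.
Qed.

(** The partitions of n without repetition: such a partition has at most n parts, all at most n, so
    it is a tuple of n entries in 0..n, sorted and stripped of zeros. *)
Definition parts (n : nat) : seq (seq nat) :=
  undup [seq l <- [seq sort geq [seq k <- map val (tval t) | k != 0%N] | t : n.-tuple 'I_n.+1]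
        | sumn l == n].

Lemma parts_uniq n : uniq (parts n). Proof. exact: undup_uniq. Qed.

Lemma sort_filter_part s : is_part (sort geq [seq k <- s | k != 0%N]).
Proof.
rewrite /is_part sort_sorted; last by move=> x y; rewrite /= leq_total.
by rewrite mem_sort mem_filter.
Qed.

Lemma sort_part l : is_part l -> sort geq [seq k <- l | k != 0%N] = l.
Proof.
case/andP => sl l0; rewrite (_ : filter _ _ = l).
  apply: sorted_sort => //; exact: (rev_trans leq_trans).
by apply/all_filterP/allP => k kl; apply: contraNneq l0 => <-.
Qed.

Lemma sumn_sort_filter s : sumn (sort geq [seq k <- s | k != 0%N]) = sumn s.
Proof.
rewrite (perm_sumn (_ : perm_eq _ [seq k <- s | k != 0%N])) ?perm_sort //.
by elim: s => //= k s <-; case: eqP => //= ->.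
Qed.

Lemma part_bound l : is_part l ->
  all (fun d => (d <= sumn l)%N) l && (size l <= sumn l)%N.
Proof.
case/andP => _; elim: l => //= d l IH; rewrite inE negb_or => /andP[d0 /IH /andP[la ls]].
rewrite leq_addr /=; apply/andP; split.
  by apply: sub_all la => k kl; apply: leq_trans kl (leq_addl _ _).
by rewrite -add1n leq_add // lt0n eq_sym.
Qed.

Lemma mem_parts n l : (l \in parts n) = is_part l && (sumn l == n).
Proof.
rewrite mem_undup mem_filter andbC.
apply/andP/andP => [[/mapP[t _ ->] ->]|[lp /eqP ln]]; first by rewrite sort_filter_part.
rewrite ln eqxx; split=> //; have /andP[/allP lle ls] := part_bound lp.
pose u := l ++ nseq (n - size l) 0%N.
have us : size [seq inord k : 'I_n.+1 | k <- u] == n.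
  by rewrite size_map size_cat size_nseq -ln subnKC.
apply/mapP; exists (Tuple us); first by rewrite mem_enum.
rewrite -{1}(sort_part lp) /= -map_comp map_id_in => [|k].
  rewrite /u filter_cat (_ : [seq k <- nseq _ _ | _] = [::]) ?cats0 //.
  by elim: (n - size l)%N.
rewrite mem_cat => /orP[/lle|]; rewrite ?ln => kn; first by rewrite /= inordK.
by move: kn; rewrite mem_nseq => /andP[_ /eqP->]; rewrite /= inordK.
Qed.

Lemma parts_sort s : sort geq [seq k <- s | k != 0%N] \in parts (sumn s).
Proof. by rewrite mem_parts sort_filter_part sumn_sort_filter eqxx. Qed.

Lemma cnt_sort D l s : cnt D l (sort geq [seq k <- s | k != 0%N]) = cnt D l s.
Proof. by rewrite -(cnt_filter D l s); apply: cnt_permr; rewrite perm_sort. Qed.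

(** Such an f is determined by its values on the partitions of n. The square matrix of the
    [cnt 1 l m], with l and m among these partitions, has independent rows, hence is invertible, and
    c solves the linear system. *)
Lemma cnt1_expansion n (f : seq nat -> rat) :
    (forall s, f (sort geq [seq k <- s | k != 0%N]) = f s) ->
    (forall s, f s != 0 -> sumn s = n) ->
  exists c : seq nat -> rat, forall s, f s = \sum_(l <- parts n) c l * cnt 1 l s.
Proof.
move=> fsort fdeg; pose k := size (parts n); pose p (i : nat) := nth [::] (parts n) i.
pose M : 'M[rat]_k := \matrix_(i, j) cnt 1 (p i) (p j).
have pin i : (i < k)%N -> p i \in parts n by move=> ik; apply: mem_nth.
have Mfree : row_free M.
  apply: inj_row_free => v vM.
  pose c (l : seq nat) : rat := if insub (index l (parts n)) is Some i then v 0 i else 0.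
  have cp (i : 'I_k) : c (p i) = v 0 i.
    rewrite /c /p index_uniq ?parts_uniq //; case: insubP => [j _ /val_inj ->//|].
    by rewrite ltn_ord.
  have csum s : \sum_(l <- parts n) c l * cnt 1 l s = \sum_i v 0 i * cnt 1 (p i) s.
    by rewrite (big_nth [::]) big_mkord; apply: eq_bigr => i _; rewrite -cp.
  have c0 : forall l, l \in parts n -> c l = 0.
    apply: (@cnt1_independent n n); first exact: parts_uniq.
      by move=> l; rewrite mem_parts => /andP[lp /eqP <-]; rewrite lp part_bound.
    move=> s _; have [sn|sn] := eqVneq (sumn s) n; last first.
      rewrite big1_seq // => l /andP[_]; rewrite mem_parts => /andP[_ /eqP ln].
      by apply/eqP; rewrite mulf_eq0; apply/orP; right; apply: contraNT sn => /cnt_sumn <-; rewrite ln.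
    have sp := parts_sort s; rewrite sn in sp.
    have ik : (index (sort geq [seq k <- s | k != 0%N]) (parts n) < k)%N by rewrite index_mem.
    rewrite csum; have := congr1 (fun w : 'rV_k => w 0 (Ordinal ik)) vM.
    rewrite !mxE => vM0; apply: etrans vM0; apply: eq_bigr => i _.
    by rewrite mxE /p /= (nth_index [::] sp) cnt_sort.
  by apply/rowP => i; rewrite mxE -cp c0 ?pin.
have Mu : M \in unitmx by rewrite -row_free_unit.
pose u : 'rV_k := (\row_j f (p j)) *m invmx M.
exists (fun l => if insub (index l (parts n)) is Some i then u 0 i else 0) => s.
have csum : \sum_(l <- parts n) (if insub (index l (parts n)) is Some i then u 0 i else 0) * cnt 1 l s =
    \sum_i u 0 i * cnt 1 (p i) s.
  rewrite (big_nth [::]) big_mkord; apply: eq_bigr => i _; congr (_ * _).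
  rewrite index_uniq ?parts_uniq //; case: insubP => [j _ /val_inj ->//|].
  by rewrite ltn_ord.
rewrite csum; have [sn|sn] := eqVneq (sumn s) n; last first.
  have -> : f s = 0 by apply: contraNeq sn => /fdeg ->.
  rewrite big1 // => i _; apply/eqP; rewrite mulf_eq0; apply/orP; right.
  apply: contraNT sn => /cnt_sumn <-; have := pin i (ltn_ord i).
  by rewrite mem_parts => /andP[].
have sp := parts_sort s; rewrite sn in sp.
have ik : (index (sort geq [seq k <- s | k != 0%N]) (parts n) < k)%N by rewrite index_mem.
have := congr1 (fun w : 'rV_k => w 0 (Ordinal ik)) (mulmxKV Mu (\row_j f (p j))).
rewrite !mxE /p /= (nth_index [::] sp) fsort => <-; apply: eq_bigr => i _.
by rewrite [M _ _]mxE /p /= (nth_index [::] sp) cnt_sort.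
Qed.

(** * The relation between elementary and complete functions *)

Lemma fps_local (f f' g g' : fps) b :
    (forall c, divides c b -> f c = f' c) -> (forall c, divides c b -> g c = g' c) ->
  (f * g) b = (f' * g') b.
Proof.
move=> ff gg; rewrite !fpsME /smul; apply: eq_fsbigr => -[p q]; rewrite inE /= => pq.
by rewrite ff ?gg //; [move: pq; rewrite mulmC => /divides_mulr | move: pq => /divides_mulr].
Qed.

Lemma fpsM_off (V : pred int) (f g : fps) b :
    (forall c, ~~ all V (msup c) -> f c = 0) -> (forall c, ~~ all V (msup c) -> g c = 0) ->
  ~~ all V (msup b) -> (f * g) b = 0.
Proof.
move=> f0 g0 bV; rewrite fpsME /smul fsbig1 // => -[p q] /= pq.
by have /orP[/f0->|/g0->] := not_all_msup_mul bV pq; rewrite ?mul0r ?mulr0.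
Qed.

Lemma fpsM_one (f g : fps) : (f * g) mone = f mone * g mone.
Proof.
rewrite fpsME /smul -(@fsbig_widen _ _ _ _ [set (mone, mone)]) ?fsbig_set1 //.
  by move=> _ -> /=; rewrite mul1m.
by move=> [p q] /= [/unitm[-> ->]].
Qed.

Lemma gsym0 D V d b : ~~ all V (msup b) -> gsym D V d b = 0.
Proof.
move=> bV; rewrite /gsym (_ : all _ _ = false) ?andbF //.
by apply: contraNF bV; apply: sub_all => i /andP[].
Qed.

Lemma gsym_deg0 D V : gsym D V 0 = 1.
Proof.
apply/funext => b; rewrite fps1E /sone /gsym mdeg_eq0; congr (_%:R).
by case: eqP => //= ->; rewrite /msup mdom1.
Qed.

Lemma hsym0 V d b : ~~ all V (msup b) -> hsym V d b = 0.
Proof. by rewrite (hsymE _ (leqnn d)); exact: gsym0. Qed.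

Lemma hsym_deg0 V : hsym V 0 = (1 : fps).
Proof. by rewrite (hsymE _ (leqnn 0)) gsym_deg0. Qed.

Definition addvar (V : pred int) (k : int) : pred int := fun i => (i == k) || V i.

Lemma msup_mulU k b : msup (mmul (ucm k) b) = (k |` msup b)%fset.
Proof. by rewrite /msup mdomD mdomU. Qed.

Lemma esym_addvar V k d : ~~ V k ->
  gsym 1 (addvar V k) d.+1 = gsym 1 V d.+1 + X k * gsym 1 V d.
Proof.
move=> Vk; apply/funext => b; rewrite fpsD; have [bk|bk] := posnP (b k).
  rewrite [(X k * _) b]varM_coef0 // addr0 /gsym; congr ((_ && _)%:R).
  apply: eq_in_all => i; rewrite msupE /addvar.
  by have [->|ik] := eqVneq i k; rewrite ?bk.
rewrite [X in _ = X + _]gsym0 ?add0r; last first.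
  by apply: contraNN Vk => /allP; apply; rewrite msupE -lt0n.
have [c ->] := monom_split bk; rewrite varM_coef /gsym mdegM mdegU add1n eqSS.
congr ((_ && _)%:R); rewrite msup_mulU.
have [ck|ck] := eqVneq (c k) 0%N; last first.
  transitivity false; [|apply/esym]; apply/negP => /allP /(_ k).
    by rewrite in_fset1U eqxx cmM cmUU => /(_ isT) /andP[_]; lia.
  by rewrite msupE ck (negPf Vk) => /(_ isT).
apply/allP/allP => H i ic.
  have ik : i != k by apply: contraTneq ic => ->; rewrite msupE ck.
  have := H i; rewrite in_fset1U ic orbT cmM cmU /addvar (negPf ik) eq_sym (negPf ik).
  exact.
rewrite cmM cmU eq_sym /addvar; move: ic; rewrite in_fset1U.
by case: eqP => [-> _|_ /H]; rewrite ?ck.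
Qed.

(** Monomials are split by whether x_k occurs. Unlike for the e's, dividing by x_k may leave further
    factors x_k, so the last term keeps that variable. *)
Lemma hsym_addvar V k d : ~~ V k ->
  hsym (addvar V k) d.+1 = (hsym V d.+1 : fps) + X k * hsym (addvar V k) d.
Proof.
move=> Vk; apply/funext => b; rewrite fpsD; have [bk|bk] := posnP (b k).
  rewrite [(X k * _) b]varM_coef0 // addr0 /hsym; congr ((_ && _)%:R).
  apply: eq_in_all => i; rewrite -[i \in _]/(i \in msup b) msupE /addvar.
  by have [->|ik] := eqVneq i k; rewrite ?bk.
rewrite [X in _ = X + _]hsym0 ?add0r; last first.
  by apply: contraNN Vk => /allP; apply; rewrite msupE -lt0n.
have [c ->] := monom_split bk; rewrite varM_coef /hsym mdegM mdegU add1n eqSS.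
congr ((_ && _)%:R); rewrite -/(msup _) -/(msup c) msup_mulU.
apply/allP/allP => H i; have := H i; rewrite in_fset1U.
  by move=> + ic; rewrite ic orbT => /(_ isT).
by rewrite /addvar; case: eqP.
Qed.

(** The coefficient of t^n in E(-t) H(t), for the generating series E and H of the e's and h's in
    the variables V. *)
Definition eh_sum (V : pred int) (n : nat) : fps :=
  \sum_(i < n.+1) (-1) ^+ i * (gsym 1 V i * (hsym V (n - i) : fps)).

(** A new variable multiplies E(-t) by 1 - x_k t and H(t) by the inverse of this factor. *)
Lemma eh_sum_addvar V k n : ~~ V k -> eh_sum (addvar V k) n.+1 = eh_sum V n.+1.
Proof.
move=> Vk; pose e := gsym 1 V; pose e' := gsym 1 (addvar V k).
pose h i : fps := hsym V i; pose h' i : fps := hsym (addvar V k) i.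
have hE i : h i.+1 = h' i.+1 - X k * h' i by rewrite /h /h' hsym_addvar // addrK.
pose S := \sum_(i < n.+1) (-1) ^+ i * (e i * h' (n - i)%N).
pose Q := \sum_(i < n.+2) (-1) ^+ i * (e i * h' (n.+1 - i)%N).
(* Q pairs the e's without x_k with the h's including x_k. Splitting the e's of the left side, or
   the h's of the right side, leads to Q - x_k S. *)
transitivity (Q - X k * S).
  rewrite /eh_sum /Q big_ord_recl [in RHS]big_ord_recl -addrA; congr (_ + _).
    by rewrite /e !gsym_deg0.
  rewrite mulr_sumr -sumrN -big_split; apply: eq_bigr => i _ /=.
  rewrite /bump /= add1n subSS -/(h' _) /e esym_addvar // mulrDl mulrDr; congr (_ + _).
  by rewrite exprS mulN1r mulNr -!mulrA mulrCA.
(* The last term contains h_0 = 1, to which the recursion [hE] does not apply. *)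
have lastE : (-1) ^+ n.+1 * (e n.+1 * h (n.+1 - n.+1)%N) = (-1) ^+ n.+1 * (e n.+1 * h' (n.+1 - n.+1)%N).
  congr (_ * (_ * _)); rewrite subnn.
  exact: etrans (hsym_deg0 _) (esym (hsym_deg0 _)).
apply/esym; rewrite /eh_sum [LHS]big_ord_recr /= lastE /Q [in RHS]big_ord_recr /= addrAC; congr (_ + _).
rewrite mulr_sumr -sumrN -big_split; apply: eq_bigr => i _ /=.
have -> : (n.+1 - i = (n - i).+1)%N by rewrite subSn // -ltnS.
rewrite -/(h _) hE mulrBr mulrBr; congr (_ - _).
by rewrite [RHS]mulrCA; congr (_ * _); rewrite mulrCA.
Qed.

(** To read the coefficient of b other than 1, remove from the variables one that occurs in b: the
    sum does not change, and afterwards b cannot occur in it. In the constant term each summand has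
    a factor of positive degree. *)
Lemma eh_sum0 n : eh_sum xpredT n.+1 = 0.
Proof.
apply/funext => b; rewrite fps0; have [->|b1] := eqVneq b mone.
  rewrite /eh_sum fps_sumE big1 // => i _; rewrite !fpsM_one /gsym /hsym mdeg1.
  case: (nat_of_ord i) => [|j] /=; first by rewrite ?subn0 /= !mulr0.
  by rewrite mul0r mulr0.
have [k bk] : exists k, k \in msup b.
  have /fset0Pn[k kb] : msup b != fset0; last by exists k.
  apply: contraNneq b1 => b0; apply/eqP/cmonom_ext => i; rewrite cm1.
  by apply/eqP; rewrite -[_ == _]negbK -msupE b0.
pose V := [pred i : int | i != k].
have -> : xpredT = addvar V k by apply/funext => i; rewrite /addvar /=; case: eqP.
rewrite eh_sum_addvar /= ?eqxx // /eh_sum fps_sumE big1 // => i _.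
have bV : ~~ all V (msup b) by apply/negP => /allP /(_ _ bk); rewrite /= eqxx.
have sgn m : (-1 : fps) ^+ m = 1 \/ (-1 : fps) ^+ m = -1.
  elim: m => [|m IH]; first by left.
  by rewrite exprS mulN1r; case: IH => ->; [right|left; rewrite opprK].
have z : (gsym 1 V i * (hsym V (n.+1 - i) : fps)) b = 0.
  by apply: (@fpsM_off V) => // c cV; [exact: gsym0 | exact: hsym0].
by case: (sgn i) => ->; rewrite ?mul1r ?mulN1r ?fpsN z ?oppr0.
Qed.

(** With [fuel] at least n, these are the compositions of n with sign (-1)^(n - length), as in the
    expression of h_n through products of e's, or of e_n through h's. *)
Fixpoint dual_expr (fuel n : nat) : seq (rat * seq nat) :=
  match fuel, n with
  | f.+1, n'.+1 => flatten [seq [seq ((-1) ^+ i * p.1, i.+1 :: p.2) | p <- dual_expr f (n' - i)]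
                           | i <- iota 0 n'.+1]
  | _, _ => [:: (1, [::])]
  end.

Lemma dual_exprS f n : dual_expr f.+1 n.+1 =
  flatten [seq [seq ((-1) ^+ i * p.1, i.+1 :: p.2) | p <- dual_expr f (n - i)] | i <- iota 0 n.+1].
Proof. by []. Qed.

Fixpoint dual_word (s : seq nat) : seq (rat * seq nat) :=
  if s is k :: s' then
    [seq (p.1 * q.1, p.2 ++ q.2) | p <- dual_expr k k, q <- dual_word s']
  else [:: (1, [::])].

Section DualWords.
Variable T : Type.
Implicit Types (a b : nat -> (T -> rat) -> T -> rat) (v : T -> rat).

(** Linearity, stated for finite combinations. T is the set of monomials when the operators multiply
    by e_k and h_k, and the set of permutations when they are coefficients of A(x) and B(x). *)
Definition preserves_sums (g : (T -> rat) -> T -> rat) :=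
  forall (I : Type) (r : seq I) (c : I -> rat) (F : I -> T -> rat),
    g (fun x => \sum_(i <- r) c i * F i x) = fun x => \sum_(i <- r) c i * g (F i) x.

Definition act a (s : seq nat) v : T -> rat := foldr a v s.

Lemma act_cons a k s v : act a (k :: s) v = a k (act a s v).
Proof. by []. Qed.

Lemma act_cat a s t v : act a (s ++ t) v = act a s (act a t v).
Proof. exact: foldr_cat. Qed.

Lemma act_linear a : (forall k, preserves_sums (a k)) -> forall s, preserves_sums (act a s).
Proof.
move=> alin; elim=> [|k s IH] I r c F //=.
by rewrite -/(act a s _) IH alin.
Qed.

Variables a b : nat -> (T -> rat) -> T -> rat.
Hypotheses (alin : forall k, preserves_sums (a k)).
Hypotheses (a0 : a 0 = id) (b0 : b 0 = id).
Hypothesis ab : forall n v x, \sum_(i < n.+2) (-1) ^+ i * a i (b (n.+1 - i)%N v) x = 0.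

(** The term i = 0 of the relation [ab] is b_n itself; solving for it expresses b_n through smaller
    b's, to which the induction applies. *)
Lemma dual_exprE f n v x : (n <= f)%N ->
  b n v x = \sum_(p <- dual_expr f n) p.1 * act a p.2 v x.
Proof.
elim: f n v x => [|f IH] [|n] v x nf //; try by rewrite /= big_seq1 b0 mul1r.
have -> : b n.+1 v x = \sum_(i < n.+1) (-1) ^+ i * a i.+1 (b (n - i)%N v) x.
  have := ab n v x; rewrite big_ord_recl /= expr0 mul1r subn0 a0 /=.
  move/eqP; rewrite addr_eq0 => /eqP ->; rewrite -sumrN; apply: eq_bigr => i _.
  by rewrite /bump /= add1n subSS exprS mulN1r mulNr opprK.
rewrite dual_exprS big_flatten -(big_mkord xpredT (fun i => (-1) ^+ i * a i.+1 (b (n - i)%N v) x)).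
rewrite /index_iota subn0 [RHS]big_map; apply: eq_bigr => i _.
rewrite big_map /= (_ : b (n - i)%N v = fun y => \sum_(p <- dual_expr f (n - i)) p.1 * act a p.2 v y).
  by rewrite alin mulr_sumr; apply: eq_bigr => p _; rewrite /= mulrA.
by apply/funext => y; rewrite -IH //; lia.
Qed.

Lemma dual_wordE s v x : act b s v x = \sum_(p <- dual_word s) p.1 * act a p.2 v x.
Proof.
elim: s x => [|k s IH] x; first by rewrite /= big_seq1 mul1r.
rewrite act_cons (dual_exprE _ _ (leqnn k)) [RHS]big_allpairs_dep; apply: eq_bigr => p _.
rewrite (_ : act b s v = fun y => \sum_(q <- dual_word s) q.1 * act a q.2 v y); last first.
  by apply/funext => y; rewrite -IH.
rewrite (act_linear alin) mulr_sumr; apply: eq_bigr => q _.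
by rewrite /= act_cat mulrA.
Qed.
End DualWords.

Definition hprod V (l : seq nat) : fps := \prod_(d <- l) (hsym V d : fps).

Lemma hprod_gprod D V l : all (fun d => (d <= D)%N) l -> hprod V l = gprod D V l.
Proof.
by move=> /allP lD; apply: eq_big_seq => d dl; rewrite (hsymE _ (lD _ dl)).
Qed.

Lemma leq_sumn l : all (fun d => (d <= sumn l)%N) l.
Proof.
elim: l => //= d l IH; rewrite leq_addr; apply: sub_all IH => k kl.
exact: leq_trans kl (leq_addl _ _).
Qed.

(* Any bound on the entries that is at least max l gives the same count. *)
Definition cnth (l s : seq nat) : rat := cnt (sumn l + sumn s) l s.

Lemma cnth_cnt D l s : all (fun d => (d <= D)%N) l -> cnth l s = cnt D l s.
Proof.
move=> lD; rewrite /cnth !(cnt_gprod _ _ _ 0) -!hprod_gprod //.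
by apply: sub_all (leq_sumn l) => d dl; apply: leq_trans dl (leq_addr _ _).
Qed.

Lemma cnth_sym l s : cnth l s = cnth s l.
Proof. by rewrite /cnth cnt_sym addnC. Qed.

Lemma cnth_hprod l s i : cnth l s = hprod xpredT l (mon i s).
Proof. by rewrite (hprod_gprod _ (leq_sumn l)) -cnt_gprod (cnth_cnt _ (leq_sumn l)). Qed.

Lemma hprodE V l b : hprod V l b =
  if all V (msup b) then cnth l [seq b i | i <- msup b] else 0.
Proof.
by rewrite (hprod_gprod _ (leq_sumn l)) gprodE (cnth_cnt _ (leq_sumn l)).
Qed.

Section EH.

Let ea (k : nat) (f : monom -> rat) : monom -> rat := gsym 1 xpredT k * (f : fps).
Let ha (k : nat) (f : monom -> rat) : monom -> rat := (hsym xpredT k : fps) * (f : fps).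

Lemma fpsM_linear (g : fps) : @preserves_sums monom (fun f => g * (f : fps)).
Proof.
move=> I r c F; apply/funext => b.
rewrite (_ : (fun x => \sum_(i <- r) c i * F i x) = \sum_(i <- r) ((constf (c i) : fps) * (F i : fps))).
  rewrite mulr_sumr fps_sumE; apply: eq_bigr => i _.
  by rewrite mulrCA constfM_coef.
by apply/funext => x; rewrite fps_sumE; apply: eq_bigr => i _; rewrite constfM_coef.
Qed.

Let act_ea s : act ea s (1 : fps) = gprod 1 xpredT s.
Proof. by elim: s => [|k s IH]; rewrite /gprod ?big_nil // big_cons /= -/(act _ _ _) IH. Qed.

Let act_ha s : act ha s (1 : fps) = hprod xpredT s.
Proof. by elim: s => [|k s IH]; rewrite /hprod ?big_nil // big_cons /= -/(act _ _ _) IH. Qed.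

Let ea0 : ea 0 = id.
Proof. by apply/funext => f; rewrite /ea gsym_deg0 mul1r. Qed.

Let ha0 : ha 0 = id.
Proof. by apply/funext => f; rewrite /ha hsym_deg0 mul1r. Qed.

Let signE n (f : fps) b : ((-1) ^+ n * f) b = (-1) ^+ n * f b.
Proof.
elim: n f => [|n IH] f; rewrite ?mul1r // !exprS -!mulrA !mulN1r.
by rewrite fpsN IH.
Qed.

Let eh n v x : \sum_(i < n.+2) (-1) ^+ i * ea i (ha (n.+1 - i)%N v) x = 0.
Proof.
transitivity ((eh_sum xpredT n.+1 * (v : fps)) x); last by rewrite eh_sum0 mul0r fps0.
rewrite /eh_sum mulr_suml fps_sumE; apply: eq_bigr => i _.
by rewrite -!mulrA signE.
Qed.

(** This is H(-t) E(t) = 1, obtained from E(-t) H(t) = 1 by t -> -t: reversing the summation costs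
    the global sign (-1)^(n+1). *)
Let he n v x : \sum_(i < n.+2) (-1) ^+ i * ha i (ea (n.+1 - i)%N v) x = 0.
Proof.
rewrite (reindex_inj rev_ord_inj) /=.
transitivity ((-1) ^+ n.+1 * \sum_(i < n.+2) (-1) ^+ i * ea i (ha (n.+1 - i)%N v) x); last first.
  by rewrite eh mulr0.
rewrite mulr_sumr; apply: eq_bigr => i _; rewrite subSS mulrA.
have i_le : (i <= n.+1)%N by rewrite -ltnS.
rewrite /ea /ha subKn // mulrCA; congr (_ * _).
by rewrite -signr_odd oddB // -[in RHS]signr_odd -[X in _ * X]signr_odd -signr_addb.
Qed.

Lemma cnth_dual s t : cnth s t = \sum_(p <- dual_word s) p.1 * cnt 1 p.2 t.
Proof.
rewrite (cnth_hprod _ _ 0) -act_ha (@dual_wordE _ ea ha) //; last by move=> k; exact: fpsM_linear.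
by apply: eq_bigr => p _; rewrite act_ea -cnt_gprod.
Qed.

Lemma cnt1_dual s t : cnt 1 s t = \sum_(p <- dual_word s) p.1 * cnth p.2 t.
Proof.
rewrite (cnt_gprod _ _ _ 0) -act_ea (@dual_wordE _ ha ea) //; last by move=> k; exact: fpsM_linear.
by apply: eq_bigr => p _; rewrite act_ha -cnth_hprod.
Qed.
End EH.

Lemma cnt1_all_independent (c : seq nat -> rat) (L : seq (seq nat)) : uniq L ->
    (forall l, l \in L -> is_part l) ->
    (forall s, \sum_(l <- L) c l * cnt 1 l s = 0) ->
  forall l, l \in L -> c l = 0.
Proof.
move=> uL Lp L0; pose N := sumn (map sumn L).
apply: (@cnt1_independent N N) => // l lL.
have lN : (sumn l <= N)%N by apply: (allP (leq_sumn (map sumn L))); apply: map_f.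
have /andP[lb ls] := part_bound (Lp _ lL); rewrite Lp // (leq_trans ls lN) andbT.
by apply: sub_all lb => d dl; apply: leq_trans dl lN.
Qed.

(** By symmetry the dual words can be taken of s instead of l, so a linear relation among the
    [cnth l] holds among the [cnt 1 l] with the same coefficients. *)
Lemma cnth_independent (c : seq nat -> rat) (L : seq (seq nat)) : uniq L ->
    (forall l, l \in L -> is_part l) ->
    (forall s, \sum_(l <- L) c l * cnth l s = 0) ->
  forall l, l \in L -> c l = 0.
Proof.
move=> uL Lp L0; apply: cnt1_all_independent => // s.
under eq_bigr do rewrite cnt_sym cnt1_dual mulr_sumr.
rewrite exchange_big big1 // => p _.
by under eq_bigr do rewrite mulrCA cnth_sym; rewrite -mulr_sumr L0 mulr0.
Qed.

(* Both kinds of counts are symmetric, so that expressing the h's through the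
   e's also transforms the coefficients of an expansion. *)
Lemma dual_expansion n (c f g : seq nat -> rat) :
    (forall s, f s = \sum_(l <- parts n) c l * cnt 1 l s) ->
    (forall s, g s = \sum_(p <- dual_word s) p.1 * f p.2) ->
  forall s, g s = \sum_(l <- parts n) c l * cnth l s.
Proof.
move=> fE gE s; rewrite gE; under eq_bigr do rewrite fE mulr_sumr.
rewrite exchange_big; apply: eq_bigr => l _; rewrite cnth_sym cnth_dual mulr_sumr.
by apply: eq_bigr => p _; rewrite mulrCA cnt_sym.
Qed.

(** * The nilCoxeter algebra *)

Section RingIdentities.
Variables (T : Type) (o u : T) (add mul sub : T -> T -> T) (opp : T -> T).
Hypothesis T_ring : ring_theory o u add mul sub opp eq.
Add Ring T_ring : T_ring.
Local Infix "+!" := add (at level 50).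
Local Infix "*!" := mul (at level 40).

(** Here a and b stand for the values of [U i f] and [U (i + 1) f], longer names for composed
    operators; bab is already replaced by aba, and o = 0 is the value of aa and bb. *)
Lemma yang_baxter_identity x y f a b ab ba aba :
  ((f +! x *! a) +! (x +! y) *! (b +! x *! ba)) +! y *! ((a +! x *! o) +! (x +! y) *! (ab +! x *! aba)) =
  ((f +! y *! b) +! (x +! y) *! (a +! y *! ab)) +! x *! ((b +! y *! o) +! (x +! y) *! (ba +! y *! aba)).
Proof. ring. Qed.

Lemma straightening_identity x p q r s :
  s *! p = sub (r *! q +! (p +! x *! q) *! s) ((r +! x *! s) *! q).
Proof. ring. Qed.
End RingIdentities.

Lemma ring_theoryP (K : comNzRingType) :
  ring_theory 0 1 (fun x y : K => x + y) (fun x y => x * y) (fun x y => x - y) (fun x => - x) eq.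
Proof.
split=> *; rewrite ?add0r ?mul1r ?subrr ?mulrDl ?addrA ?mulrA //;
  [exact: addrC | exact: mulrC].
Qed.

Lemma simple_tr_l i : simple_tr i i = i + 1.
Proof. by rewrite /simple_tr eqxx. Qed.

Lemma simple_tr_r i : simple_tr i (i + 1) = i.
Proof. by rewrite /simple_tr eqxx; case: eqP => //; lia. Qed.

Lemma simple_tr_id i j : j != i -> j != i + 1 -> simple_tr i j = j.
Proof. by rewrite /simple_tr => /negPf-> /negPf->. Qed.

Lemma simple_trK i : involutive (simple_tr i).
Proof.
move=> j; have [->|ji] := eqVneq j i; first by rewrite simple_tr_l simple_tr_r.
have [->|ji1] := eqVneq j (i + 1); first by rewrite simple_tr_r simple_tr_l.
by rewrite !simple_tr_id.
Qed.

Section Operators.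
Variable K : comNzRingType.
Implicit Types (f g : (int -> int) -> K) (w : int -> int) (x y : K).

(* The right action of u_i in the nilCoxeter algebra, on coefficient functions:
   w occurs in v u_i only when v = w s_i is shorter than w. *)
Definition U (i : int) f : (int -> int) -> K :=
  fun w => if w (i + 1) < w i then f (w \o simple_tr i) else 0.

(** The right action of 1 + x u_i. *)
Definition hop (i : int) x f : (int -> int) -> K := fun w => f w + x * U i f w.

(* The right action of (1 + x u_(i+n-1)) ... (1 + x u_i). *)
Fixpoint A (i : int) (n : nat) x f : (int -> int) -> K :=
  if n is n'.+1 then hop i x (A (i + 1) n' x f) else f.

(* The right action of (1 + x u_i) ... (1 + x u_(i+n-1)). *)
Fixpoint B (i : int) (n : nat) x f : (int -> int) -> K :=
  if n is n'.+1 then B (i + 1) n' x (hop i x f) else f.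

Lemma UD i f g : U i (fun w => f w + g w) = fun w => U i f w + U i g w.
Proof. by apply/funext => w; rewrite /U; case: ifP => //; rewrite addr0. Qed.

Lemma UZ i x f : U i (fun w => x * f w) = fun w => x * U i f w.
Proof. by apply/funext => w; rewrite /U; case: ifP => //; rewrite mulr0. Qed.

Lemma U0 i : U i (fun=> 0) = fun=> 0.
Proof. by apply/funext => w; rewrite /U; case: ifP. Qed.

Lemma U_sum i (I : Type) (r : seq I) (F : I -> (int -> int) -> K) :
  U i (fun w => \sum_(k <- r) F k w) = fun w => \sum_(k <- r) U i (F k) w.
Proof.
apply/funext => w; rewrite /U; case: ifP => // _; by rewrite big1.
Qed.

Lemma UU i f : U i (U i f) = fun=> 0.
Proof.
apply/funext => w; rewrite /U /= simple_tr_l simple_tr_r.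
by case: (ltrP (w (i + 1)) (w i)) => // h1; case: ltrP => // h2; lia.
Qed.

Lemma U_comm i j f : 1 < `|i - j| -> U i (U j f) = U j (U i f).
Proof.
move=> ij; apply/funext => w; rewrite /U /=.
rewrite !(@simple_tr_id i j) ?(@simple_tr_id i (j + 1)) ?(@simple_tr_id j i) ?(@simple_tr_id j (i + 1)); try by lia.
case: ifP => // _; case: ifP => // _; congr f; apply/funext => k /=; congr w.
rewrite /simple_tr.
by do !case: eqP => //; lia.
Qed.

(** Either side can be nonzero only when w(i) > w(i+1) > w(i+2), and then both evaluate f at the
    same permutation. *)
Lemma U_braid i f : U i (U (i + 1) (U i f)) = U (i + 1) (U i (U (i + 1) f)).
Proof.
apply/funext => w; rewrite /U /=.
have st1 : simple_tr i (i + 1 + 1) = i + 1 + 1 by apply: simple_tr_id; lia.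
have st2 : simple_tr (i + 1) i = i by apply: simple_tr_id; lia.
rewrite !(simple_tr_l, simple_tr_r, st1, st2).
case: (ltrP (w (i + 1)) (w i)) => h1; case: (ltrP (w (i + 1 + 1)) (w (i + 1))) => h2;
  case: (ltrP (w (i + 1 + 1)) (w i)) => h3 //; try lia.
congr f; apply/funext => k /=; congr w; rewrite /simple_tr.
by do !case: eqP => //; lia.
Qed.

Lemma hopD i x y f : hop i x (hop i y f) = hop i (x + y) f.
Proof.
apply/funext => w; rewrite /hop UD UZ UU mulr0 addr0.
by rewrite -addrA -mulrDl [y + x]addrC.
Qed.

Lemma hop_comm i j x y f : 1 < `|i - j| -> hop i x (hop j y f) = hop j y (hop i x f).
Proof.
move=> ij; apply/funext => w; rewrite /hop !UD !UZ U_comm // !mulrDr !addrA.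
by congr (_ + _); [rewrite addrAC | rewrite mulrCA].
Qed.

Lemma hopU_comm i j y f : 1 < `|i - j| -> U i (hop j y f) = hop j y (U i f).
Proof. by move=> ij; apply/funext => w; rewrite /hop UD UZ U_comm. Qed.

Lemma yang_baxter i x y f :
  hop i y (hop (i + 1) (x + y) (hop i x f)) = hop (i + 1) x (hop i (x + y) (hop (i + 1) y f)).
Proof.
apply/funext => w; rewrite /hop; do !rewrite ?UD ?UZ; rewrite !UU -!U_braid.
exact: (yang_baxter_identity (ring_theoryP K)).
Qed.

Lemma A_hop_comm i n j x y f : j + 1 < i -> A i n x (hop j y f) = hop j y (A i n x f).
Proof.
elim: n i => //= n IH i ji; rewrite IH; last by lia.
by rewrite hop_comm //; lia.
Qed.

Lemma A_U_comm i n j x f : j + 1 < i -> U j (A i n x f) = A i n x (U j f).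
Proof.
elim: n i => //= n IH i ji; rewrite -IH; last by lia.
by rewrite hopU_comm //; lia.
Qed.

(* Fomin and Stanley: A_i(x) = A_(i+1)(x) h_i(x), and the Yang-Baxter relation
   exchanges h_i(x) h_(i+1)(y) h_i(y - x). *)
Lemma A_comm i n x y f : A i n x (A i n y f) = A i n y (A i n x f).
Proof.
elim: n i f => [|n IH] i f //=.
case: n IH => [|n] IH; first by rewrite /= !hopD addrC.
set A1 := A (i + 1) n.+1; set A2 := A (i + 1 + 1) n.
have A2h z v g : A2 z (hop i v g) = hop i v (A2 z g) by rewrite /A2 A_hop_comm //; lia.
have A1E z g : A1 z g = hop (i + 1) z (A2 z g) by [].
have A1K z g : A2 z g = hop (i + 1) (- z) (A1 z g).
  by rewrite A1E hopD addNr; apply/funext => w; rewrite /hop mul0r addr0.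
have exch g : hop i y (hop (i + 1) y (hop i x g)) =
    hop i x (hop (i + 1) x (hop i y (hop (i + 1) (y - x) g))).
  have hE h : hop i y h = hop i x (hop i (y - x) h) by rewrite hopD addrC subrK.
  have := yang_baxter i x (y - x) g; rewrite [x + (y - x)]addrC subrK => <-.
  by rewrite -hE.
transitivity (hop i y (hop (i + 1) y (hop i x (A2 y (A1 x f)))));
  last by rewrite -A2h -A1E.
rewrite [in RHS]A1K exch hopD addrAC subrr add0r.
have -> : A1 y (A1 x f) = A1 x (A1 y f) by rewrite /A1 IH.
by rewrite -A1K -A2h -A1E.
Qed.

(** The factors meet in opposite orders and cancel from the inside, since u_j^2 = 0 gives (1 + x
    u_j)(1 - x u_j) = 1. *)
Lemma AB_cancel i n x f : A i n (- x) (B i n x f) = f.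
Proof.
elim: n i f => //= n IH i f; rewrite IH hopD addNr.
by apply/funext => w; rewrite /hop mul0r addr0.
Qed.

End Operators.

(** * Coefficient operators *)

Lemma A_morph (K K' : comNzRingType) (phi : K -> K') i n x (f : (int -> int) -> K) :
    phi 0 = 0 -> {morph phi : a b / a + b} -> {morph phi : a b / a * b} ->
  A i n (phi x) (fun w => phi (f w)) = fun w => phi (A i n x f w).
Proof.
move=> p0 pD pM; elim: n i => //= n IH i; rewrite IH; apply/funext => w.
by rewrite /hop pD pM /U; case: ifP => // _; rewrite p0.
Qed.

(* The coefficient of x^k in A i n x. *)
Fixpoint acoef (i : int) (n k : nat) (f : (int -> int) -> rat) : (int -> int) -> rat :=
  match n, k with
  | 0%N, 0%N => f
  | 0%N, _.+1 => fun=> 0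
  | n'.+1, 0%N => acoef (i + 1) n' 0 f
  | n'.+1, k'.+1 => fun w => acoef (i + 1) n' k f w + U i (acoef (i + 1) n' k' f) w
  end.

Lemma acoef0 i n : acoef i n 0 = id.
Proof. by elim: n i => //= n IH i; apply/funext => f; rewrite IH. Qed.

Lemma acoef_linear i n k : preserves_sums (acoef i n k).
Proof.
elim: n i k => [|n IH] i [|k] I r c F //=.
- by apply/funext => w; rewrite big1 // => j _; rewrite mulr0.
- exact: IH.
rewrite !IH U_sum; apply/funext => w; rewrite -big_split; apply: eq_bigr => j _ /=.
by rewrite (UZ i (c j)) mulrDr.
Qed.

Section PolynomialCoefficients.
Local Notation C f := (fun w : int -> int => (f w)%:P).

(** The scalar c is -1 when A(-x) B(x) = 1 is read coefficientwise, and 1 in the comparison with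
    Dynkin reversal. *)
Lemma coef_A i n (c : rat) (g : (int -> int) -> {poly rat}) m w :
  (A i n (c%:P * 'X) g w)`_m =
    \sum_(k < m.+1) c ^+ k * acoef i n k (fun v => (g v)`_(m - k)) w.
Proof.
elim: n i m w => [|n IH] i m w /=.
  rewrite big_ord_recl big1 ?addr0 ?expr0 ?mul1r ?subn0 // => k _.
  by rewrite mulr0.
rewrite /hop coefD IH -mulrA coefCM coefXM big_ord_recl [RHS]big_ord_recl /=.
rewrite !subn0 -addrA; congr (_ + _).
case: m => [|m]; first by rewrite !big_ord0 mulr0 addr0.
have UE (h : (int -> int) -> {poly rat}) : (U i h w)`_m = U i (fun v => (h v)`_m) w.
  by rewrite /U; case: ifP; rewrite ?coef0.
rewrite /= UE.
rewrite (_ : (fun v => _) = (fun v => \sum_(k < m.+1) c ^+ k * acoef (i + 1) n k (fun v => (g v)`_(m - k)) v)); last first.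
  by apply/funext => v; rewrite IH.
rewrite U_sum mulr_sumr -big_split; apply: eq_bigr => k _ /=.
by rewrite UZ /bump /= add1n subSS mulrDr exprS mulrA.
Qed.

(** Taken from polynomials in one variable rather than by recursion, so that [AB_cancel] with x = 'X
    directly gives the relation with [acoef]. *)
Definition bcoef (i : int) (n k : nat) (f : (int -> int) -> rat) : (int -> int) -> rat :=
  fun w => (B i n 'X (C f) w)`_k.

Lemma bcoef0 i n : bcoef i n 0 = id.
Proof.
apply/funext => f; apply/funext => w; rewrite /bcoef.
suff H (g : (int -> int) -> {poly rat}) : (B i n 'X g w)`_0 = (g w)`_0 by rewrite H coefC.
elim: n i g => // n IH i g.
by rewrite (IH (i + 1) (hop i 'X g)) /hop coefD coefXM addr0.
Qed.

Lemma acoef_bcoef i n m v w :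
  \sum_(k < m.+2) (-1) ^+ k * acoef i n k (bcoef i n (m.+1 - k) v) w = 0.
Proof.
rewrite -(coef_A i n (-1) (B i n 'X (C v)) m.+1 w) polyCN mulN1r AB_cancel.
by rewrite coefC.
Qed.
End PolynomialCoefficients.

Definition off (V : pred int) (f : (int -> int) -> fps) :=
  forall w b, ~~ all V (msup b) -> f w b = 0.

Lemma off_hop (V : pred int) i k f : V k -> off V f -> off V (hop i (X k) f).
Proof.
move=> Vk fV w b bV; rewrite /hop fpsD fV // add0r.
apply: fpsM_off bV => c cV; last by rewrite /U; case: ifP => _; rewrite ?fV ?fps0.
rewrite /X monoE; case: eqP => // cE; case/negP: cV.
by rewrite cE /msup mdomU; apply/allP => j; rewrite in_fset1 => /eqP->.
Qed.

Lemma off_A (V : pred int) i n k f : V k -> off V f -> off V (A i n (X k) f).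
Proof. by move=> Vk fV; elim: n i => //= n IH i; apply: off_hop. Qed.

Lemma off_sub (V V' : pred int) f : subpred V V' -> off V f -> off V' f.
Proof. by move=> VV' fV w b bV; apply: fV; apply: contraNN bV; apply: sub_all. Qed.

Lemma expcmnS (b : monom) k : expcmn b k.+1 = mmul b (expcmn b k).
Proof. by apply: cmonom_ext => i; rewrite cmM !expcmnE mulSn. Qed.

(** As x_j occurs neither in f nor in c, it plays the role of the formal variable of [acoef]. *)
Lemma A_coef (V : pred int) i n j k f (c : monom) w : ~~ V j -> off V f -> c j = 0%N ->
  A i n (X j) f w (mmul (expcmn (ucm j) k) c) = acoef i n k (fun v => f v c) w.
Proof.
move=> Vj fV cj; elim: n i k w => [|n IH] i k w.
  case: k => [|k]; first by rewrite mul1m.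
  rewrite [LHS]fV //; apply: contraNN Vj => /allP; apply.
  by rewrite msupE cmM expcmnE cmUU muln1.
rewrite [A _ _ _ _]/(hop i (X j) (A (i + 1) n (X j) f)) /hop fpsD IH; case: k => [|k].
  by rewrite mul1m [(X j * _) c]varM_coef0 // addr0.
rewrite expcmnS -mulmA [(X j * _) _]varM_coef.
rewrite [RHS]/(acoef (i + 1) n k.+1 (fun v => f v c) w + U i (acoef (i + 1) n k (fun v => f v c)) w).
congr (_ + _).
rewrite -(_ : (fun v => A (i + 1) n (X j) f v (mmul (expcmn (ucm j) k) c)) = acoef (i + 1) n k (fun v => f v c)); last first.
  by apply/funext => v; rewrite IH.
by rewrite /U; case: ifP => _; rewrite ?fps0.
Qed.

(** The unit of the nilCoxeter algebra, as a coefficient function. *)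
Definition delta (K : comNzRingType) : (int -> int) -> K := fun w => if `[< w = id >] then 1 else 0.

(** Both sides are the coefficient of the same monomial in two distinct variables, x_1 and x_2, in
    the commuting products of A(x_1) and A(x_2) acting on f made into constants. *)
Lemma acoef_comm i n k l f : acoef i n k (acoef i n l f) = acoef i n l (acoef i n k f).
Proof.
pose F (w : int -> int) : fps := constf (f w).
have offF : off pred0 F.
  move=> w b; rewrite /F /constf; case: eqP => // ->.
  by rewrite /msup mdom1.
have Fone : (fun v => F v mone) = f by apply/funext => v; rewrite /F /constf eqxx.
have main p q m r : p != q ->
    (fun w => A i n (X p) (A i n (X q) F) w (mmul (expcmn (ucm p) m) (expcmn (ucm q) r))) =
    acoef i n m (acoef i n r f).
  move=> pq; apply/funext => w; rewrite (@A_coef (pred1 q)) /= ?(negPf pq) //; last 2 first.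
  - by apply: off_A => //=; apply: off_sub offF.
  - by rewrite expcmnE cmU eq_sym (negPf pq) muln0.
  congr (acoef i n m _ w); apply/funext => v.
  by rewrite -[expcmn _ r]mulm1 (@A_coef pred0) ?cm1 // Fone.
rewrite -(main 1 2 k l) // -(main 2 1 l k) //; apply/funext => w.
by rewrite A_comm mulmC.
Qed.

(** * Supports, shifts and Dynkin reversal *)

Definition supported (lo N : int) (w : int -> int) : Prop :=
  forall j, if lo <= j <= N then lo <= w j <= N else w j == j.

Lemma supported_in lo N w j : supported lo N w -> lo <= j <= N -> lo <= w j <= N.
Proof. by move=> /(_ j) + jN; rewrite jN. Qed.

Lemma supported_out lo N w j : supported lo N w -> ~~ (lo <= j <= N) -> w j = j.
Proof. by move=> /(_ j) + jN; rewrite (negPf jN) => /eqP. Qed.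

Lemma supported_widen lo lo' N N' w : lo' <= lo -> N <= N' ->
  supported lo N w -> supported lo' N' w.
Proof.
move=> ll NN wS j; have := wS j; do !case: ifP => //; try lia.
Qed.

Lemma supported_swap lo N w i : supported lo N w -> lo <= i -> i < N ->
  supported lo N (w \o simple_tr i).
Proof.
move=> wS li iN j /=; have [->|ji] := eqVneq j i.
  by rewrite simple_tr_l; have := wS (i + 1); do !case: ifP => //; lia.
have [->|ji1] := eqVneq j (i + 1).
  by rewrite simple_tr_r; have := wS i; do !case: ifP => //; lia.
by rewrite simple_tr_id //; exact: wS.
Qed.

Lemma supported_no_descent lo N w i : supported lo N w -> (i < lo) || (N <= i) ->
  (w (i + 1) < w i) = false.
Proof.
move=> wS iN; have := wS i; have := wS (i + 1); do !case: ifP => //; try lia.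
Qed.

(** On such permutations u_i acts as zero unless lo <= i < N, which allows truncating the products
    at both ends. *)
Definition eq_on lo N (f g : (int -> int) -> rat) := forall w, supported lo N w -> f w = g w.

Lemma eq_on_trans lo N f g h : eq_on lo N f g -> eq_on lo N g h -> eq_on lo N f h.
Proof. by move=> fg gh w wS; rewrite fg ?gh. Qed.

Lemma eq_on_U lo N i f g : eq_on lo N f g -> eq_on lo N (U i f) (U i g).
Proof.
move=> fg w wS; rewrite /U; case: ifP => // wi; apply: fg.
have [iN|] := boolP ((i < lo) || (N <= i)).
  by rewrite (supported_no_descent wS iN) in wi.
by rewrite negb_or -ltNge -leNgt => /andP[*]; apply: supported_swap.
Qed.

Lemma eq_on_U0 lo N i f : (i < lo) || (N <= i) -> eq_on lo N (U i f) (fun=> 0).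
Proof. by move=> iN w wS; rewrite /U (supported_no_descent wS iN). Qed.

Lemma eq_on_acoef lo N i n k f g : eq_on lo N f g -> eq_on lo N (acoef i n k f) (acoef i n k g).
Proof.
move=> fg; elim: n i k => [|n IH] i [|k].
- exact: fg.
- by [].
- exact: (IH (i + 1) 0%N).
move=> w wS /=; congr (_ + _); first exact: IH.
exact: (eq_on_U i (IH (i + 1) k)).
Qed.

Lemma acoef_above lo N i n k f : N <= i ->
  eq_on lo N (acoef i n k f) (acoef i 0 k f).
Proof.
elim: n i k => [|n IH] i [|k] Ni //=; first by rewrite acoef0.
move=> w wS; rewrite (IH (i + 1)) //=; last by lia.
by rewrite (eq_on_U0 _ _ wS) ?addr0 // Ni orbT.
Qed.

Lemma acoef_upper lo N i n m k f : N <= i + n%:Z ->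
  eq_on lo N (acoef i (n + m) k f) (acoef i n k f).
Proof.
elim: n i k => [|n IH] i [|k] Ni; rewrite ?acoef0 //.
  by apply: acoef_above; lia.
rewrite addSn /= => w wS; rewrite IH //; last by lia.
congr (_ + _); apply: (eq_on_U i _ wS); apply: IH; lia.
Qed.

Lemma acoef_below lo N i n k f : i < lo ->
  eq_on lo N (acoef i n.+1 k f) (acoef (i + 1) n k f).
Proof.
case: k => [|k] il //= w wS.
by rewrite (eq_on_U0 _ _ wS) ?addr0 // il.
Qed.

(** Truncated difference: the number of generators u_j with i <= j < N. *)
Definition len (N i : int) : nat := if (N - i)%R is Posz n then n else 0%N.

Lemma len_ge N i : N <= i -> len N i = 0%N.
Proof. by rewrite /len; case E : (N - i)%R => [[|n]|n] //; lia. Qed.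

Lemma len_le N i : i <= N -> i + (len N i)%:Z = N.
Proof. by rewrite /len; case E : (N - i)%R => [n|n]; lia. Qed.

Lemma len_shift (N i m : int) : len (N + m) (i + m) = len N i.
Proof. by rewrite /len (_ : N + m - (i + m) = N - i) //; lia. Qed.

Definition arange (N i : int) (k : nat) := acoef i (len N i) k.

Lemma arange0 N i : arange N i 0 = id. Proof. exact: acoef0. Qed.

Lemma eq_on_arange lo N M i k f g : eq_on lo N f g ->
  eq_on lo N (arange M i k f) (arange M i k g).
Proof. exact: eq_on_acoef. Qed.

Lemma arange_upper lo N M i k f : N <= M -> eq_on lo N (arange M i k f) (arange N i k f).
Proof.
move=> NM; rewrite /arange; case: (leP i N) => iN.
  rewrite (_ : len M i = len N i + (len M i - len N i))%N; last first.
    by have := len_le iN; have := len_le (le_trans iN NM); lia.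
  by apply: acoef_upper; rewrite len_le.
rewrite (len_ge (ltW iN)); apply: acoef_above; lia.
Qed.

Lemma arange_below lo N i k f : i <= lo -> lo <= N ->
  eq_on lo N (arange N i k f) (arange N lo k f).
Proof.
move=> il lN; have [n] := ubnP (absz (lo - i)%R); elim: n i il => // n IH i il nE.
have [->//|il'] := eqVneq i lo.
apply: (@eq_on_trans _ _ _ (arange N (i + 1) k f)); last by apply: IH; lia.
rewrite /arange (_ : len N i = (len N (i + 1)).+1).
  by apply: acoef_below; lia.
have iN : i <= N by lia.
have i1N : i + 1 <= N by lia.
by have := len_le iN; have := len_le i1N; lia.
Qed.

(* The coefficient of x_i^(s_0) x_(i+1)^(s_1) ... in
   f A_[i,N)(x_i) A_[i+1,N)(x_(i+1)) ... *)
Fixpoint flagged (N i : int) (f : (int -> int) -> rat) (s : seq nat) : (int -> int) -> rat :=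
  if s is k :: s' then flagged N (i + 1) (arange N i k f) s' else f.

Lemma flagged_cat N i f s t :
  flagged N i f (s ++ t) = flagged N (i + (size s)%:Z) (flagged N i f s) t.
Proof.
elim: s i f => [|k s IH] i f /=; first by rewrite addr0.
by rewrite IH; congr flagged; lia.
Qed.

Lemma flagged_nseq0 N i f n : flagged N i f (nseq n 0%N) = f.
Proof. by elim: n i => //= n IH i; rewrite arange0 IH. Qed.

Lemma eq_on_flagged lo N M i f g s : eq_on lo N f g ->
  eq_on lo N (flagged M i f s) (flagged M i g s).
Proof. by elim: s i f g => //= k s IH i f g fg; apply/IH/eq_on_arange. Qed.

Lemma flagged_upper lo N M i f s : N <= M ->
  eq_on lo N (flagged M i f s) (flagged N i f s).
Proof.
move=> NM; elim: s i f => //= k s IH i f.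
apply: eq_on_trans (IH _ _); apply: eq_on_flagged; exact: arange_upper.
Qed.

Lemma act_perm (T : Type) (a : nat -> (T -> rat) -> T -> rat) s t v :
    (forall k l f, a k (a l f) = a l (a k f)) -> perm_eq s t -> act a s v = act a t v.
Proof.
move=> aC; elim: s t => [|k s IH] t; first by rewrite perm_sym => /perm_nilP ->.
move=> kst; have kt : k \in t by rewrite -(perm_mem kst) mem_head.
have tE : t = take (index k t) t ++ k :: drop (index k t).+1 t.
  by rewrite -{2}(nth_index 0%N kt) -drop_nth ?index_mem // cat_take_drop.
rewrite tE in kst *; set t1 := take _ _ in kst *; set t2 := drop _ _ in kst *.
have st : perm_eq s (t1 ++ t2).
  by move: kst; rewrite perm_sym -cat1s perm_catCA /= perm_cons perm_sym.
rewrite act_cons (IH _ st) !act_cat act_cons.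
by elim: t1 {kst st tE} => [|j t1 IH1] //=; rewrite aC IH1.
Qed.

Lemma arange_comm N i k l f : arange N i k (arange N i l f) = arange N i l (arange N i k f).
Proof. exact: acoef_comm. Qed.

(* Below the support all the factors coincide. *)
Lemma flagged_below lo N i f s : i + (size s)%:Z <= lo + 1 -> lo <= N ->
  eq_on lo N (flagged N i f s) (act (arange N lo) s f).
Proof.
move=> + lN; elim: s i f => [|k s IH] i f il //=.
have ilo : i <= lo by move: il => /=; lia.
apply: (@eq_on_trans _ _ _ (flagged N (i + 1) (arange N lo k f) s)).
  by apply: eq_on_flagged; apply: arange_below.
apply: eq_on_trans (IH _ _ _) _; first by move: il => /=; lia.
(* [flagged] applies the first entry of the list first, [act] applies it last; the operators
   commute. *)
have -> : act (arange N lo) s (arange N lo k f) = act (arange N lo) (rcons s k) f.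
  by rewrite -cats1 act_cat.
rewrite (@act_perm _ _ _ (k :: s)) ?perm_rcons //; exact: arange_comm.
Qed.

Lemma shift_swap m w i : shift m w \o simple_tr (i + m%:Z) = shift m (w \o simple_tr i).
Proof.
apply/funext => j; rewrite /shift /=; congr (w _ + _).
by rewrite /simple_tr; do !case: eqP => //; lia.
Qed.

Lemma U_shift i m (f : (int -> int) -> rat) w :
  U (i + m%:Z) f (shift m w) = U i (fun v => f (shift m v)) w.
Proof.
rewrite /U shift_swap {1 2}/shift addrK (_ : i + m%:Z + 1 - m%:Z = i + 1); last by lia.
by rewrite ltrD2r.
Qed.

Lemma acoef_shift i n m k f w :
  acoef (i + m%:Z) n k f (shift m w) = acoef i n k (fun v => f (shift m v)) w.
Proof.
have iE j : j + m%:Z + 1 = j + 1 + m%:Z by lia.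
elim: n i k w => [|n IH] i [|k] w //=; rewrite iE IH // U_shift; congr (_ + U i _ w).
by apply/funext => v; rewrite IH.
Qed.

Lemma flagged_shift N i m f s w :
  flagged (N + m%:Z) (i + m%:Z) f s (shift m w) = flagged N i (fun v => f (shift m v)) s w.
Proof.
elim: s i f w => //= k s IH i f w.
rewrite (_ : i + m%:Z + 1 = i + 1 + m%:Z) ?IH; last by lia.
congr flagged; apply/funext => v; rewrite /arange len_shift; exact: acoef_shift.
Qed.

Lemma delta_shift K m w : delta K (shift m w) = delta K w.
Proof.
rewrite /delta (_ : `[< shift m w = id >] = `[< w = id >]) //; apply/asbool_equiv_eq.
split=> [wid|->]; apply/funext => j; last by rewrite /shift /=; lia.
by have := congr1 (@^~ (j + m%:Z)) wid; rewrite /shift /= addrK => /addIr.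
Qed.

Lemma hatK : involutive hat.
Proof. by move=> w; apply/funext => i; rewrite /hat (_ : 1 - (1 - i) = i); lia. Qed.

Lemma hat_swap w i : hat w \o simple_tr i = hat (w \o simple_tr (- i)).
Proof.
apply/funext => j; rewrite /hat /=; congr (1 - w _).
by rewrite /simple_tr; do !case: eqP => //; lia.
Qed.

Lemma hop_hat (K : comNzRingType) i x (f : (int -> int) -> K) w :
  hop i x f (hat w) = hop (- i) x (fun v => f (hat v)) w.
Proof.
rewrite /hop /U hat_swap {2 3}/hat; congr (_ + _ * _).
rewrite (_ : 1 - (i + 1) = - i); last by lia.
rewrite (_ : 1 - i = - i + 1); last by lia.
by rewrite (_ : (1 - w (- i) < 1 - w (- i + 1)) = (w (- i + 1) < w (- i))) //; lia.
Qed.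

Lemma B_rcons (K : comNzRingType) i n x (f : (int -> int) -> K) :
  B i n.+1 x f = hop (i + n%:Z) x (B i n x f).
Proof.
elim: n i f => [|n IH] i f; first by rewrite /= addr0.
transitivity (B (i + 1) n.+1 x (hop i x f)); first by [].
rewrite [LHS]IH (_ : i + 1 + n%:Z = i + n.+1%:Z) //; lia.
Qed.

(** Reversal replaces u_j by u_(-j), so the product with decreasing indices over [i, i + n) becomes
    one with increasing indices, starting at -(i + n - 1). *)
Lemma A_hat (K : comNzRingType) i n x (f : (int -> int) -> K) w :
  A i n x f (hat w) = B (1 - i - n%:Z) n x (fun v => f (hat v)) w.
Proof.
elim: n i w => [|n IH] i w //.
rewrite B_rcons; transitivity (hop i x (A (i + 1) n x f) (hat w)); first by [].
rewrite hop_hat.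
rewrite (_ : 1 - i - n.+1%:Z + n%:Z = - i); last by lia.
congr (hop _ x _ w); apply/funext => v; rewrite IH; congr (B _ _ _ _ v); lia.
Qed.

Lemma acoef_hat i n k f w :
  acoef i n k f (hat w) = bcoef (1 - i - n%:Z) n k (fun v => f (hat v)) w.
Proof.
(* With constant polynomials as values, only the last term of [coef_A] survives. *)
rewrite /bcoef -(A_hat i n 'X (fun v => (f v)%:P) w) -['X]mul1r -polyC1 coef_A (bigD1 (@ord_max k)) //= big1 => [|j jk].
  by rewrite expr1n mul1r addr0; congr (acoef _ _ _ _ (hat w)); apply/funext => v; rewrite subnn coefC.
rewrite (_ : (fun v => _) = fun=> 0); last first.
  apply/funext => v; rewrite coefC subn_eq0 leqNgt (_ : (j < k)%N) //.
  by rewrite ltn_neqAle -ltnS ltn_ord andbT; apply: contraNN jk => /eqP jk; apply/eqP/val_inj.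
have := @acoef_linear i n j void [::] (fun=> 0) (fun _ _ => 0).
rewrite (_ : (fun x => _) = fun=> 0); last by apply/funext => v; rewrite big_nil.
by move=> ->; rewrite big_nil mulr0.
Qed.

(** * Schubert polynomials *)

Section FlaggedProduct.
Variable K : comNzRingType.
Implicit Types (x : int -> K) (f : (int -> int) -> K).

(* f A_[i,N)(x_i) A_[i+1,N)(x_(i+1)) ..., with r factors. *)
Fixpoint Aflag x (N i : int) (r : nat) f : (int -> int) -> K :=
  if r is r'.+1 then Aflag x N (i + 1) r' (A i (len N i) (x i) f) else f.

Lemma Aflag_add x N i r m f :
  Aflag x N i (r + m) f = Aflag x N (i + r%:Z) m (Aflag x N i r f).
Proof.
elim: r i f => [|r IH] i f /=; first by rewrite addr0.
by rewrite IH; congr Aflag; lia.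
Qed.

Lemma Aflag_id x N i r f : N <= i -> Aflag x N i r f = f.
Proof. by elim: r i f => //= r IH i f Ni; rewrite len_ge //= IH //; lia. Qed.

Lemma eq_Aflag x x' N i r f : (forall j, i <= j -> j < i + r%:Z -> x j = x' j) ->
  Aflag x N i r f = Aflag x' N i r f.
Proof.
elim: r i f => //= r IH i f xx; rewrite xx ?IH //; try lia.
by move=> j ij jr; apply: xx; lia.
Qed.

Lemma U_Aflag x N i j r f : j + 1 < i -> U j (Aflag x N i r f) = Aflag x N i r (U j f).
Proof. by elim: r i f => //= r IH i f ji; rewrite IH ?A_U_comm //; lia. Qed.

Lemma A_addZ i n y c f g :
  A i n y (fun w => f w + c * g w) = fun w => A i n y f w + c * A i n y g w.
Proof.
elim: n i => //= n IH i; rewrite IH; apply/funext => w; rewrite /hop UD UZ.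
by rewrite !mulrDr addrACA [y * (c * _)]mulrCA.
Qed.

Lemma Aflag_addZ x N i r c f g :
  Aflag x N i r (fun w => f w + c * g w) =
  fun w => Aflag x N i r f w + c * Aflag x N i r g w.
Proof. by elim: r i f g => //= r IH i f g; rewrite A_addZ IH. Qed.

(** The origin of the divided differences. With y = x_(i+1) and z = x_i, commutation gives Q = (1 +
    y U_i) g = (1 + z U_i) g'. Since U_i squares to zero, U_i g = U_i Q = U_i g', and subtracting
    yields g - g' = (z - y) U_i g. *)
Lemma Aflag_swap x i n f :
  let g := A (i + 1) n (x (i + 1)) (A i n.+1 (x i) f) in
  let g' := A (i + 1) n (x i) (A i n.+1 (x (i + 1)) f) in
  g = fun w => g' w + (x i - x (i + 1)) * U i g w.
Proof.
set y := x (i + 1); set z := x i => g g'.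
pose Q := A i n.+1 y (A i n.+1 z f).
have Qg : Q = hop i y g by [].
have Qg' : Q = hop i z g' by rewrite /Q A_comm.
have UQ : U i Q = U i g.
  by rewrite Qg /hop UD UZ UU; apply/funext => w; rewrite mulr0 addr0.
have hE v h w : hop i v h w = h w + v * U i h w by [].
have UQ' : U i Q = U i g'.
  by rewrite Qg' /hop UD UZ UU; apply/funext => w; rewrite mulr0 addr0.
apply/funext => w; have : hop i y g w = hop i z g' w by rewrite -Qg -Qg'.
rewrite !hE -UQ -UQ' mulrBl addrA => <-.
by rewrite addrK.
Qed.
End FlaggedProduct.

Lemma Aflag_morph (K K' : comNzRingType) (phi : K -> K') x N i r (f : (int -> int) -> K) :
    phi 0 = 0 -> {morph phi : a b / a + b} -> {morph phi : a b / a * b} ->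
  Aflag (fun j => phi (x j)) N i r (fun w => phi (f w)) = fun w => phi (Aflag x N i r f w).
Proof.
move=> p0 pD pM; elim: r i f => //= r IH i f.
by rewrite (A_morph i (len N i) (x i) f p0 pD pM) IH.
Qed.

Lemma off_Aflag (V : pred int) N i r f : (forall j, i <= j -> j < i + r%:Z -> V j) ->
  off V f -> off V (Aflag X N i r f).
Proof.
elim: r i f => //= r IH i f Vi fV; apply: IH; first by move=> j ij jr; apply: Vi; lia.
by apply: off_A => //; apply: Vi; lia.
Qed.

(** The variables are read off in increasing order, each of them fresh when its factor is applied; c
    is the part of the monomial already read. *)
Lemma Aflag_coef N i f s (c : monom) w : off (fun j => j < i) f ->
    (forall j, j \in msup c -> j < i) ->
  Aflag X N i (size s) f w (mmul c (mon i s)) = flagged N i (fun v => f v c) s w.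
Proof.
elim: s i f c w => [|k s IH] i f c w fi ci /=; first by rewrite mulm1.
rewrite mulmA IH.
- congr flagged; apply/funext => v; rewrite mulmC.
  apply: (@A_coef (fun j => j < i)) => //=; first by rewrite ltxx.
  by apply/eqP; rewrite -[_ == _]negbK -msupE; apply/negP => /ci; rewrite ltxx.
- apply: off_A => /=; first by lia.
  by apply: off_sub fi => j /=; lia.
- move=> j; rewrite msupE cmM expcmnE cmU; have [->|ij] := eqVneq i j; first by lia.
  by rewrite muln0 addn0 -msupE => /ci; lia.
Qed.

Lemma rename_tr i (b : monom) j : rename (simple_tr i) b j = b (simple_tr i j).
Proof. by rewrite -{1}(simple_trK i j) renameE //; exact: inv_inj (simple_trK i). Qed.

Lemma rename_trK i : involutive (rename (simple_tr i)).
Proof. by move=> b; apply: cmonom_ext => j; rewrite !rename_tr simple_trK. Qed.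

Lemma rename_trM i : {morph rename (simple_tr i) : b c / mmul b c}.
Proof. by move=> b c; apply: cmonom_ext => j; rewrite !(rename_tr, cmM). Qed.

Definition tr_fps (i : int) (f : fps) : fps := fun b => f (rename (simple_tr i) b).

Lemma tr_fps0 i : tr_fps i 0 = 0.
Proof. by apply/funext => b; rewrite /tr_fps !fps0. Qed.

Lemma tr_fps1 i : tr_fps i 1 = 1.
Proof.
apply/funext => b; rewrite /tr_fps !fps1E /sone; congr (_%:R); congr nat_of_bool.
apply/eqP/eqP => [|->]; last by apply: cmonom_ext => j; rewrite rename_tr !cm1.
move=> bi; apply: (can_inj (rename_trK i)); rewrite bi.
by apply: cmonom_ext => j; rewrite rename_tr !cm1.
Qed.

Lemma tr_fpsD i : {morph tr_fps i : f g / f + g}.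
Proof. by move=> f g; apply/funext => b; rewrite /tr_fps !fpsD. Qed.

Lemma tr_fpsM i : {morph tr_fps i : f g / f * g}.
Proof.
by move=> f g; apply/funext => b; apply: (smul_comp _ _ (rename_trK i) (rename_trK i)); exact: rename_trM.
Qed.

Lemma tr_fpsX i k : tr_fps i (X k) = X (simple_tr i k).
Proof.
apply/funext => b; rewrite /tr_fps /X !monoE; congr (_%:R); congr nat_of_bool.
have E : rename (simple_tr i) (ucm k) = ucm (simple_tr i k).
  apply: cmonom_ext => j; rewrite rename_tr !cmU; congr nat_of_bool.
  by apply/eqP/eqP => [->|<-]; rewrite simple_trK.
by rewrite -E; apply/eqP/eqP => [<-|->]; rewrite rename_trK.
Qed.

Lemma fps_of_simple_act i P : fps_of (simple_act i P) = tr_fps i (fps_of P).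
Proof.
apply/funext => b; rewrite /fps_of /tr_fps /simple_act raddf_sum /=.
rewrite (eq_bigr (fun c => P@_c *+ (c == rename (simple_tr i) b))); last first.
  by move=> c _; rewrite mcoeffU (can2_eq (rename_trK i) (rename_trK i)).
have [Pb|Pb] := boolP (rename (simple_tr i) b \in msupp P).
  rewrite (big_fsetD1 _ Pb) /= eqxx big1_seq /= ?addr0 // => c.
  by rewrite in_fsetD1 => /andP[/negPf-> _].
rewrite big1_seq => [|c /= cP]; first by rewrite mcoeff_outdom.
by case: eqP => // cE; rewrite -cE cP in Pb.
Qed.

Lemma fps_ofM P Q : fps_of (P * Q) = fps_of P * fps_of Q.
Proof. exact: rmorphM. Qed.

Lemma fps_ofB P Q : fps_of (P - Q) = fps_of P - fps_of Q.
Proof. exact: rmorphB. Qed.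

(** The coefficient of w in A_[1,N)(x_1) A_[2,N)(x_2) ..., which is the Schubert polynomial for w in
    S_N. *)
Definition schubN (N : nat) (w : int -> int) : poly_ring :=
  Aflag var N%:Z 1 N (delta poly_ring) w.

Lemma fps_of_schubN N w : fps_of (schubN N w) = Aflag X N%:Z 1 N (delta fps) w.
Proof.
have := congr1 (@^~ w) (@Aflag_morph poly_ring fps fps_of var N%:Z 1 N (delta poly_ring) (rmorph0 _) (rmorphD _) (rmorphM _)).
move=> /= <-; congr (Aflag _ _ _ _ _ w); apply/funext => k.
  by rewrite fps_of_var.
by rewrite /delta; case: ifP => _; rewrite ?rmorph1 ?rmorph0.
Qed.

Lemma delta_off : off pred0 (delta fps).
Proof.
move=> w b bV; rewrite /delta; case: ifP => _; last by rewrite fps0.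
by rewrite fps1E /sone; case: eqP bV => // ->; rewrite /msup mdom1.
Qed.

Lemma schubN_coef N s w : (schubN N w)@_(mon 1 s) = flagged N%:Z 1 (delta rat) s w.
Proof.
rewrite -[LHS]/(fps_of _ _) fps_of_schubN.
(* Zeros are appended to have at least one exponent per factor; factors with index N or more are
   trivial. *)
pose m := (N - size s)%N; pose s' := s ++ nseq m 0%N.
have -> : mon 1 s = mon 1 s' by rewrite mon_cat mon_nseq0 mulm1.
have -> : flagged N%:Z 1 (delta rat) s w = flagged N%:Z 1 (delta rat) s' w.
  by rewrite flagged_cat flagged_nseq0.
have -> : Aflag X N%:Z 1 N (delta fps) = Aflag X N%:Z 1 (size s') (delta fps).
  have -> : size s' = (N + (size s' - N))%N by rewrite size_cat size_nseq; lia.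
  by rewrite Aflag_add (@Aflag_id _ _ _ (1 + N%:Z)) //; lia.
rewrite -[mon 1 s']mul1m Aflag_coef.
- congr flagged; apply/funext => v; rewrite /delta; case: ifP => _; last by rewrite fps0.
  by rewrite fps1E /sone eqxx.
- by apply: off_sub delta_off.
- by move=> j; rewrite /msup mdom1 in_fset0.
Qed.

Lemma schubN_off N w (b : monom) : ~~ all (fun j => 1 <= j) (msup b) -> (schubN N w)@_b = 0.
Proof.
move=> bV; rewrite -[LHS]/(fps_of _ _) fps_of_schubN.
apply: (@off_Aflag (fun j => 1 <= j)) bV => //; exact: off_sub delta_off.
Qed.

Lemma mon1_ex (b : monom) : all (fun j => 1 <= j) (msup b) -> exists s, b = mon 1 s.
Proof.
move=> /allP b1; pose n := (\sum_(j <- msup b) absz j)%N.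
exists [seq b j | j <- vars 1 n]; rewrite mon_map // => j jb; rewrite b1 //=.
have : (absz j <= n)%N by rewrite /n (big_fsetD1 j) //= leq_addr.
lia.
Qed.

Lemma schubN_widen N M w : (N <= M)%N -> supported 1 N%:Z w -> schubN M w = schubN N w.
Proof.
move=> NM wS; apply/malgP => b; have [/mon1_ex[s ->]|b1] := boolP (all (fun j => 1 <= j) (msup b)).
  by rewrite !schubN_coef; apply: flagged_upper wS; lia.
by rewrite !schubN_off.
Qed.

Lemma schubN_divided_difference N w i : 1 <= i -> i < N%:Z -> w (i + 1) < w i ->
  is_divided_difference i (schubN N w) (schubN N (w \o simple_tr i)).
Proof.
move=> i1 iN wi; rewrite /is_divided_difference; apply: fps_of_inj.
rewrite fps_ofM fps_ofB [fps_of (schubN N w - _)]fps_ofB.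
transitivity ((X i - X (i + 1)) * fps_of (schubN N (w \o simple_tr i))).
  by congr (_ * _); congr (_ - _); exact: fps_of_var.
transitivity (fps_of (schubN N w) - tr_fps i (fps_of (schubN N w))); last first.
  by congr (_ - _); apply/esym/fps_of_simple_act.
rewrite !fps_of_schubN.
set P := Aflag X N%:Z 1 N (delta fps).
(* There are k factors before those of x_i and x_(i+1), and r after. Exchanging the two variables
   affects only the middle pair, and the later factors commute with U_i. *)
pose k := absz (i - 1)%R; pose r := (N - k - 2)%N.
have kE : 1 + k%:Z = i by rewrite /k; lia.
have NE : N = (k + r.+2)%N by rewrite /r /k; lia.
pose f := Aflag X N%:Z 1 k (delta fps).
pose n := len N%:Z (i + 1).
have lenE : len N%:Z i = n.+1.
  have iN' : i <= N%:Z by lia. have iN1 : i + 1 <= N%:Z by lia.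
  by rewrite /n; have := len_le iN'; have := len_le iN1; lia.
pose g := A (i + 1) n (X (i + 1)) (A i n.+1 (X i) f).
pose g' := A (i + 1) n (X i) (A i n.+1 (X (i + 1)) f).
have PE : P = Aflag X N%:Z (i + 1 + 1) r g.
  by rewrite /P [X in Aflag _ _ _ X]NE Aflag_add kE /= lenE.
have PE' : (fun v => tr_fps i (P v)) = Aflag X N%:Z (i + 1 + 1) r g'.
  rewrite /P -(Aflag_morph _ _ _ _ _ (tr_fps0 i) (@tr_fpsD i) (@tr_fpsM i)).
  rewrite [X in Aflag _ _ _ X]NE Aflag_add kE /= lenE !tr_fpsX simple_tr_l simple_tr_r.
  rewrite (@eq_Aflag _ _ X) => [|j ij jr]; last first.
    by rewrite tr_fpsX simple_tr_id //; lia.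
  congr Aflag; congr A; congr A.
  rewrite (@eq_Aflag _ _ X) => [|j ij jr]; last first.
    by rewrite tr_fpsX simple_tr_id //; lia.
  congr Aflag; apply/funext => v; rewrite /delta.
  by case: ifP => _; rewrite ?tr_fps1 ?tr_fps0.
have gE := Aflag_swap X i n f.
have UP : U i P w = P (w \o simple_tr i) by rewrite /U wi.
rewrite -UP; have PwE : P w = tr_fps i (P w) + (X i - X (i + 1)) * U i P w.
  have -> : tr_fps i (P w) = Aflag X N%:Z (i + 1 + 1) r g' w by rewrite -PE'.
  rewrite {1}PE /g gE Aflag_addZ PE U_Aflag //; lia.
by rewrite [in RHS](addrC (P w)) {2}PwE addKr.
Qed.

(** * Inversions and Coxeter length *)

Section Inversions.
Definition inversions (lo : int) (m : nat) (w : int -> int) : nat :=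
  \sum_(p : 'I_m * 'I_m) ((p.1 < p.2)%N && (w (lo + p.2%:Z) < w (lo + p.1%:Z))%R).

Implicit Types (lo N i : int) (w : int -> int).

(** Exchanging the positions i and i + 1 permutes the pairs of positions and preserves the order in
    each of them except this one pair. *)
Lemma inv_descent lo m w i : lo <= i -> i + 1 < lo + m%:Z -> w (i + 1) < w i ->
  inversions lo m w = (inversions lo m (w \o simple_tr i)).+1.
Proof.
move=> li im wi.
have am : (absz (i - lo)%R < m)%N by lia.
have bm : ((absz (i - lo)%R).+1 < m)%N by lia.
pose a := Ordinal am; pose b := Ordinal bm.
have aE : lo + a%:Z = i by rewrite /=; lia.
have bE : lo + b%:Z = i + 1 by rewrite /=; lia.
have ab : a != b by rewrite -val_eqE /=; lia.
have tE (c : 'I_m) : simple_tr i (lo + c%:Z) = lo + (tperm a b c)%:Z.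
  case: tpermP => [->|->|ca cb]; first by rewrite aE simple_tr_l bE.
    by rewrite bE simple_tr_r aE.
  rewrite simple_tr_id // -?aE -?bE.
    by apply/eqP => E; apply: ca; apply: val_inj; rewrite /=; move: E => /=; lia.
  by apply/eqP => E; apply: cb; apply: val_inj; rewrite /=; move: E => /=; lia.
have invE : inversions lo m (w \o simple_tr i) =
    (\sum_(p : 'I_m * 'I_m) ((tperm a b p.1 < tperm a b p.2)%N && (w (lo + p.2%:Z) < w (lo + p.1%:Z))%R))%N.
  rewrite /inversions (reindex_inj (h := fun p : 'I_m * 'I_m => (tperm a b p.1, tperm a b p.2))) /=.
    by apply: eq_bigr => p _; rewrite !tE !tpermK.
  by move=> [p1 p2] [q1 q2] /= [] /perm_inj -> /perm_inj ->.
rewrite invE /inversions (bigD1 (a, b)) //= [in RHS](bigD1 (a, b)) //= (bigD1 (b, a)) /=; last first.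
  by rewrite xpair_eqE negb_and eq_sym ab.
rewrite [in RHS](bigD1 (b, a)) /=; last by rewrite xpair_eqE negb_and eq_sym ab.
have ab1 : (a < b)%N = true by rewrite /= ltnS leqnn.
have ba1 : (b < a)%N = false by rewrite /= ltnNge leqnSn.
have wi1 : (w i < w (i + 1)) = false by apply/negbTE; rewrite -leNgt ltW.
rewrite !tpermL !tpermR !aE !bE wi wi1 ab1 ba1 !andbF !andFb !add0n !andbT add1n; congr _.+1.
have tv (c : 'I_m) : tperm a b c = (if c == a :> nat then (a : nat).+1 else if c == (a : nat).+1 :> nat then a else c) :> nat.
  case: tpermP => [->|->|/eqP ca /eqP cb]; first by rewrite eqxx.
    by rewrite eqxx (_ : (b == a :> nat) = false) //=; apply/negbTE; rewrite eq_sym.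
  by rewrite !ifN.
apply: eq_bigr => -[p q] /= /andP[pq1 pq2]; congr (nat_of_bool (_ && _)).
rewrite !xpair_eqE !negb_and -!val_eqE /= in pq1 pq2; rewrite !tv /=.
by move: pq1 pq2; do !case: eqP => //=; lia.
Qed.

Lemma inv_ascent lo m w i : lo <= i -> i + 1 < lo + m%:Z -> w i < w (i + 1) ->
  inversions lo m (w \o simple_tr i) = (inversions lo m w).+1.
Proof.
move=> li im wi; rewrite (inv_descent li im) /= ?simple_tr_l ?simple_tr_r //.
by congr (inversions _ _ _).+1; apply/funext => k /=; rewrite simple_trK.
Qed.

Lemma inv_bound lo m w : (inversions lo m w <= m * m)%N.
Proof.
rewrite -[m in (_ * m)%N]card_ord -{1}[m in (m * _)%N]card_ord -card_prod -sum1_card.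
by apply: leq_sum => p _; case: (_ && _).
Qed.

Lemma inv_id lo m : inversions lo m id = 0%N.
Proof. by rewrite /inversions big1 // => p _; case: ltnP => //= pq; rewrite ltrD2l; lia. Qed.

Lemma inv_swap_le lo m w i : injective w -> lo <= i -> i + 1 < lo + m%:Z ->
  (inversions lo m (w \o simple_tr i) <= (inversions lo m w).+1)%N.
Proof.
move=> w_inj li im; case: (ltgtP (w i) (w (i + 1))) => wi.
- by rewrite inv_ascent.
- by rewrite [in X in (_ <= X)%N](inv_descent li im wi); lia.
- by move/w_inj: wi; lia.
Qed.

Lemma word_prod_rcons a i : word_prod (rcons a i) = word_prod a \o simple_tr i.
Proof. by rewrite /word_prod; elim: a => //= j a ->. Qed.

Lemma word_prod_inj a : injective (word_prod a).
Proof.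
elim: a => [|i a IH]; first exact: inj_id.
by apply: inj_comp IH; exact: inv_inj (simple_trK i).
Qed.

Lemma inv_word lo m a : all (fun i => (lo <= i) && (i + 1 < lo + m%:Z)) a ->
  (inversions lo m (word_prod a) <= size a)%N.
Proof.
elim/last_ind: a => [|a i IH]; first by rewrite inv_id.
rewrite all_rcons word_prod_rcons size_rcons => /andP[/andP[li im] /IH ia].
by apply: leq_trans (inv_swap_le (@word_prod_inj a) li im) _.
Qed.

(** Going up from lo gives v(j) >= j, going down from N gives v(j) <= j. *)
Lemma increasing_id lo N v : (forall j, lo <= j <= N -> lo <= v j <= N) ->
    (forall j, lo <= j -> j < N -> v j < v (j + 1)) ->
  forall j, lo <= j <= N -> v j = j.
Proof.
move=> vS vinc j jN.
have up n : lo + n%:Z <= N -> lo + n%:Z <= v (lo + n%:Z).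
  elim: n => [|n IH] nN; first by have := vS (lo + 0%:Z); lia.
  have := vinc (lo + n%:Z); rewrite (_ : lo + n%:Z + 1 = lo + n.+1%:Z); lia.
have down n : lo <= N - n%:Z -> v (N - n%:Z) <= N - n%:Z.
  elim: n => [|n IH] nN; first by have := vS (N - 0%:Z); lia.
  have := vinc (N - n.+1%:Z); rewrite (_ : N - n.+1%:Z + 1 = N - n%:Z); lia.
have := up (absz (j - lo)%R); have := down (absz (N - j)%R).
rewrite (_ : N - (absz (N - j)%R)%:Z = j); last by lia.
rewrite (_ : lo + (absz (j - lo)%R)%:Z = j); lia.
Qed.

Lemma descent_ex lo N w : supported lo N w -> injective w -> w <> id ->
  exists i, [/\ lo <= i, i < N & w (i + 1) < w i].
Proof.
move=> wS w_inj wid; apply: contrapT => noex; apply: wid; apply/funext => j.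
have [jN|jN] := boolP (lo <= j <= N); last exact: supported_out wS jN.
apply: (increasing_id _ _ jN) => [k|k lk kN]; first exact: supported_in.
case: (ltgtP (w k) (w (k + 1))) => // wk; last by move/w_inj: wk; lia.
by case: noex; exists k.
Qed.

Lemma comp_trK w i : (w \o simple_tr i) \o simple_tr i = w.
Proof. by apply/funext => k /=; rewrite simple_trK. Qed.

Lemma has_word_inv lo m w : supported lo (lo + m%:Z - 1) w -> injective w ->
  has_word w (inversions lo m w).
Proof.
have [n] := ubnP (inversions lo m w); elim: n w => // n IH w wn wS w_inj.
have [->|wid] := pselect (w = id); first by rewrite inv_id; exists [::].
have [i [li iN wi]] := descent_ex wS w_inj wid.
have im : i + 1 < lo + m%:Z by lia.
rewrite (inv_descent li im wi) in wn *.
have [||a sa aw] := IH (w \o simple_tr i) wn.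
- exact: supported_swap.
- by apply: inj_comp w_inj _; exact: inv_inj (simple_trK i).
by exists (rcons a i); rewrite ?size_rcons ?sa // word_prod_rcons aw comp_trK.
Qed.

Lemma cox_length_spec w n : has_word w n ->
  has_word w (cox_length w) /\ forall k, has_word w k -> (cox_length w <= k)%N.
Proof.
move=> wn; have ex : exists k, `[< has_word w k >] by exists n; apply/asboolP.
have ex2 : exists k, [set k | has_word w k /\ forall j, has_word w j -> (k <= j)%N] k.
  case: (ex_minnP ex) => k /asboolP wk kmin; exists k; split=> // j wj.
  by apply: kmin; apply/asboolP.
exact: (xgetPex 0%N ex2).
Qed.

(** A shortest word might a priori use letters outside the support of w, so the window is required
    to contain the letters of the word as well. *)
Lemma cox_length_inv lo m w a : supported lo (lo + m%:Z - 1) w -> injective w ->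
    size a = cox_length w -> word_prod a = w ->
    all (fun i => (lo <= i) && (i + 1 < lo + m%:Z)) a ->
  cox_length w = inversions lo m w.
Proof.
move=> wS w_inj sa aw am; apply/eqP; rewrite eqn_leq; apply/andP; split.
  have wi := has_word_inv wS w_inj.
  by have [_] := cox_length_spec wi; apply.
by rewrite -sa -aw inv_word.
Qed.

Lemma seq_int_bound (s : seq int) : exists n : nat, forall i, i \in s -> `|i| <= n%:Z.
Proof.
exists (sumn (map absz s)) => i si; have := leq_sumn (map absz s).
by move/allP/(_ (absz i)); rewrite map_f // => /(_ isT); lia.
Qed.

Lemma cox_length_descent lo N w i : supported lo N w -> injective w -> lo <= i -> i < N ->
  (cox_length (w \o simple_tr i) < cox_length w)%N = (w (i + 1) < w i).
Proof.
move=> wS w_inj li iN; set v := w \o simple_tr i.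
have vS : supported lo N v by exact: supported_swap.
have v_inj : injective v by apply: inj_comp w_inj _; exact: inv_inj (simple_trK i).
pose m := (absz (N - lo)%R).+1.
have mE : lo + m%:Z - 1 = N by rewrite /m; lia.
have ww := @has_word_inv lo m w; rewrite mE in ww; have [[a sa aw] _] := cox_length_spec (ww wS w_inj).
have wv := @has_word_inv lo m v; rewrite mE in wv; have [[a' sa' aw'] _] := cox_length_spec (wv vS v_inj).
(* The window [-n, n + 1], of size 2n + 2, contains the support and admits all letters of shortest
   words for both permutations; their inversions are compared there. *)
have [n nb] := seq_int_bound (lo :: N :: a ++ a').
pose L := - n%:Z; pose M := (n + n).+2.
have lb := nb lo (mem_head _ _).
have Nb : `|N| <= n%:Z by apply: nb; rewrite !inE eqxx orbT.
have ab j : j \in a -> `|j| <= n%:Z by move=> ja; apply: nb; rewrite !inE mem_cat ja !orbT.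
have ab' j : j \in a' -> `|j| <= n%:Z by move=> ja; apply: nb; rewrite !inE mem_cat ja !orbT.
have wS' : supported L (L + M%:Z - 1) w by apply: supported_widen wS; rewrite /L /M; lia.
have vS' : supported L (L + M%:Z - 1) v by apply: supported_widen vS; rewrite /L /M; lia.
rewrite (cox_length_inv wS' w_inj sa aw); last by apply/allP => j /ab; rewrite /L /M; lia.
rewrite (cox_length_inv vS' v_inj sa' aw'); last by apply/allP => j /ab'; rewrite /L /M; lia.
have Li : L <= i by rewrite /L; lia.
have iM : i + 1 < L + M%:Z by rewrite /L /M; lia.
case: (ltgtP (w i) (w (i + 1))) => wi; last by move/w_inj: wi; lia.
  by rewrite /v inv_ascent //; lia.
by rewrite /v (inv_descent Li iM wi) ltnS leqnn.
Qed.

End Inversions.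

(** * The Schubert polynomial of the longest element *)

Section LongestElement.
Implicit Types (lo i : int) (w v : int -> int).

(** The word u_(i+n-1) ... u_i of the top degree term in [A i n x]. *)
Fixpoint letters (i : int) (n : nat) : seq int :=
  if n is n'.+1 then rcons (letters (i + 1) n') i else [::].

Lemma letters_prod i n k : word_prod (letters i n) k =
  if k == i then i + n%:Z else if (i < k) && (k <= i + n%:Z) then k - 1 else k.
Proof.
elim: n i k => [|n IH] i k /=.
  by case: eqP => [->|ki]; [lia | case: ifP => //; lia].
rewrite word_prod_rcons /= IH /simple_tr; do !case: ifP => //; lia.
Qed.

Section TopDegree.
Variables (K : comNzRingType) (N : nat).
Local Notation invN := (inversions 1 N).

(* At the longest element only the product of all the x u_i survives, for
   reasons of degree. *)
Definition top_value (f : (int -> int) -> K) d v c :=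
  [/\ forall w, (d < invN w)%N -> f w = 0,
      (invN v <= d)%N, injective v & invN v = d -> f v = c].

(** If v s_j has d + 1 inversions, then j is an ascent of v and v has d of them. There f itself
    vanishes by degree, and the term x U_j contributes x f(v). *)
Lemma top_hop f d v c j x : 1 <= j -> j + 1 <= N%:Z -> top_value f d v c ->
  top_value (hop j x f) d.+1 (v \o simple_tr j) (x * c).
Proof.
move=> j1 jN [f0 vd v_inj fv]; have jN' : j + 1 < 1 + N%:Z by lia.
split.
- move=> w dw; rewrite /hop f0 ?add0r; last by lia.
  rewrite /U; case: ifP => [wj|_]; last by rewrite mulr0.
  by rewrite f0 ?mulr0 //; move: dw; rewrite (inv_descent j1 jN' wj).
- exact: leq_trans (inv_swap_le v_inj j1 jN') _.
- by apply: inj_comp v_inj _; exact: inv_inj (simple_trK j).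
move=> vjd; have vasc : v j < v (j + 1).
  case: (ltgtP (v j) (v (j + 1))) => // vj; last by move/v_inj: vj; lia.
  by move: vd; rewrite (inv_descent j1 jN' vj) vjd; lia.
rewrite /hop f0 ?vjd // add0r /U /= simple_tr_l simple_tr_r vasc.
rewrite [_ \o _](_ : _ = v); last by apply/funext => k /=; rewrite simple_trK.
by rewrite fv //; move: vjd; rewrite (inv_ascent j1 jN' vasc) => -[].
Qed.

Lemma top_A f d v c i n x : 1 <= i -> i + n%:Z <= N%:Z -> top_value f d v c ->
  top_value (A i n x f) (d + n) (v \o word_prod (letters i n)) (x ^+ n * c).
Proof.
elim: n i => [|n IH] i i1 iN T; first by rewrite addn0 mul1r.
rewrite addnS exprS -mulrA /= word_prod_rcons.
have T1 := IH (i + 1) ltac:(lia) ltac:(lia) T.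
have iN1 : i + 1 <= N%:Z by lia.
exact: (top_hop x i1 iN1 T1).
Qed.

(** In one-line notation N, N-1, ..., N-r+1, 1, 2, ..., N-r: the product of the top words of the
    first r factors, reaching w0 at r = N. *)
Definition partial_reversal (r : nat) : int -> int := fun k =>
  if (1 <= k) && (k <= r%:Z) then N%:Z + 1 - k
  else if (r%:Z < k) && (k <= N%:Z) then k - r%:Z else k.

Lemma partial_reversalS r : (r < N)%N ->
  partial_reversal r \o word_prod (letters (r%:Z + 1) (N - r.+1)) = partial_reversal r.+1.
Proof.
move=> rN; apply/funext => k /=; rewrite letters_prod /partial_reversal.
do !case: ifP => //; lia.
Qed.

Lemma len_nat r : (r <= N)%N -> len N%:Z r%:Z = (N - r)%N.
Proof. by move=> rN; have rN' : r%:Z <= N%:Z by []; have := len_le rN'; lia. Qed.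

Lemma top_Aflag (x : int -> K) r q f d c : (r + q <= N)%N ->
    top_value f d (partial_reversal r) c ->
  top_value (Aflag x N%:Z (r%:Z + 1) q f) (d + \sum_(j < q) (N - (r + j).+1))
    (partial_reversal (r + q)) ((\prod_(j < q) x (r + j)%N.+1%:Z ^+ (N - (r + j).+1)) * c).
Proof.
elim: q r f d c => [|q IH] r f d c rq T.
  by rewrite !big_ord0 !addn0 mul1r.
rewrite [Aflag _ _ _ _ _]/(Aflag x N%:Z (r%:Z + 1 + 1) q (A (r%:Z + 1) (len N%:Z (r%:Z + 1)) (x (r%:Z + 1)) f)).
have -> : len N%:Z (r%:Z + 1) = (N - r.+1)%N by rewrite -len_nat; [congr len; lia | lia].
have T1 := @top_A _ _ _ _ (r%:Z + 1) (N - r.+1) (x (r%:Z + 1)) _ _ T.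
rewrite partial_reversalS in T1; last by lia.
have {}T1 := T1 ltac:(lia) ltac:(lia).
have := IH r.+1 _ _ _ _ T1; rewrite (_ : r.+1%:Z = r%:Z + 1); last by lia.
move=> /(_ ltac:(lia)).
rewrite addSnnS !big_ord_recl /= !addn0 addnA mulrA.
have -> : (\sum_(j < q) (N - (r.+1 + j).+1) = \sum_(j < q) (N - (r + bump 0 j).+1))%N.
  by apply: eq_bigr => j _; rewrite /bump /= add1n addnS.
have -> : \prod_(j < q) x (r.+1 + j)%N.+1%:Z ^+ (N - (r.+1 + j).+1) =
    \prod_(j < q) x (r + bump 0 j)%N.+1%:Z ^+ (N - (r + bump 0 j).+1).
  by apply: eq_bigr => j _; rewrite /bump /= add1n addnS.
rewrite (_ : r.+1%:Z = r%:Z + 1); last by lia.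
by rewrite [(\prod_(j < q) _) * _]mulrC.
Qed.

Lemma partial_reversal0 : partial_reversal 0 = id.
Proof. by apply/funext => k; rewrite /partial_reversal; do !case: ifP => //; lia. Qed.

Lemma partial_reversalN : partial_reversal N = w0 N.
Proof. by apply/funext => k; rewrite /partial_reversal /w0; do !case: ifP => //; lia. Qed.

Lemma inv_w0 : invN (w0 N) = (\sum_(j < N) (N - j.+1))%N.
Proof.
rewrite (reindex_inj rev_ord_inj) /=.
transitivity (\sum_(j < N) j)%N; last by apply: eq_bigr => j _; have := ltn_ord j; lia.
rewrite /inversions -(pair_big xpredT xpredT (fun p q : 'I_N => (p < q)%N && (w0 N (1 + q%:Z) < w0 N (1 + p%:Z))%R : nat)) /=.
rewrite exchange_big; apply: eq_bigr => q _ /=.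
transitivity (\sum_(p < N) (p < q)%N)%N.
  apply: eq_bigr => p _; have := ltn_ord p; have := ltn_ord q; rewrite /w0.
  by do !case: ifP => //; lia.
rewrite -[RHS]card_ord -sum1_card big_mkcond /= -(big_mkord xpredT (fun p => (p < q)%N : nat)).
rewrite (big_cat_nat (n := q)) //=; last by apply: ltnW.
rewrite [X in (_ + X)%N]big1_seq => [|p /andP[_]]; last first.
  by rewrite mem_index_iota => /andP[qp _]; rewrite ltnNge qp.
rewrite addn0 big_mkord; apply: eq_bigr => p _; by rewrite ltn_ord.
Qed.
End TopDegree.

Lemma schubN_w0 N : schubN N (w0 N) = \prod_(1 <= i < N) var i%:Z ^+ (N - i).
Proof.
have T0 : top_value N (delta poly_ring) 0 (partial_reversal N 0) 1.
  split; rewrite ?partial_reversal0 ?inv_id //; last by rewrite /delta asboolT.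
  by move=> w; rewrite /delta; case: asboolP => // ->; rewrite inv_id.
have [_ _ _] := top_Aflag var (leqnn (0 + N)) T0.
rewrite !add0n partial_reversalN inv_w0 mulr1 => /(_ erefl) E.
rewrite /schubN (_ : 1 = 0%:Z + 1) // E.
have reindex (R : comNzRingType) (z : nat -> R) :
    \prod_(j < N) z (0 + j).+1 ^+ (N - (0 + j).+1) = \prod_(1 <= i < N) z i ^+ (N - i).
  rewrite -(big_mkord xpredT (fun j => z (0 + j).+1 ^+ (N - (0 + j).+1))).
  case: N {T0 E} => [|n]; first by rewrite !big_geq.
  by rewrite big_nat_recr //= subnn mulr1 [RHS]big_add1.
exact: (reindex _ (fun k => var k%:Z)).
Qed.

End LongestElement.

(** * Uniqueness of Schubert polynomials and stable limits *)

Section StableLimits.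
Implicit Types (lo i : int) (w v : int -> int).

Lemma S_Z_supported w : S_Z w -> injective w /\ exists n : nat, supported (- n%:Z) n%:Z w.
Proof.
move=> [w_bij w_fin]; have w_inj := bij_inj w_bij; split=> //.
have [n nb] := seq_int_bound (fset_set [set i | w i != i]).
exists n; have wout j : ~~ (- n%:Z <= j <= n%:Z) -> w j = j.
  move=> jn; apply/eqP; apply: contraNT jn => wj.
  by have := nb j; rewrite in_fset_set // inE => /(_ wj); lia.
move=> j; case: ifPn => [jn|/wout->//].
apply/negPn/negP => wjn; have := wout _ wjn => /w_inj wj.
by rewrite wj jn in wjn.
Qed.

Lemma supported_S_Z lo N w : supported lo N w -> injective w -> S_Z w.
Proof.
move=> wS w_inj; split; last first.
  apply: (@sub_finite_set _ _ [set` vars lo (absz (N - lo)%R).+1]); last exact: finite_seq.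
  move=> j /= wj; rewrite mem_vars; apply: contraNT wj => jN; apply/eqP.
  by apply: supported_out wS _; lia.
have surj j : exists k, w k = j.
  have [jN|jN] := boolP (lo <= j <= N); last by exists j; apply: supported_out wS jN.
  have [m mE] : exists m : nat, m = (absz (N - lo)%R).+1 by eexists.
  have wb (a : 'I_m) : lo <= w (lo + a%:Z) <= N.
    by apply: supported_in wS _; have := ltn_ord a; lia.
  have wm (a : 'I_m) : (absz (w (lo + a%:Z) - lo)%R < m)%N by have := wb a; lia.
  pose g (a : 'I_m) := Ordinal (wm a).
  have g_inj : injective g.
    move=> a b /(congr1 val) /= ab; apply: val_inj => /=.
    have wE : w (lo + a%:Z) = w (lo + b%:Z) by have := wb a; have := wb b; lia.
    by have := w_inj _ _ wE; lia.
  have jm : (absz (j - lo)%R < m)%N by lia.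
  have [g' _ gK] := injF_bij g_inj.
  exists (lo + (g' (Ordinal jm))%:Z).
  by have /= := congr1 val (gK (Ordinal jm)); have := wb (g' (Ordinal jm)); lia.
pose w' j := xget 0 [set k | w k = j].
have w'P j : w (w' j) = j by have [k kj] := surj j; exact: (@xgetPex _ 0 [set k | w k = j] (ex_intro _ k kj)).
by exists w' => // j; apply: w_inj; rewrite w'P.
Qed.

Lemma S_infty_supported w : S_infty w -> exists N : nat, supported 1 N%:Z w.
Proof.
move=> [wSZ w0]; have [w_inj [n wS]] := S_Z_supported wSZ; exists n => j.
have := wS j; have w1 k : 1 <= k -> 1 <= w k.
  move=> k1; rewrite leNgt; apply/negP => wk.
  have : w (w k) = w k by apply: w0; lia.
  by move/w_inj; lia.
have := w1 j; have := w0 j; do !case: ifP => //; lia.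
Qed.

Lemma supported_S_infty (N : int) w : supported 1 N w -> injective w -> S_infty w.
Proof.
move=> wS w_inj; split; first exact: supported_S_Z wS w_inj.
by move=> i i0; apply: supported_out wS _; lia.
Qed.

Lemma w0_supported N : supported 1 N%:Z (w0 N).
Proof. by move=> j; rewrite /w0; case: ifPn => jN; rewrite ?jN ?(negPf jN); lia. Qed.

Definition schub w : poly_ring := schubN (xget 0%N [set N : nat | supported 1 N%:Z w]) w.

Lemma schubE N w : supported 1 N%:Z w -> schub w = schubN N w.
Proof.
move=> wS; rewrite /schub; set M := xget _ _.
have MS : supported 1 M%:Z w := xgetPex 0%N (ex_intro _ N wS : exists N, [set N : nat | supported 1 N%:Z w] N).
by have [NM|/ltnW MN] := leqP N M; [exact: schubN_widen | apply/esym; exact: schubN_widen].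
Qed.

(** Existence of a family: it guarantees that [schubert] is not the default value of [xget]. *)
Lemma schub_family : schubert_family schub.
Proof.
split=> [n|w i wS i1 cwi]; first by rewrite (schubE (@w0_supported n)) schubN_w0.
have [N wN] := S_infty_supported wS; have [[w_bij _] _] := wS.
pose M := maxn N (absz (i + 1)%R).
have wM : supported 1 M%:Z w by apply: supported_widen wN; rewrite /M; lia.
have iM : i < M%:Z by rewrite /M; lia.
rewrite (cox_length_descent wM (bij_inj w_bij) i1 iM) in cwi.
rewrite (schubE wM) (schubE (supported_swap wM i1 iM)).
exact: schubN_divided_difference.
Qed.

(** Descending induction on inversions, starting from w0: at an ascent i, the value at w is the
    divided difference of the value at the longer w s_i, which determines it because x_i - x_(i+1)
    can be cancelled. *)
Lemma schubert_unique S N w : schubert_family S -> supported 1 N%:Z w -> injective w ->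
  S w = schubN N w.
Proof.
move=> [Sw0 Sdd]; have [n] := ubnP (N * N - inversions 1 N w)%N.
elim: n w => // n IH w wn wS w_inj.
have [[i [i1 iN wi]]|noasc] := pselect (exists i, [/\ 1 <= i, i < N%:Z & w i < w (i + 1)]).
  pose v := w \o simple_tr i.
  have vS : supported 1 N%:Z v by exact: supported_swap.
  have v_inj : injective v by apply: inj_comp w_inj _; exact: inv_inj (simple_trK i).
  have vi : v (i + 1) < v i by rewrite /v /= simple_tr_l simple_tr_r.
  have iN' : i + 1 < 1 + N%:Z by lia.
  have vw : v \o simple_tr i = w by rewrite /v comp_trK.
  have Sv : S v = schubN N v.
    apply: IH => //; have := inv_bound 1 N v.
    move: wn; rewrite /v (inv_ascent i1 iN' wi).
    by move: (N * N)%N (inversions _ _ _) => x y; lia.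
  have dS : is_divided_difference i (S v) (S w).
    rewrite -vw; apply: Sdd => //; first exact: supported_S_infty vS v_inj.
    by rewrite (cox_length_descent vS v_inj i1 iN).
  have dN : is_divided_difference i (schubN N v) (schubN N w).
    by rewrite -vw; apply: schubN_divided_difference.
  have ij : i != i + 1 by lia.
  rewrite Sv in dS.
  exact: (cancel_varp_sub ij (etrans dS (esym dN))).
suff -> : w = w0 N by rewrite Sw0 schubN_w0.
apply/funext => j; rewrite /w0; case: ifPn => [jN|jN]; last exact: supported_out wS jN.
(* Without ascents in the window, this reflected map is increasing, hence the identity. *)
have inc := @increasing_id 1 N%:Z (fun j => N%:Z + 1 - w j).
rewrite -{2}(inc _ _ j jN); first by lia.
  by move=> k kN; have := supported_in wS kN; lia.
move=> k k1 kN; case: (ltgtP (w k) (w (k + 1))) => wk; first by case: noasc; exists k.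
  by lia.
by move/w_inj: wk; lia.
Qed.

Lemma schubertE N w : supported 1 N%:Z w -> injective w -> schubert w = schubN N w.
Proof.
apply: schubert_unique; exact: (@xgetPex _ (fun=> 0) schubert_family (ex_intro _ schub schub_family)).
Qed.

Lemma stable_lim_eq u c n : (forall m, (n <= m)%N -> u m = c) -> stable_lim u = c.
Proof.
move=> uc; have [k kP] : [set c | exists N, forall m, (N <= m)%N -> u m = c] (stable_lim u).
  have ex : exists c, [set c | exists N, forall m, (N <= m)%N -> u m = c] c by exists c; exists n.
  exact: (xgetPex 0 ex).
by rewrite -(kP (maxn n k)) ?leq_maxr // uc // leq_maxl.
Qed.

Lemma shift_inj m w : injective w -> injective (shift m w).
Proof. by move=> w_inj j k /addIr /w_inj /addIr. Qed.

Lemma supported_shift lo (N : int) m w : supported lo N w ->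
  supported (lo + m%:Z) (N + m%:Z) (shift m w).
Proof.
move=> wS j; rewrite /shift; have := wS (j - m%:Z); do !case: ifP => //; lia.
Qed.

(** One formula for both limits: fixed i gives the back stable function, i = 1 - m the Stanley
    function. *)
Lemma schubert_shift_coef n m w s i : supported (- n%:Z) n%:Z w -> injective w ->
    (n < m)%N -> 1 <= i + m%:Z ->
  (schubert (shift m w))@_(mon (i + m%:Z) s) = flagged n%:Z i (delta rat) s w.
Proof.
move=> wS w_inj nm im; have mS : supported 1 (n + m)%N%:Z (shift m w).
  by apply: supported_widen (supported_shift m wS); lia.
rewrite (schubertE mS (shift_inj w_inj)).
(* The variables x_1, ..., x_k precede x_(i+m) and get exponent zero. *)
pose k := absz (i + m%:Z - 1)%R.
have -> : mon (i + m%:Z) s = mon 1 (nseq k 0%N ++ s).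
  by rewrite mon_cat mon_nseq0 mul1m size_nseq; congr mon; rewrite /k; lia.
rewrite schubN_coef flagged_cat flagged_nseq0 size_nseq.
rewrite (_ : 1 + k%:Z = i + m%:Z); last by rewrite /k; lia.
rewrite PoszD flagged_shift; congr flagged; apply/funext => v; exact: delta_shift.
Qed.

Lemma rename_shift m (b : monom) j : rename (fun i => i + m%:Z) b (j + m%:Z) = b j.
Proof. by rewrite (@renameE (fun i => i + m%:Z)) //; exact: addIr. Qed.

Lemma shift_mon m i s : shift_monom m (mon i s) = mon (i + m%:Z) s.
Proof.
apply: cmonom_ext => j; rewrite -(subrK m%:Z j) /shift_monom rename_shift !monE.
rewrite lerD2r; case: ifP => // _; congr (nth _ _ _); congr absz; lia.
Qed.

Section Limits.
Variables (n : nat) (w : int -> int).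
Hypotheses (wS : supported (- n%:Z) n%:Z w) (w_inj : injective w).

Lemma back_stable_coef i s :
  back_stable_schubert w (mon i s) = flagged n%:Z i (delta rat) s w.
Proof.
apply: (@stable_lim_eq _ _ (maxn n (absz i)).+1) => m nm; rewrite shift_mon.
by rewrite (@schubert_shift_coef n) //; lia.
Qed.

Lemma stanley_coef s :
  stanley w (mon 1 s) = act (arange n%:Z (- n%:Z)) s (delta rat) w.
Proof.
apply: (@stable_lim_eq _ _ (n + size s).+1) => m nm.
have := @schubert_shift_coef n m w s (1 - m%:Z) wS w_inj.
rewrite subrK => ->; try by lia.
by apply: flagged_below wS; lia.
Qed.

Lemma stanley_shift s m : (n + size s < m)%N ->
  stanley w (mon 1 s) = back_stable_schubert w (mon (1 - m%:Z) s).
Proof.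
move=> nm; rewrite back_stable_coef stanley_coef; apply/esym.
by apply: flagged_below wS; lia.
Qed.

Lemma stanley_off (b : monom) : ~~ all (fun j => 1 <= j) (msup b) -> stanley w b = 0.
Proof.
move=> b1; apply: (@stable_lim_eq _ _ n.+1) => m nm.
have mS : supported 1 (n + m)%N%:Z (shift m w).
  by apply: supported_widen (supported_shift m wS); lia.
by rewrite (schubertE mS (shift_inj w_inj)) schubN_off.
Qed.
End Limits.

End StableLimits.

(** * Expansions of Stanley functions *)

Section StanleyExpansions.
Implicit Types (lo : int) (w v : int -> int).

(** Homogeneity: only permutations with d inversions occur. It confines the expansion of a Stanley
    function to partitions of a single number. *)
Definition graded lo m (d : nat) (f : (int -> int) -> rat) :=
  forall w, f w != 0 -> inversions lo m w = d.

Lemma graded_U lo m d f i : lo <= i -> i + 1 < lo + m%:Z -> graded lo m d f ->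
  graded lo m d.+1 (U i f).
Proof.
move=> li im fd w; rewrite /U; case: ifP => [wi /fd <-|]; last by rewrite eqxx.
exact: inv_descent.
Qed.

Lemma graded_acoef lo m d f i n k : lo <= i -> i + n%:Z < lo + m%:Z -> graded lo m d f ->
  graded lo m (d + k) (acoef i n k f).
Proof.
elim: n i k => [|n IH] i [|k] li im fd; rewrite ?acoef0 ?addn0; try exact: fd.
  by move=> w; rewrite /acoef eqxx.
have [li1 im1 in1] : [/\ lo <= i + 1, i + 1 + n%:Z < lo + m%:Z & i + 1 < lo + m%:Z] by split; lia.
move=> w; have [z|nz] := eqVneq (acoef (i + 1) n k.+1 f w) 0; last first.
  by move=> _; exact: IH li1 im1 fd _ nz.
rewrite /= z add0r addnS => Uw.
exact: graded_U li in1 (IH (i + 1) k li1 im1 fd) _ Uw.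
Qed.

Lemma graded_act (n : nat) s f d : graded (- n%:Z) (n + n).+1 d f ->
  graded (- n%:Z) (n + n).+1 (d + sumn s) (act (arange n%:Z (- n%:Z)) s f).
Proof.
move=> fd; elim: s => [|k s IH]; first by rewrite addn0.
rewrite [sumn _]/(k + sumn s)%N addnCA addnC act_cons; apply: graded_acoef IH => //.
have nn : - n%:Z <= n%:Z by lia.
by have := len_le nn; lia.
Qed.

Lemma graded_delta lo m : graded lo m 0 (delta rat).
Proof. by move=> w; rewrite /delta; case: asboolP => [->|]; rewrite ?inv_id ?eqxx. Qed.

Lemma act_filter (T : Type) (a : nat -> (T -> rat) -> T -> rat) s f : a 0%N = id ->
  act a [seq k <- s | k != 0%N] f = act a s f.
Proof.
move=> a0; elim: s => // k s IH /=.
by case: eqP => [->|_] /=; rewrite ?act_cons IH //= a0.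
Qed.

Lemma act_sort (T : Type) (a : nat -> (T -> rat) -> T -> rat) s f : a 0%N = id ->
    (forall k l f, a k (a l f) = a l (a k f)) ->
  act a (sort geq [seq k <- s | k != 0%N]) f = act a s f.
Proof.
move=> a0 aC; rewrite -(act_filter s f a0).
by apply: act_perm => //; rewrite perm_sort.
Qed.

Lemma act_expansion (n : nat) v : exists c : seq nat -> rat, forall s,
  act (arange n%:Z (- n%:Z)) s (delta rat) v =
  \sum_(l <- parts (inversions (- n%:Z) (n + n).+1 v)) c l * cnt 1 l s.
Proof.
apply: cnt1_expansion => s.
  by rewrite act_sort //; [exact: arange0 | exact: arange_comm].
by move/(graded_act (@graded_delta _ _)).
Qed.

Lemma eq_on_act lo N (a a' : nat -> ((int -> int) -> rat) -> (int -> int) -> rat) s f :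
    (forall k g, eq_on lo N (a k g) (a' k g)) ->
    (forall k g h, eq_on lo N g h -> eq_on lo N (a' k g) (a' k h)) ->
  eq_on lo N (act a s f) (act a' s f).
Proof.
move=> aa a'e; elim: s => [|k s IH] //.
exact: eq_on_trans (aa _ _) (a'e _ _ _ IH).
Qed.

Lemma hat_inj w : injective w -> injective (hat w).
Proof. by move=> w_inj j k; rewrite /hat => jk; have := w_inj (1 - j) (1 - k); lia. Qed.

(** Reversal reflects about 1/2 and maps [-n, n] to [1 - n, n + 1]; enlarging n by one keeps the
    window symmetric. *)
Lemma supported_hat (n : nat) w : supported (- n%:Z) n%:Z w ->
  supported (- n.+1%:Z) n.+1%:Z (hat w).
Proof. by move=> wS j; have := wS (1 - j); rewrite /hat; do !case: ifP => //; lia. Qed.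

Lemma delta_hat (K : comNzRingType) w : delta K (hat w) = delta K w.
Proof.
rewrite /delta (_ : `[< hat w = id >] = `[< w = id >]) //; apply/asbool_equiv_eq.
have hat_id : hat id = id by apply/funext => j; rewrite /hat; lia.
by split=> [wid|->//]; rewrite -(hatK w) wid.
Qed.

Lemma act_hat i n s f w :
  act (acoef i n) s f (hat w) = act (bcoef (1 - i - n%:Z) n) s (fun v => f (hat v)) w.
Proof.
elim: s w => // k s IH w; rewrite !act_cons acoef_hat; congr (bcoef _ _ _ _ w).
by apply/funext => v; rewrite IH.
Qed.

Lemma bcoef_act i n s f w :
  act (bcoef i n) s f w = \sum_(p <- dual_word s) p.1 * act (acoef i n) p.2 f w.
Proof.
apply: dual_wordE.
- by move=> k; exact: acoef_linear.
- exact: acoef0.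
- exact: bcoef0.
- exact: acoef_bcoef.
Qed.

(* Passing from w to its Dynkin reversal exchanges the e- and h-expansions. *)
Lemma stanley_expansions (n : nat) w : supported (- n%:Z) n%:Z w -> injective w ->
  exists D c, (forall s, stanley w (mon 1 s) = \sum_(l <- parts D) c l * cnt 1 l s) /\
    (forall s, stanley (hat w) (mon 1 s) = \sum_(l <- parts D) c l * cnth l s).
Proof.
move=> wS w_inj; have [c cE] := act_expansion n w.
exists (inversions (- n%:Z) (n + n).+1 w), c; split=> s.
  by rewrite (stanley_coef wS w_inj) cE.
have hS := supported_hat wS; rewrite (stanley_coef hS (hat_inj w_inj)).
apply: (@dual_expansion _ _ _ (fun s => act _ s _ (hat w)) cE) => {}s.
have n1 : - n.+1%:Z <= n.+1%:Z by lia.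
have lenE : len n.+1%:Z (- n.+1%:Z) = (n + n).+2 by have := len_le n1; lia.
have n0 : - n%:Z <= n%:Z by lia.
have lenE0 : len n%:Z (- n%:Z) = (n + n)%N by have := len_le n0; lia.
(* The reflected range of generators starts at -n again and has two extra ones at its upper end, u_n
   and u_(n+1), which act as zero on the window of w. *)
rewrite /arange lenE act_hat (_ : 1 - _ - _ = - n%:Z); last by lia.
rewrite (_ : (fun v => delta rat (hat v)) = delta rat); last first.
  by apply/funext => v; exact: delta_hat.
rewrite bcoef_act; apply: eq_bigr => p _; congr (_ * _); rewrite lenE0.
apply: eq_on_act wS => [k g|k g h]; last exact: eq_on_acoef.
by rewrite -[(n + n).+2](addn2); apply: acoef_upper; lia.
Qed.

Section Coefficients.
Variables (B : intpart -> series) (M : seq nat -> monom -> rat).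
Hypothesis BM : forall l b, B l b = M (val l) b.
Hypothesis M_independent : forall (c : seq nat -> rat) (L : seq (seq nat)), uniq L ->
    (forall l, l \in L -> is_part l) -> (forall b, \sum_(l <- L) c l * M l b = 0) ->
  forall l, l \in L -> c l = 0.

Lemma expansionE (I : choiceType) (C : I -> series) f c (F : {fset I}) :
    expansion C f c -> (forall i, c i != 0 -> i \in F) ->
  forall b, f b = \sum_(i <- F) c i * C i b.
Proof.
move=> [_ fE] cF b; rewrite fE; apply: fsbigTE => i iF.
by rewrite (_ : c i = 0) ?mul0r //; apply/eqP; apply: contraNT iF; exact: cF.
Qed.

(** The difference of two expansions is a finite linear relation, indexed by the union of their
    supports, so the choice made by [xget] is forced. *)
Lemma coef_eq f c : expansion B f c -> coef B f = c.
Proof.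
move=> cE; have cE' : expansion B f (coef B f) := xgetPex (fun=> 0) (ex_intro _ c cE).
set c' := coef B f in cE' *.
pose F := fset_set ([set i | c i != 0] `|` [set i | c' i != 0]).
have memF i : (i \in F) = (c i != 0) || (c' i != 0).
  rewrite in_fset_set; last by rewrite finite_setU; split; [case: cE | case: cE'].
  by apply/idP/orP; rewrite inE.
have cF := expansionE (F := F) cE; have c'F := expansionE (F := F) cE'.
pose d (l : seq nat) : rat := if insub l is Some i then c' i - c i else 0.
have dE i : d (val i) = c' i - c i by rewrite /d valK.
have d0 : forall l, l \in [seq val i | i <- F] -> d l = 0.
  apply: M_independent.
  - by rewrite map_inj_uniq ?fset_uniq //; exact: val_inj.
  - by move=> _ /mapP[i _ ->]; exact: valP.
  move=> b; rewrite big_map; under eq_bigr do rewrite dE -BM mulrBl.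
  rewrite sumrB -c'F; last by move=> i ci; rewrite memF ci orbT.
  rewrite -cF ?subrr // => i ci; by rewrite memF ci.
apply/funext => i; apply/eqP; rewrite -subr_eq0 -dE; apply/eqP.
have [iF|] := boolP (i \in F); first by apply: d0; apply: map_f.
by rewrite memF negb_or !negbK dE => /andP[/eqP-> /eqP->]; rewrite subrr.
Qed.

Lemma expansion_parts f D (c : seq nat -> rat) :
    (forall b, f b = \sum_(l <- parts D) c l * M l b) ->
  expansion B f (fun i => if val i \in parts D then c (val i) else 0).
Proof.
move=> fE; pose L : seq intpart := pmap insub (parts D).
have LE : [seq val i | i <- L] = parts D.
  rewrite pmap_filter; last exact: insubK.
  apply/all_filterP/allP => l; rewrite mem_parts => /andP[lp _].
  by rewrite insubT.
have memL i : (i \in L) = (val i \in parts D).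
  by rewrite -LE mem_map //; exact: val_inj.
have uL : uniq L by apply: (@map_uniq _ _ val); rewrite LE parts_uniq.
split.
  apply: (@sub_finite_set _ _ [set` L]); last exact: finite_seq.
  by move=> i /=; rewrite memL; case: ifP; rewrite ?eqxx.
move=> b; rewrite fE -[in LHS]LE big_map (@fsbigTE _ _ _ _ [fset i in L]%fset) => [|i]; last first.
  by rewrite in_fset memL => /negPf ->; rewrite mul0r.
transitivity (\sum_(i <- L) (if val i \in parts D then c (val i) else 0) * B i b).
  by apply: eq_big_seq => i; rewrite memL => ->; rewrite BM.
by apply/perm_big/uniq_perm => // [|i]; rewrite ?fset_uniq // in_fset.
Qed.
End Coefficients.

Lemma gprod_mon D (V : pred int) l i s : all V (vars i (size s)) ->
  gprod D V l (mon i s) = cnt D l s.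
Proof.
move=> Vi; rewrite (@gprod_coef D V (vars i (size s))) ?vars_uniq ?map_mon //.
by move=> j /msup_mon; rewrite mem_vars.
Qed.

Lemma vars1_pos n : all (fun j : int => 1 <= j) (vars 1 n).
Proof. by apply/allP => j; rewrite mem_vars => /andP[]. Qed.

Lemma e_E l b : e_ l b = gprod 1 (fun j => 1 <= j) (val l) b.
Proof. by rewrite /e_ big_smul /gprod; congr (_ b); apply: eq_bigr => d _; exact: esymE. Qed.

Lemma h_E l b : h_ l b = hprod (fun j => 1 <= j) (val l) b.
Proof. by rewrite /h_ big_smul. Qed.

Lemma hprod_mon (V : pred int) l i s : all V (vars i (size s)) ->
  hprod V l (mon i s) = cnth l s.
Proof.
by move=> Vi; rewrite (hprod_gprod _ (leq_sumn l)) gprod_mon // (cnth_cnt _ (leq_sumn l)).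
Qed.

Lemma coef_e f c : expansion e_ f c -> coef e_ f = c.
Proof.
apply: (coef_eq e_E) => d L uL Lp L0; apply: cnt1_all_independent => // s.
rewrite -[RHS](L0 (mon 1 s)); apply: eq_bigr => l _.
by rewrite gprod_mon // vars1_pos.
Qed.

Lemma coef_h f c : expansion h_ f c -> coef h_ f = c.
Proof.
apply: (coef_eq h_E) => d L uL Lp L0; apply: cnth_independent => // s.
rewrite -[RHS](L0 (mon 1 s)); apply: eq_bigr => l _.
by rewrite hprod_mon // vars1_pos.
Qed.

Lemma coef_e_stanley_hat (n : nat) w : supported (- n%:Z) n%:Z w -> injective w ->
  coef e_ (stanley w) = coef h_ (stanley (hat w)).
Proof.
move=> wS w_inj; have [D [c [eE hE]]] := stanley_expansions wS w_inj.
rewrite (coef_e (expansion_parts e_E (D := D) (c := c) _)); last first.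
  move=> b; have [/mon1_ex[s ->]|b1] := boolP (all (fun j => 1 <= j) (msup b)).
    by rewrite eE; apply: eq_bigr => l _; rewrite gprod_mon // vars1_pos.
  by rewrite (stanley_off wS w_inj b1) big1 // => l _; rewrite gprod0 ?mulr0.
rewrite (coef_h (expansion_parts h_E (D := D) (c := c) _)) //.
move=> b; have [/mon1_ex[s ->]|b1] := boolP (all (fun j => 1 <= j) (msup b)).
  by rewrite hE; apply: eq_bigr => l _; rewrite hprod_mon // vars1_pos.
rewrite (stanley_off (supported_hat wS) (hat_inj w_inj) b1) big1 // => l _.
by rewrite hprodE (negPf b1) mulr0.
Qed.

End StanleyExpansions.

(** * The span of the SEMs *)

Section SemSpan.
Implicit Types (k N : int) (alpha : tuples).

Definition elem_le k (d : nat) : fps := gsym 1 (fun j => j <= k) d.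

Lemma elem_le0 k : elem_le k 0 = 1. Proof. exact: gsym_deg0. Qed.

Lemma elem_leS k d : elem_le (k + 1) d.+1 = elem_le k d.+1 + X (k + 1) * elem_le k d.
Proof.
rewrite /elem_le -esym_addvar; last by lia.
by congr gsym; apply/funext => j; rewrite /addvar; lia.
Qed.

Lemma semE alpha : sem alpha = \prod_(i <- msup alpha) elem_le i (alpha i).
Proof. by rewrite /sem big_smul; apply: eq_bigr => i _; exact: esymE. Qed.

Lemma sem_mul k d alpha : alpha k = 0%N ->
  (sem (mmul (expcmn (ucm k) d) alpha) : fps) = elem_le k d * (sem alpha : fps).
Proof.
move=> ak; case: d => [|d]; first by rewrite mul1m elem_le0 mul1r.
set b := mmul _ _.
have bk : b k = d.+1 by rewrite cmM expcmnE cmUU muln1 ak addn0.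
have bj j : j != k -> b j = alpha j.
  by move=> jk; rewrite cmM expcmnE cmU eq_sym (negPf jk) muln0.
have kb : k \in msup b by rewrite msupE bk.
rewrite !semE (big_fsetD1 k kb) bk; congr (_ * _).
have -> : (msup b `\ k)%fset = msup alpha.
  apply/fsetP => j; rewrite in_fsetD1 !msupE.
  by have [->|/bj ->//] := eqVneq j k; rewrite ak.
apply: eq_big_seq => j; rewrite msupE => aj; rewrite bj //.
by apply: contraNneq aj => ->; rewrite ak.
Qed.

Definition sem_span (f : fps) : Prop :=
  exists r : seq (rat * tuples), f = \sum_(p <- r) (constf p.1 : fps) * (sem p.2 : fps).

Lemma constfM a b : (constf a : fps) * (constf b : fps) = constf (a * b).
Proof.
apply/funext => c; rewrite constfM_coef /constf.
by case: eqP; rewrite ?mulr0.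
Qed.

Lemma constfN1 (f : fps) : - f = (constf (-1) : fps) * f.
Proof. by apply/funext => c; rewrite constfM_coef fpsN mulN1r. Qed.

Lemma span_sem alpha : sem_span (sem alpha).
Proof.
exists [:: (1, alpha)]; rewrite big_seq1 /=; apply/funext => c.
by rewrite constfM_coef mul1r.
Qed.

Lemma span0 : sem_span 0.
Proof. by exists [::]; rewrite big_nil. Qed.

Lemma spanD f g : sem_span f -> sem_span g -> sem_span (f + g).
Proof. by move=> [r ->] [s ->]; exists (r ++ s); rewrite big_cat. Qed.

Lemma spanZ a f : sem_span f -> sem_span ((constf a : fps) * f).
Proof.
move=> [r ->]; exists [seq (a * p.1, p.2) | p <- r]; rewrite big_map mulr_sumr.
by apply: eq_bigr => p _; rewrite mulrA constfM.
Qed.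

Lemma spanB f g : sem_span f -> sem_span g -> sem_span (f - g).
Proof. by move=> fS gS; rewrite constfN1; apply: spanD fS (spanZ _ gS). Qed.

Lemma span_sum (I : eqType) (r : seq I) (F : I -> fps) :
  (forall i, i \in r -> sem_span (F i)) -> sem_span (\sum_(i <- r) F i).
Proof.
elim: r => [|i r IH] Fr; first by rewrite big_nil; exact: span0.
rewrite big_cons; apply: spanD; first by apply: Fr; rewrite mem_head.
by apply: IH => j jr; apply: Fr; rewrite in_cons jr orbT.
Qed.

(** Passing from k to k + 1 in e_(a+1) e_d - e_(d+1) e_a, in the first factor of each product, adds
    x_(k+1) e_a e_d twice with opposite signs. *)
Lemma straighten k a d : elem_le k d * elem_le k a.+1 =
  elem_le k d.+1 * elem_le k a + elem_le (k + 1) a.+1 * elem_le k d - elem_le (k + 1) d.+1 * elem_le k a.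
Proof.
rewrite !elem_leS; exact: (straightening_identity (ring_theoryP fps)).
Qed.

Lemma monom_factor (alpha : tuples) k :
  exists2 alpha0 : tuples, alpha0 k = 0%N & alpha = mmul (expcmn (ucm k) (alpha k)) alpha0.
Proof.
exists (divcm alpha (expcmn (ucm k) (alpha k))).
  by rewrite divcmE expcmnE cmUU muln1 subnn.
apply: cmonom_ext => j; rewrite cmM divcmE expcmnE cmU.
by have [->|jk] := eqVneq k j; rewrite ?muln1 ?muln0 ?subn0 ?subnn ?addn0 ?add0n.
Qed.

(* Products of elementary symmetric functions e_d(..., x_k) with the same k are
   straightened by moving factors to larger k, until all the k are distinct. *)
Lemma span_elem_le_sem N k d alpha : (forall i, i \in msup alpha -> i <= N) ->
  sem_span (elem_le k d * (sem alpha : fps)).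
Proof.
have [n] := ubnP (absz (N + 1 - k)%R); elim: n k d alpha => // n IH k d alpha kn aN.
have [ak|ak] := eqVneq (alpha k) 0%N; first by rewrite -sem_mul //; exact: span_sem.
have kN : k <= N by apply: aN; rewrite msupE.
have [alpha0 a0k aE] := monom_factor alpha k.
have a0N j : j \in msup alpha0 -> j <= N.
  by rewrite msupE => a0j; apply: aN; rewrite msupE aE cmM; lia.
have pN e j : j \in msup (mmul (expcmn (ucm k) e) alpha0) -> j <= N.
  rewrite msupE cmM expcmnE cmU; have [<-//|kj] := eqVneq k j.
  by rewrite muln0 -msupE; exact: a0N.
rewrite aE sem_mul //; move: (alpha k) => a {ak aE alpha aN}.
(* Straightening either lowers the exponent a at k, or raises k in the extra factor. Once k exceeds
   N, alpha has no factor there and the outer induction ends. *)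
elim: a d => [|a IHa] d; first by rewrite elem_le0 mul1r -sem_mul //; exact: span_sem.
rewrite mulrA straighten mulrBl mulrDl -!mulrA; apply: spanB; first apply: spanD.
- exact: IHa.
- by rewrite -sem_mul //; apply: IH => //; [lia | exact: pN].
- by rewrite -sem_mul //; apply: IH => //; [lia | exact: pN].
Qed.

Lemma span_elem_le k d f : sem_span f -> sem_span (elem_le k d * f).
Proof.
move=> [r ->]; rewrite mulr_sumr; elim: r => [|p r IH].
  by rewrite big_nil; exact: span0.
rewrite big_cons; apply: spanD IH; rewrite mulrCA; apply: spanZ.
have [n nb] := seq_int_bound (msup p.2).
by apply: (@span_elem_le_sem n%:Z) => i /nb; lia.
Qed.

Lemma span_X k f : sem_span f -> sem_span (X k * f).
Proof.
move=> fS; have := elem_leS (k - 1) 0; rewrite subrK elem_le0 mulr1 => Ek.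
have -> : X k = elem_le k 1 - elem_le (k - 1) 1 by rewrite Ek addrC addKr.
by rewrite mulrBl; apply: spanB; exact: span_elem_le.
Qed.

Lemma span_gprod k l : sem_span (gprod 1 (fun j => j <= k) l).
Proof.
rewrite /gprod; elim: l => [|d l IH]; last by rewrite big_cons; exact: span_elem_le.
rewrite big_nil (_ : 1 = (sem mone : fps)); first exact: span_sem.
by rewrite semE /msup mdom1 big_seq_fset0.
Qed.

Lemma span_U i (f : (int -> int) -> fps) : (forall w, sem_span (f w)) ->
  forall w, sem_span (U i f w).
Proof. by move=> fS w; rewrite /U; case: ifP => _ //; exact: span0. Qed.

Lemma span_A i n k (f : (int -> int) -> fps) : (forall w, sem_span (f w)) ->
  forall w, sem_span (A i n (X k) f w).
Proof.
move=> fS; elim: n i => //= n IH i w.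
by apply: spanD (IH _ _) _; apply: span_X; apply: span_U.
Qed.

Lemma span_Aflag M i r (f : (int -> int) -> fps) : (forall w, sem_span (f w)) ->
  forall w, sem_span (Aflag X M i r f w).
Proof. by elim: r i f => //= r IH i f fS; apply: IH; exact: span_A. Qed.

Lemma msup_mon_perm i s :
  perm_eq [seq mon i s j | j <- msup (mon i s)] [seq k <- s | k != 0%N].
Proof.
rewrite -{3}(map_mon i s) filter_map; apply: perm_map; apply: uniq_perm.
- exact: fset_uniq.
- by rewrite filter_uniq // vars_uniq.
move=> j; rewrite mem_filter /= msupE mem_vars.
case: eqP => //= /eqP; rewrite -msupE => /msup_mon ->.
by [].
Qed.

Lemma act_exponents (a : nat -> ((int -> int) -> rat) -> (int -> int) -> rat) i s f : a 0%N = id ->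
    (forall (p q : nat) g, a p (a q g) = a q (a p g)) ->
  act a [seq mon i s j | j <- msup (mon i s)] f = act a s f.
Proof.
move=> a0 aC; rewrite -(act_filter s f a0); apply: act_perm => //.
exact: msup_mon_perm.
Qed.

Section BackStableSpan.
Variables (n : nat) (w : int -> int).
Hypotheses (wS : supported (- n%:Z) n%:Z w) (w_inj : injective w).

(* The factors of the variables below the support of w. *)
Definition lower_part : (int -> int) -> fps := fun v b =>
  if all (fun j => j <= - n%:Z - 1) (msup b)
  then act (arange n%:Z (- n%:Z)) [seq b j | j <- msup b] (delta rat) v else 0.

(** It is a symmetric function of the variables x_j with j < -n, hence a combination of products of
    the e_d(..., x_(-n-1)). *)
Lemma lower_part_span v : sem_span (lower_part v).
Proof.
have [c cE] := act_expansion n v.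
rewrite (_ : lower_part v = \sum_(l <- parts (inversions (- n%:Z) (n + n).+1 v))
    (constf (c l) : fps) * gprod 1 (fun j => j <= - n%:Z - 1) l).
  by apply: span_sum => l _; apply: spanZ; exact: span_gprod.
apply/funext => b; rewrite fps_sumE /lower_part cE; case: ifPn => bV.
  by apply: eq_bigr => l _; rewrite constfM_coef gprodE bV.
by rewrite big1 // => l _; rewrite constfM_coef gprodE (negPf bV) mulr0.
Qed.

(** The product is cut at the variable x_(-n). The factors to the left form [lower_part], those with
    index n or more are trivial, and n + n factors remain. *)
Lemma back_stable_Aflag :
  back_stable_schubert w = Aflag X n%:Z (- n%:Z) (n + n) lower_part w.
Proof.
apply/funext => b; have [m mb] := seq_int_bound (msup b).
(* The range [-M, M] contains the variables of b and reaches down to -n; s1 collects the exponents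
   of the variables below x_(-n), s2 the others. *)
pose M := maxn n m; pose s := [seq b j | j <- vars (- M%:Z) (M + M).+1].
have bE : b = mon (- M%:Z) s by rewrite mon_map // => j /mb; rewrite /M; lia.
have ss : size s = (M + M).+1 by rewrite size_map size_vars.
pose s1 := take (M - n) s; pose s2 := drop (M - n) s.
have nM : (n <= M)%N by rewrite /M; lia.
have s1s : size s1 = (M - n)%N by rewrite size_takel // ss; lia.
have s2s : size s2 = (n + n + (M - n).+1)%N by rewrite size_drop ss; lia.
have e : - M%:Z + (size s1)%:Z = - n%:Z by rewrite s1s; lia.
rewrite bE -(cat_take_drop (M - n) s) -/s1 -/s2 (back_stable_coef wS w_inj).
rewrite flagged_cat mon_cat e.
have -> : Aflag X n%:Z (- n%:Z) (n + n) lower_part = Aflag X n%:Z (- n%:Z) (size s2) lower_part.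
  by rewrite s2s [RHS]Aflag_add [RHS]Aflag_id //; lia.
have c1 j : j \in msup (mon (- M%:Z) s1) -> j < - n%:Z.
  by move=> /msup_mon; rewrite e => /andP[].
rewrite Aflag_coef //; last first.
  move=> v c cV; rewrite /lower_part ifN //; apply: contraNN cV.
  by apply: sub_all => j; lia.
apply: eq_on_flagged wS => v vS; rewrite /lower_part.
rewrite ifT; last by apply/allP => j /c1; lia.
rewrite act_exponents; [|exact: arange0|exact: arange_comm].
by apply: flagged_below vS; rewrite ?e; lia.
Qed.

Lemma back_stable_span : sem_span (back_stable_schubert w).
Proof. by rewrite back_stable_Aflag; apply: span_Aflag; exact: lower_part_span. Qed.
End BackStableSpan.

Lemma span_expansion (f : fps) : sem_span f -> exists c, expansion sem f c.
Proof.
move=> [r ->]; pose F := [fset p.2 | p in r]%fset.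
exists (fun alpha => \sum_(p <- r | p.2 == alpha) p.1); split.
  apply: (@sub_finite_set _ _ [set` F]); last exact: finite_fset.
  move=> alpha /=; apply: contraNT => aF; rewrite big1_seq // => p /andP[/eqP pa pr].
  by case/negP: aF; apply/imfsetP; exists p.
move=> b; rewrite fps_sumE (@fsbigTE _ _ _ _ F) => [|alpha aF]; last first.
  rewrite big1_seq ?mul0r // => p /andP[/eqP pa pr].
  by case/negP: aF; apply/imfsetP; exists p.
under [RHS]eq_bigr do rewrite mulr_suml big_mkcond /=.
rewrite exchange_big; apply: eq_big_seq => p pr.
have pF : p.2 \in F by apply/imfsetP; exists p.
rewrite constfM_coef (big_fsetD1 _ pF) /= eqxx big1_seq ?addr0 // => alpha.
by rewrite in_fsetD1 eq_sym => /andP[_ /andP[/negPf ->]].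
Qed.

End SemSpan.

(** * Comparison of coefficients *)

Section Comparison.
Implicit Types (alpha : tuples) (w : int -> int).

Definition exponents alpha : seq nat := [seq alpha i | i <- msup alpha].

Lemma exponents_neq0 alpha : [seq d <- exponents alpha | d != 0%N] = exponents alpha.
Proof.
by apply/all_filterP/allP => d /mapP[i]; rewrite msupE => ia ->.
Qed.

Lemma exponents_part alpha : is_part (sort geq (exponents alpha)).
Proof. by rewrite -exponents_neq0; exact: sort_filter_part. Qed.

Definition part_of alpha : intpart := exist _ (sort geq (exponents alpha)) (exponents_part alpha).

Lemma OrbE l alpha : Orb l alpha <-> part_of alpha = l.
Proof. by split=> [al|<-] //; apply: val_inj. Qed.

Lemma prod_local (I : eqType) (r : seq I) (F G : I -> fps) b :
    (forall i c, i \in r -> divides c b -> F i c = G i c) ->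
  (\prod_(i <- r) F i) b = (\prod_(i <- r) G i) b.
Proof.
elim: r b => [|i r IH] b FG; first by rewrite !big_nil.
rewrite !big_cons; apply: fps_local => c cb; first by apply: FG; rewrite ?mem_head.
apply: IH => j d jr dc; apply: FG; first by rewrite in_cons jr orbT.
by move=> k; apply: leq_trans (dc k) (cb k).
Qed.

(* On monomials in variables below all the indices of alpha, all the factors of
   sem alpha look like elementary symmetric functions in all variables. *)
Lemma sem_below alpha i s : (forall j, j \in msup alpha -> i + (size s)%:Z - 1 <= j) ->
  sem alpha (mon i s) = cnt 1 (exponents alpha) s.
Proof.
move=> ai; rewrite (cnt_gprod _ _ _ i) semE /gprod big_map; apply: prod_local => j c ja cb.
rewrite /elem_le /gsym; congr ((_ && _)%:R); apply: eq_in_all => k kc /=.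
have -> // : k <= j.
have := ai j ja; have /msup_mon : k \in msup (mon i s); last by lia.
by move: kc; rewrite !msupE -!lt0n => /leq_trans; apply.
Qed.

(** The chosen expansion has finite support, so a monomial can be moved to the left of all its
    indices. There each SEM has the coefficient of e_lambda, with lambda the sorted exponents of its
    tuple, and the left side has that of F_w. The orbit sums are therefore coefficients of an
    e-expansion of F_w. *)
Lemma kappa_sum w l : S_Z w ->
  \sum_(alpha \in Orb l) kappa w alpha = coef e_ (stanley w) l.
Proof.
move=> wSZ; have [w_inj [n wS]] := S_Z_supported wSZ.
have [c0 c0E] := span_expansion (back_stable_span wS w_inj).
have kE : expansion sem (back_stable_schubert w) (kappa w) :=
  xgetPex (fun=> 0) (ex_intro _ c0 c0E).
have kfin : finite_set [set alpha | kappa w alpha != 0] by case: kE.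
pose F := fset_set [set alpha | kappa w alpha != 0].
have memF alpha : (alpha \in F) = (kappa w alpha != 0).
  by rewrite in_fset_set //; apply/idP/idP; rewrite inE.
have k0 alpha : alpha \notin F -> kappa w alpha = 0 by rewrite memF negbK => /eqP.
pose d l' := \sum_(alpha <- F | part_of alpha == l') kappa w alpha.
have dE l' : \sum_(alpha \in Orb l') kappa w alpha = d l'.
  rewrite fsbig_mkcond (@fsbigTE _ _ _ _ F) => [|alpha /k0 aF].
    rewrite /d [RHS]big_mkcond; apply: eq_bigr => alpha _; rewrite patchE.
    by rewrite (_ : (alpha \in Orb l') = (part_of alpha == l')) //; apply/idP/eqP; rewrite inE OrbE.
  by rewrite patchE aF; case: ifP.
rewrite dE; suff /coef_e -> : expansion e_ (stanley w) d by [].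
pose G := [fset part_of alpha | alpha in F]%fset.
have d0 l' : l' \notin G -> d l' = 0.
  move=> lG; rewrite /d big1_seq // => alpha /andP[/eqP al aF].
  by case/negP: lG; apply/imfsetP; exists alpha.
split.
  apply: (@sub_finite_set _ _ [set` G]); last exact: finite_fset.
  by move=> l' /=; apply: contraNT => /d0 ->.
move=> b; rewrite (@fsbigTE _ _ _ _ G) => [|l' /d0 ->]; last by rewrite mul0r.
have [/mon1_ex[s ->]|b1] := boolP (all (fun j => 1 <= j) (msup b)); last first.
  rewrite (stanley_off wS w_inj b1) big1 // => l' _.
  by rewrite e_E gprod0 ?mulr0.
have [N Nb] := seq_int_bound (flatten [seq (msup alpha : seq int) | alpha <- F]).
(* Large enough for [stanley_shift], and such that the variables x_(1-m), ..., x_(size s - m) all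
   lie below -N, hence below every index in the expansion. *)
pose m := (n + size s + N).+1.
rewrite (@stanley_shift _ _ wS w_inj _ m); last by rewrite /m; lia.
have kF alpha : kappa w alpha != 0 -> alpha \in F by rewrite memF.
rewrite (expansionE kE kF).
transitivity (\sum_(alpha <- F) kappa w alpha * e_ (part_of alpha) (mon 1 s)).
  apply: eq_big_seq => alpha aF; congr (_ * _).
  rewrite sem_below => [|j ja].
    rewrite e_E gprod_mon ?vars1_pos //; apply: cnt_perml.
    by rewrite perm_sym perm_sort.
  have : j \in flatten [seq (msup alpha : seq int) | alpha <- F].
    apply/flattenP; exists (msup alpha : seq int) => //.
    exact: (map_f (fun alpha => msup alpha : seq int) aF).
  by move/Nb; rewrite /m; lia.
under [RHS]eq_bigr do rewrite mulr_suml big_mkcond /=.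
rewrite exchange_big; apply: eq_big_seq => alpha aF.
have aG : part_of alpha \in G by apply/imfsetP; exists alpha.
rewrite (big_fsetD1 _ aG) /= eqxx big1_seq ?addr0 // => l'.
by rewrite in_fsetD1 eq_sym => /andP[_ /andP[/negPf ->]].
Qed.

Lemma hat_tupleE alpha i : hat_tuple alpha i = alpha (- i).
Proof. by rewrite -{1}(opprK i) renameE //; exact: oppr_inj. Qed.

Lemma hat_tupleK : involutive hat_tuple.
Proof. by move=> alpha; apply: cmonom_ext => i; rewrite !hat_tupleE opprK. Qed.

Lemma part_of_hat alpha : part_of (hat_tuple alpha) = part_of alpha.
Proof.
have geq_total : total geq by move=> x y; exact: leq_total.
have geq_anti : antisymmetric geq.
  by move=> x y /andP[xy yx]; apply/eqP; rewrite eqn_leq; apply/andP.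
apply: val_inj; apply/(perm_sortP geq_total (rev_trans leq_trans) geq_anti).
rewrite /exponents.
have -> : [seq hat_tuple alpha i | i <- msup (hat_tuple alpha)] =
    [seq alpha i | i <- [seq - i | i <- msup (hat_tuple alpha)]].
  by rewrite -map_comp; apply: eq_map => i; rewrite hat_tupleE.
apply: perm_map; apply: uniq_perm; rewrite ?map_inj_uniq ?fset_uniq //; try exact: oppr_inj.
move=> i; rewrite -(mem_map oppr_inj) -map_comp (eq_map (g := id)); last by move=> j /=; rewrite opprK.
by rewrite map_id !msupE hat_tupleE opprK.
Qed.

End Comparison.

Theorem theorem5p4 (w : int -> int) (hw : S_Z w) (l : intpart) :
  \sum_(alpha \in Orb l) kappa w alpha = coef e_ (stanley w) l /\
  \sum_(alpha \in Orb l) kappa (hat w) (hat_tuple alpha)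
    = coef h_ (stanley w) l.
Proof.
split; first exact: kappa_sum.
have [w_inj [n wS]] := S_Z_supported hw.
have hS := supported_hat wS; have h_inj := hat_inj w_inj.
(* The first identity is applied to [hat w], whose e-coefficients are the h-coefficients for its own
   reversal w; reversing tuples permutes each orbit. *)
have -> : stanley w = stanley (hat (hat w)) by rewrite hatK.
rewrite -(coef_e_stanley_hat hS h_inj) -(kappa_sum _ (supported_S_Z hS h_inj)).
apply/esym/reindex_fsbig; split.
- by move=> alpha /OrbE al; apply/OrbE; rewrite part_of_hat.
- by move=> alpha beta _ _ /(can_inj hat_tupleK).
- move=> alpha /OrbE al; exists (hat_tuple alpha); last exact: hat_tupleK.
  by apply/OrbE; rewrite part_of_hat.
Qed.
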